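(* Let $\mathrm{un}_4(n,e)$ denote the maximum number of edges of a $4$-graph $\mathcal{H}$ that is $(n,e)$-unavoidable. Then: \begin{enumerate} \item[(i)] For $1\le e\le n^2$ we have $\mathrm{un}_4(n,e)\approx 1$. \item[(ii)] For $n^2\le e\le n^3$ we have $\mathrm{un}_4(n,e)\approx \min\{(e/n^2)^{3/4},(e/n)^{1/3}\}$. \item[(iii)] For $n^3<e\ll \binom{n}{4}$ we have $\mathrm{un}_4(n,e)\approx \min\Big\{e^{4/3}/n^{10/3},\ \frac{e^{1/4}\log n}{\log\left(\binom{n}{4}/e\right)}\Big\}$. \end{enumerate}
   Context: An $r$-graph is an $r$-uniform hypergraph. An $r$-graph $\mathcal{H}$ is called $(n,e)$-unavoidable if every $r$-graph on $n$ vertices with $e$ edges contains a copy of $\mathcal{H}$ as a subhypergraph; $\mathrm{un}_r(n,e)$ is the maximum number of edges of an $(n,e)$-unavoidable $r$-graph. Asymptotic notation is as $n\to\infty$: $f\approx g$ means there are absolute constants $c,C>0$ with $cg\le f\le Cg$ (for all sufficiently large $n$ and all $e$ in the stated range); $f\ll g$ means $f\le c g$ for a sufficiently small absolute constant $c>0$ (so part (iii) asserts the estimate for all $e$ with $n^3<e\le c\binom{n}{4}$ for a suitable absolute constant $c>0$). *)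

(* Defs.v *)
From mathcomp Require Import all_boot all_order all_algebra.
From mathcomp Require Import boolp classical_sets reals exp.

Set Implicit Arguments.
Unset Strict Implicit.
Unset Printing Implicit Defensive.

Import Order.TTheory GRing.Theory Num.Theory.

Definition uniform (r : nat) (T : finType) (H : {set {set T}}) : Prop :=
  forall A, A \in H -> #|A| = r.

Definition contains_copy (T U : finType) (H : {set {set T}})
    (G : {set {set U}}) : Prop :=
  exists2 f : T -> U, injective f & forall A, A \in H -> f @: A \in G.

Definition unavoidable (r n e : nat) (T : finType) (H : {set {set T}}) : Prop :=
  forall G : {set {set 'I_n}}, uniform r G -> #|G| = e -> contains_copy H G.

Definition attains_un (r n e m : nat) : Prop :=
  exists (T : finType) (H : {set {set T}}),
    [/\ uniform r H, unavoidable r n e H & #|H| = m].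

Definition is_un (r n e m : nat) : Prop :=
  attains_un r n e m /\ forall m', attains_un r n e m' -> (m' <= m)%N.

(* The junk value 0 is only used when no maximum exists; [un_spec] below shows
   that it does exist whenever e <= 'C(n, r).  For larger e no r-graph on n
   vertices has e edges, so that every r-graph is vacuously unavoidable. *)
Definition un (r n e : nat) : nat := xget 0%N [set m | is_un r n e m]%classic.

Lemma un_spec (r n e : nat) : (e <= 'C(n, r))%N -> is_un r n e (un r n e).
Proof.
move=> le_e; have ub m : attains_un r n e m -> (m <= e)%N.
  case=> T [H [_ Hun <-]].
  have [B [sB uB cB]] : exists B : seq {set 'I_n},
      [/\ subseq B (enum [set A : {set 'I_n} | #|A| == r]), uniq B
        & size B = e].
    exists (take e (enum [set A : {set 'I_n} | #|A| == r])).
    rewrite take_subseq take_uniq ?enum_uniq //; split=> //.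
    by rewrite size_takel // -cardE card_draws card_ord.
  have [] := Hun [set x in B].
  - move=> A; rewrite inE => /(mem_subseq sB).
    by rewrite mem_enum inE => /eqP.
  - by rewrite cardsE (card_uniqP uB).
  move=> f fI fH; rewrite -cB -(card_uniqP uB) -(cardsE (mem B)).
  rewrite -(card_imset (mem H) (imset_inj fI)); apply: subset_leq_card.
  by apply/fintype.subsetP => _ /imsetP[A AH ->]; exact: fH.
have ex0 : exists m, `[< attains_un r n e m >].
  exists 0%N; apply/asboolP; exists 'I_0, finset.set0.
  split; last exact: cards0.
    by move=> A; rewrite finset.in_set0.
  move=> G _ _.
  have f0 (i : 'I_0) : 'I_n by case: i.
  by exists f0 => [[]//|A]; rewrite finset.in_set0.
have ubb m : `[< attains_un r n e m >] -> (m <= e)%N by move/asboolP/ub.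
case: (ex_maxnP ex0 ubb) => m /asboolP am maxm.
suff : [set m | is_un r n e m]%classic (un r n e) by [].
apply: (@xgetPex _ 0%N [set m | is_un r n e m]%classic).
exists m; split; [exact: am | by move=> m' am'; apply/maxm/asboolP].
Qed.

Local Open Scope ring_scope.

Definition approx_on (R : realType) (D : nat -> nat -> Prop)
    (f g : nat -> nat -> R) : Prop :=
  exists c C : R, [/\ 0 < c, 0 < C & exists n0 : nat, forall n e : nat,
    (n0 <= n)%N -> D n e -> c * g n e <= f n e <= C * g n e].

(* Main.v *)
Require Import Defs.
From mathcomp Require Import all_boot all_order all_algebra.
From mathcomp Require Import boolp classical_sets reals exp.
From mathcomp Require Import fintype finset.
From mathcomp Require Import zify ring lra.

Set Implicit Arguments.
Unset Strict Implicit.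
Unset Printing Implicit Defensive.

Import Order.TTheory GRing.Theory Num.Theory.

(* Upper bounds.  Let H be (n,e)-unavoidable.  If phi colours the 4-subsets of
   [n] with c colours and c * e <= C(n,4), then some colour class has at least e
   members, so H embeds in it and all its images have the same phi-value.  With
   phi built from the elements of a 4-set sorted increasingly and reduced modulo
   M, this bounds the vertex cover of H, the number of vertices of H, the number
   of vertices of a star of H, pair degrees and (with phi the sum of the elements
   modulo n, cut into intervals) triple degrees.  Counting the pairs (G, copy of
   H in G) over all G with e edges gives moreover C(n,4)^m <= e^m * n^|V(H)| with
   m = |H|.  Combining these yields the upper bounds in all ranges.

   Lower bounds.  For (ii) and the sparse part of (iii) the witness is a disjoint
   union of r "stars": trees of depth three in which a centre has a children,
   each of these b children, each of those c children, and the edges are the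
   root-to-leaf paths.  In an arbitrary G with e edges, call u heavy over a set S
   when u takes at least a 1/m share of the edges through S; there are at most m
   such u.  Edges which cannot be ordered so as to avoid the relevant heavy sets
   are few, and the star forest is embedded greedily along the others.  In the
   dense part of (iii) the witness is a disjoint union of complete bipartite
   K_{q,m}, each with two extra vertices added to all edges, found by the
   Kovari-Sos-Turan argument. *)

(** The exponents come from block sizes. About n^4/e colours are available, so colouring by k
    residues leaves blocks of about n (e/n^4)^(1/k) vertices: k = 1 gives covers of size e/n^3, k =
    3 stars on (e/n)^(1/3) vertices, k = 4 at most e^(1/4) vertices in all. The first two multiply
    to e^(4/3)/n^(10/3), and counting copies turns e^(1/4) vertices into the logarithmic term. The
    obstacle above is (e/n^2)^(3/4) in (ii): it takes several colourings of one star. Each colouring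
    comes with its own embedding, so only its combinatorial trace on H (a cover, a degree bound,
    sets [W] and [N]) is kept, and [star_chunk_bound] combines the traces. The obstacle below is
    that a few vertices may carry most edges of an arbitrary G, so that vertices already used could
    block the greedy choice. Hence every edge chooses its own ordering, and losses are measured
    against the degree of the vertex or pair at hand rather than against e. *)

Lemma subset_of_card (T : finType) (A : {set T}) k :
  k <= #|A| -> exists2 B : {set T}, B \subset A & #|B| = k.
Proof.
move=> kA; exists [set x in take k (enum A)].
  by apply/subsetP => x; rewrite inE => /mem_take; rewrite mem_enum.
by rewrite cardsE (card_uniqP _) ?take_uniq ?enum_uniq // size_takel // -cardE.
Qed.

Lemma unavoidable_sub r n e (T : finType) (H H' : {set {set T}}) :
  H' \subset H -> unavoidable r n e H -> unavoidable r n e H'.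
Proof.
move=> /subsetP sub HH G uG cG; have [f fi fH] := HH G uG cG.
by exists f => // A /sub; exact: fH.
Qed.

Lemma unavoidable_leq r n e (T : finType) (H : {set {set T}}) (G : {set {set 'I_n}}) :
  unavoidable r n e H -> uniform r G -> e <= #|G| -> contains_copy H G.
Proof.
move=> HH uG /subset_of_card[B /subsetP BG cB].
have [|f fi fH] := HH B _ cB; first by move=> A /BG; exact: uG.
by exists f => // A /fH /BG.
Qed.

Lemma unavoidable_mono r n e e' (T : finType) (H : {set {set T}}) :
  e <= e' -> unavoidable r n e H -> unavoidable r n e' H.
Proof. by move=> ee HH G uG cG; apply: unavoidable_leq HH uG _; rewrite cG. Qed.

Lemma uniform_sub r (T : finType) (H H' : {set {set T}}) :
  H' \subset H -> uniform r H -> uniform r H'.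
Proof. by move=> /subsetP sub uH A /sub; exact: uH. Qed.

Lemma unavoidable_color r n e (T F : finType) (H : {set {set T}})
    (phi : {set 'I_n} -> F) :
  unavoidable r n e H -> #|F| * e <= 'C(n, r) ->
  exists c, exists2 f : T -> 'I_n, injective f &
    forall A, A \in H -> phi (f @: A) = c.
Proof.
move=> HH Fe; pose cl c := [set A : {set 'I_n} | (#|A| == r) && (phi A == c)].
have [c ec] : exists c, e <= #|cl c|.
  apply/existsP; apply: contraT; rewrite negb_exists => /forallP clt.
  have F0 : 0 < #|F| by apply/card_gt0P; exists (phi set0).
  have : 'C(n, r) = \sum_c #|cl c|.
    rewrite -[in LHS](card_ord n) -card_draws -sum1_card.
    rewrite (partition_big phi xpredT) //=; apply: eq_bigr => c _.
    by rewrite -sum1_card; apply: eq_bigl => A; rewrite !inE.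
  have le : \sum_c #|cl c| <= \sum_(c : F) e.-1.
    by apply: leq_sum => c _; have := clt c; case: (e) => // e'; rewrite -ltnNge ltnS.
  have e0 : 0 < e by have := clt (phi set0); case: (e).
  move: le Fe; rewrite sum_nat_const => le Fe eq.
  by have := leq_trans Fe (leq_trans (eq_leq eq) le); rewrite leq_mul2l; lia.
exists c; have [|f fi fH] := unavoidable_leq HH _ ec.
  by move=> A; rewrite inE => /andP[/eqP].
by exists f => // A /fH; rewrite inE => /andP[_ /eqP].
Qed.

(** * Upper bounds by colourings *)

(** Elements are read as natural numbers, so that a default value exists for every [n] and [inZp]
    can reduce them. The colourings rest on two facts: positions below [#|A|] give distinct
    elements, and every element of [A] has such a position. *)
Definition elt n (A : {set 'I_n}) i := nth 0 [seq val x | x <- enum A] i.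

Lemma eltP n (A : {set 'I_n}) i : i < #|A| -> exists2 u, u \in A & elt A i = u.
Proof.
move=> iA; have [x0 _] : exists x, x \in A by apply/card_gt0P/(leq_ltn_trans _ iA).
exists (nth x0 (enum A) i); first by rewrite -mem_enum mem_nth // -cardE.
by rewrite /elt (nth_map x0) // -cardE.
Qed.

Lemma elt_index n (A : {set 'I_n}) u : u \in A -> exists2 i, i < #|A| & elt A i = u.
Proof.
move=> uA; exists (index u (enum A)); first by rewrite cardE index_mem mem_enum.
by rewrite /elt (nth_map u) ?nth_index ?index_mem ?mem_enum.
Qed.

Lemma elt_inj n (A : {set 'I_n}) i j : i < #|A| -> j < #|A| -> elt A i = elt A j -> i = j.
Proof.
move=> iA jA /eqP; rewrite nth_uniq ?size_map -?cardE ?map_inj_uniq ?enum_uniq //.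
  by move/eqP.
exact: val_inj.
Qed.

Lemma eltS n (T : finType) (f : T -> 'I_n) (A : {set T}) i : injective f -> i < #|A| ->
  exists2 u, u \in A & elt (f @: A) i = f u.
Proof.
move=> fi iA; have [|y /imsetP[u uA ->] ->] := @eltP _ (f @: A) i.
  by rewrite card_imset.
by exists u.
Qed.

Lemma eltS_index n (T : finType) (f : T -> 'I_n) (A : {set T}) u : injective f -> u \in A ->
  exists2 i, i < #|A| & elt (f @: A) i = f u.
Proof.
move=> fi uA; have [|i iA e] := @elt_index _ (f @: A) (f u).
  exact: imset_f.
by exists i => //; rewrite -(card_imset (mem A) fi).
Qed.

(** The residue is fixed, so the quotient by [M.+1] determines the element; quotients run from 0 to
    [n %/ M.+1]. *)
Lemma card_block n M (c : 'I_M.+1) : #|[set x : 'I_n | inZp x == c]| <= (n %/ M.+1).+1.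
Proof.
rewrite -[X in _ <= X]card_ord.
pose g (x : 'I_n) : 'I_(n %/ M.+1).+1 := inord (x %/ M.+1).
rewrite -(@card_in_imset _ _ g) ?max_card // => x y.
rewrite !inE => /eqP xc /eqP yc e0; have := congr1 (@nat_of_ord _) e0; rewrite /g !inordK ?ltnS ?leq_div2r //; try exact: ltnW.
move=> e; apply: val_inj; rewrite /= (divn_eq x M.+1) (divn_eq y M.+1) e.
by move/(congr1 val): xc; move/(congr1 val): yc => /= -> ->.
Qed.

Lemma card_preim_inj (T U : finType) (f : T -> U) (B : {set U}) : injective f ->
  #|f @^-1: B| <= #|B|.
Proof.
move=> fi; rewrite -(card_imset _ fi); apply: subset_leq_card.
by apply/subsetP => _ /imsetP[x + ->]; rewrite inE.
Qed.

Lemma card_block_preim n (T : finType) (f : T -> 'I_n) M (c : 'I_M.+1) : injective f ->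
  #|[set x | inZp (f x) == c]| <= (n %/ M.+1).+1.
Proof.
move=> fi; apply: leq_trans (card_block n c).
apply: leq_trans (card_preim_inj _ fi); apply: subset_leq_card.
by apply/subsetP => x; rewrite !inE.
Qed.

Lemma card_bigcup_leq (I T : finType) (P : pred I) (F : I -> {set T}) :
  #|\bigcup_(i | P i) F i| <= \sum_(i | P i) #|F i|.
Proof.
elim/big_rec2: _ => [|i m A _ Am]; first by rewrite cards0.
by rewrite (leq_trans (leq_card_setU _ _)) // leq_add2l.
Qed.

Definition star (T : finType) (H : {set {set T}}) v := [set A in H | v \in A].

Section Colourings.
Variables (n e : nat) (T : finType) (H : {set {set T}}).
Hypotheses (uH : uniform 4 H) (unH : unavoidable 4 n e H).

Let blk M (f : T -> 'I_n) (c : 'I_M.+1) := [set x | inZp (f x) == c].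

(** Colour by the residue of the smallest element: each edge then has a vertex mapped into one fixed
    residue class, whose preimage is the cover. *)
Lemma cover_bound M : M.+1 * e <= 'C(n, 4) ->
  exists2 B : {set T}, #|B| <= (n %/ M.+1).+1 & forall A, A \in H -> exists2 v, v \in A & v \in B.
Proof.
move=> eN; have [|c [f fi fc]] :=
  @unavoidable_color 4 n e T 'I_M.+1 H (fun A => inZp (elt A 0)) unH.
  by rewrite card_ord.
exists (blk f c); first exact: card_block_preim.
move=> A AH; have [|u uA eu] := @eltS _ _ f A 0 fi; first by rewrite uH.
by exists u => //; rewrite inE -(fc _ AH) eu.
Qed.

(* Colour by the residues of the two smallest elements. *)
Lemma pair_cover_bound M : M.+1 ^ 2 * e <= 'C(n, 4) ->
  exists2 B : {set T}, #|B| <= 2 * (n %/ M.+1).+1 &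
    forall A v, A \in H -> exists u, [/\ u \in A, u \in B & u != v].
Proof.
move=> eN; have [|[c1 c2] [f fi fc]] :=
  @unavoidable_color 4 n e T ('I_M.+1 * 'I_M.+1)%type H
    (fun A => (inZp (elt A 0), inZp (elt A 1))) unH.
  by rewrite card_prod !card_ord -mulnn in eN *.
exists (blk f c1 :|: blk f c2).
  by rewrite mul2n -addnn (leq_trans (leq_card_setU _ _)) // leq_add // card_block_preim.
move=> A v AH.
have [|u1 u1A e1] := @eltS _ _ f A 0 fi; first by rewrite uH.
have [|u2 u2A e2] := @eltS _ _ f A 1 fi; first by rewrite uH.
have u12 : u1 != u2.
  apply/eqP => uu; move: e2; rewrite -uu -e1 => /elt_inj.
  by rewrite card_imset // uH // => /(_ isT isT).
have [c1E c2E] := fc _ AH.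
have [<-|nv] := eqVneq u1 v.
  exists u2; split; [by [] | | by rewrite eq_sym].
  by rewrite !inE -c2E e2 eqxx orbT.
by exists u1; split; rewrite // !inE -c1E e1 eqxx.
Qed.

(* Colour by the residues of all four elements. *)
Lemma clique_bound M : M.+1 ^ 4 * e <= 'C(n, 4) -> #|cover H| <= 4 * (n %/ M.+1).+1.
Proof.
move=> eN; have [|c [f fi fc]] :=
  @unavoidable_color 4 n e T {ffun 'I_4 -> 'I_M.+1} H
    (fun A => [ffun i : 'I_4 => inZp (elt A i)]) unH.
  by rewrite card_ffun !card_ord.
have sub : cover H \subset \bigcup_(i : 'I_4) blk f (c i).
  apply/subsetP => u /bigcupP[A AH uA].
  have [i iA ei] := eltS_index fi uA; rewrite uH // in iA.
  apply/bigcupP; exists (Ordinal iA) => //.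
  by rewrite inE -(fc _ AH) ffunE /= ei.
apply: leq_trans (subset_leq_card sub) _; apply: leq_trans (card_bigcup_leq _ _) _.
rewrite -[X in _ <= X * _](card_ord 4) -sum_nat_const.
by apply: leq_sum => i _; exact: card_block_preim.
Qed.

(* Colour by the residues of x_i - x_0: the position of v in an edge and its own
   residue then determine the residues of the other vertices. *)
Lemma star_cover_bound M v : M.+1 ^ 3 * e <= 'C(n, 4) ->
  #|cover (star H v)| <= 16 * (n %/ M.+1).+1.
Proof.
move=> eN; have [|c [f fi fc]] :=
  @unavoidable_color 4 n e T {ffun 'I_3 -> 'I_M.+1} H
    (fun A => [ffun i : 'I_3 => inZp (elt A i.+1) - inZp (elt A 0)]%R) unH.
  by rewrite card_ffun !card_ord.
(* [d i] is the offset of position [i] from position 0, so [d 0 = 0]; the 16 pairs of positions of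
   [u] and [v] give 16 residue classes. *)
pose d (i : 'I_4) : 'I_M.+1 := if i is Ordinal k.+1 _ then c (inord k) else 0%R.
have dE A i : A \in H -> inZp (elt (f @: A) (i : 'I_4)) = (d i + inZp (elt (f @: A) 0))%R.
  move=> AH; case: i => -[|k] kP /=; first by rewrite add0r.
  by rewrite -(fc _ AH) ffunE inordK // subrK.
have sub : cover (star H v) \subset
    \bigcup_(p : 'I_4 * 'I_4) blk f (d p.1 - d p.2 + inZp (f v))%R.
  apply/subsetP => u /bigcupP[A]; rewrite inE => /andP[AH vA] uA.
  have [i iA ei] := eltS_index fi uA; rewrite uH // in iA.
  have [j jA ej] := eltS_index fi vA; rewrite uH // in jA.
  apply/bigcupP; exists (Ordinal iA, Ordinal jA) => //; rewrite inE /=.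
  have := dE _ (Ordinal iA) AH; have := dE _ (Ordinal jA) AH; rewrite /= ei ej => -> ->.
  by rewrite addrA subrK.
apply: leq_trans (subset_leq_card sub) _; apply: leq_trans (card_bigcup_leq _ _) _.
have -> : 16 = #|{: 'I_4 * 'I_4}| by rewrite card_prod !card_ord.
rewrite -sum_nat_const.
by apply: leq_sum => i _; exact: card_block_preim.
Qed.

(* Colour by the interval of length K containing the sum modulo n. *)
Lemma triple_bound K : 0 < n -> 0 < K -> (n.-1 %/ K).+1 * e <= 'C(n, 4) ->
  forall u1 u2 u3, uniq [:: u1; u2; u3] ->
  #|[set A in H | [&& u1 \in A, u2 \in A & u3 \in A]]| <= K.
Proof.
move=> n0 K0 eN u1 u2 u3 uu.
pose S (A : {set 'I_n}) := (\sum_(x in A) x) %% n.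
have SN A : S A %/ K < (n.-1 %/ K).+1.
  by rewrite ltnS leq_div2r // -ltnS prednK // ltn_mod.
have [|c [f fi fc]] := @unavoidable_color 4 n e T _ H (fun A => Ordinal (SN A)) unH.
  by rewrite card_ord.
(* Within one interval the sum modulo [n] is fixed by its remainder modulo [K]. The sum and the
   three common vertices fix the fourth vertex, so [g] is injective on these edges. *)
pose g (A : {set T}) : 'I_K := Ordinal (ltn_pmod (S (f @: A)) K0).
rewrite -[X in _ <= X]card_ord -(@card_in_imset _ _ g) ?max_card // => A B.
rewrite !inE => /and4P[AH A1 A2 A3] /and4P[BH B1 B2 B3] /(congr1 val) /= gE.
have SE : S (f @: A) = S (f @: B).
  rewrite (divn_eq (S (f @: A)) K) (divn_eq (S (f @: B)) K) gE.
  by have := fc _ AH; rewrite -(fc _ BH) => /(congr1 val) /= ->.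
pose U := [set x in [:: u1; u2; u3]].
have cU : #|U| = 3 by rewrite cardsE (card_uniqP uu).
have key C : C \in H -> U \subset C -> exists2 z, C = z |: U & z \notin U.
  move=> CH UC; have /cards1P[z zE] : #|C :\: U| == 1.
    by rewrite cardsD (setIidPr UC) cU uH.
  exists z; first by rewrite -(setID C U) (setIidPr UC) zE setUC.
  by have : z \in C :\: U by [rewrite zE inE]; rewrite inE => /andP[].
have [||z AE zU] := key A => //.
  by apply/subsetP => x; rewrite !inE => /or3P[] /eqP->.
have [||y BE yU] := key B => //.
  by apply/subsetP => x; rewrite !inE => /or3P[] /eqP->.
have SUE t : t \notin U -> S (f @: (t |: U)) = (f t + \sum_(x in U) f x) %% n.
  by move=> tU; rewrite /S big_imset /= ?big_setU1 //; move=> ? ? _ _; exact: fi.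
move: SE; rewrite AE BE !SUE // => /eqP; rewrite eqn_modDr !modn_small // => /eqP zy.
by rewrite (fi _ _ (val_inj zy)).
Qed.

(** Up to constants given by the colour, the residues of the four positions are the linear forms s,
    t, s + t, s + 2t. Any two of them are independent modulo an odd number, so the residues of [v]
    and [w] at known positions determine those of the other two vertices. A third vertex thus lies
    in one block, and each triple has at most [K] edges; 16 counts the pairs of positions. *)
Lemma pair_degree_bound M K :
  (forall u1 u2 u3, uniq [:: u1; u2; u3] ->
    #|[set A in H | [&& u1 \in A, u2 \in A & u3 \in A]]| <= K) ->
  M.*2.+3 ^ 2 * e <= 'C(n, 4) ->
  forall v w, v != w ->
  #|[set A in H | (v \in A) && (w \in A)]| <= 16 * ((n %/ M.*2.+3).+1 * K).
Proof.
move=> hK eN v w vw.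
pose b (A : {set 'I_n}) i : 'I_M.*2.+3 := inZp (elt A i).
have [|[c1 c2] [f fi fc]] := @unavoidable_color 4 n e T ('I_M.*2.+3 * 'I_M.*2.+3)%type H
    (fun A => (b A 2 - b A 0 - b A 1, b A 3 - b A 0 - b A 1 - b A 1)%R) unH.
  by rewrite card_prod !card_ord -mulnn in eN *.
(* The modulus is odd, so doubling is injective. This settles positions 0 and 3, whose forms have
   determinant 2. *)
have dbl0 (x : 'I_M.*2.+3) : (x + x = 0 -> x = 0)%R.
  move=> xx; have : (x *+ M.*2.+3 = 0)%R by rewrite -mulr_natr (_ : _%:R = 0)%R ?mulr0 //; exact: (@pchar_Zp M.*2.+3 isT).
  have -> : (x *+ M.*2.+3 = x + (x + x) *+ M.+1)%R.
    by rewrite -mulr2n -mulrnA -mulrS; congr (_ *+ _)%R; lia.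
  by rewrite xx mul0rn addr0.
pose cl (p : 'I_4 * 'I_4) := [set A in H | [&& elt (f @: A) p.1 == f v :> nat, elt (f @: A) p.2 == f w :> nat & p.1 != p.2]].
have sub : [set A in H | (v \in A) && (w \in A)] \subset \bigcup_(p : 'I_4 * 'I_4) cl p.
  apply/subsetP => A; rewrite inE => /and3P[AH vA wA].
  have [i iA ei] := eltS_index fi vA; rewrite uH // in iA.
  have [j jA ej] := eltS_index fi wA; rewrite uH // in jA.
  apply/bigcupP; exists (Ordinal iA, Ordinal jA) => //.
  rewrite inE AH /= ei ej !eqxx /=; apply/eqP => -[ij].
  by move: ej; rewrite -ij ei => /val_inj /fi /eqP; apply/negP.
apply: leq_trans (subset_leq_card sub) _; apply: leq_trans (card_bigcup_leq _ _) _.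
have -> : 16 = #|{: 'I_4 * 'I_4}| by rewrite card_prod !card_ord.
rewrite -sum_nat_const; apply: leq_sum => -[i j] _ /=.
have [->|[A0 A0c]] := set_0Vmem (cl (i, j)); first by rewrite cards0.
have [l /andP[li lj]] : exists l : 'I_4, (l != i) && (l != j).
  have [l] : exists l, l \in ~: [set i; j].
    by apply/card_gt0P; rewrite cardsCs setCK card_ord cards2; case: (_ != _).
  by rewrite !inE negb_or; exists l.
have same A : A \in cl (i, j) -> b (f @: A) l = b (f @: A0) l.
  move: A0c; rewrite !inE /= => /and4P[A0H /eqP vi0 /eqP wj0 ij] /and4P[AH /eqP vi /eqP wj _].
  have bi : b (f @: A) i = b (f @: A0) i by rewrite /b vi vi0.
  have bj : b (f @: A) j = b (f @: A0) j by rewrite /b wj wj0.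
  have fe := etrans (fc _ AH) (esym (fc _ A0H)).
  have := congr1 snd fe; have /= := congr1 fst fe => {fe} /=.
  move: bi bj ij; clear -dbl0.
  set x := b (f @: A); set y := b (f @: A0) => bi bj ij e1 e2.
  (* For two edges of one colour the differences of residues satisfy the homogeneous relations, and
     they vanish at [i] and [j]. *)
  pose z k := (x k - y k)%R.
  have z2 : (z 2 = z 0 + z 1)%R.
    transitivity ((x 2 - x 0 - x 1) - (y 2 - y 0 - y 1) + (z 0 + z 1))%R; first by rewrite /z; ring.
    by rewrite e1 subrr add0r.
  have z3 : (z 3 = z 0 + z 1 + z 1)%R.
    transitivity ((x 3 - x 0 - x 1 - x 1) - (y 3 - y 0 - y 1 - y 1) + (z 0 + z 1 + z 1))%R; first by rewrite /z; ring.
    by rewrite e2 subrr add0r.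
  have zi : z i = 0%R by rewrite /z bi subrr.
  have zj : z j = 0%R by rewrite /z bj subrr.
  suff [h0 h1] : z 0 = 0%R /\ z 1 = 0%R.
    apply/eqP; rewrite -subr_eq0 -/(z l); case: l => -[|[|[|[|//]]]] lP /=.
    - by rewrite h0.
    - by rewrite h1.
    - by rewrite z2 h0 h1 addr0.
    - by rewrite z3 h0 h1 !addr0.
  have lin (s t p q : 'I_M.*2.+3) : (p = s + t -> q = s + t + t ->
      [|| (s == 0) && (t == 0), (s == 0) && (p == 0), (s == 0) && (q == 0),
          (t == 0) && (p == 0), (t == 0) && (q == 0) | (p == 0) && (q == 0)] -> s = 0 /\ t = 0)%R.
    move=> -> ->; case: (eqVneq s 0%R) => [->|s0] /=.
      rewrite !add0r; case: (eqVneq t 0%R) => [//|t0] /=.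
      by case: eqP => // /dbl0 tt; rewrite tt eqxx in t0.
    case: (eqVneq t 0%R) => [->|t0] /=; first by rewrite !addr0 (negPf s0).
    by case: eqP => //= ->; rewrite add0r (negPf t0).
  apply: lin z2 z3 _; move: ij zi zj; rewrite -[i == j]/(val i == val j) {bi bj e1 e2 dbl0}.
  by case: i => -[|[|[|[|//]]]] iP; case: j => -[|[|[|[|//]]]] jP //= _ -> ->; rewrite eqxx ?orbT.
have [x [xl _]] : exists x, b (f @: A0) l = inZp (f x) /\ x \in A0.
  move: A0c; rewrite inE => /andP[A0H _].
  by have [|x xA ex] := @eltS _ _ f A0 l fi; [rewrite uH | exists x; rewrite /b ex].
(* The vertex at position [l] lies in a fixed block and forms with [v] and [w] a triple to which
   [hK] applies; the guard [uniq] keeps the union within that hypothesis. *)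
apply: leq_trans (_ : #|\bigcup_(u in blk f (inZp (f x) : 'I_M.*2.+3))
   if uniq [:: v; w; u] then [set A in H | [&& v \in A, w \in A & u \in A]] else set0| <= _).
  apply: subset_leq_card; apply/subsetP => A Ac.
  have := same _ Ac; move: Ac; rewrite inE /= => /and4P[AH /eqP vi /eqP wj ij] bl.
  have [|u uA eu] := @eltS _ _ f A l fi; first by rewrite uH.
  have iA (k : 'I_4) : k < #|f @: A| by rewrite card_imset // uH.
  have elt_in k y : elt (f @: A) (k : 'I_4) = f y -> y \in A.
    move=> ey; have [|z zA ez] := @eltS _ _ f A k fi; first by rewrite uH.
    by move: ez; rewrite ey => /val_inj /fi ->.
  have neq k k' y y' : elt (f @: A) (k : 'I_4) = f y -> elt (f @: A) (k' : 'I_4) = f y' -> k != k' -> y != y'.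
    move=> ey ey'; apply: contraNneq => yy; apply/eqP/val_inj/(elt_inj (iA k) (iA k')).
    by rewrite ey ey' yy.
  have nvu : v != u by apply: neq vi eu _; rewrite eq_sym.
  have nwu : w != u by apply: neq wj eu _; rewrite eq_sym.
  apply/bigcupP; exists u.
    by rewrite inE; apply/eqP; rewrite -xl -bl /b eu.
  by rewrite /= !inE negb_or vw nvu nwu inE AH uA (elt_in i) // (elt_in j).
apply: leq_trans (card_bigcup_leq _ _) _.
apply: leq_trans (_ : \sum_(u in blk f (inZp (f x) : 'I_M.*2.+3)) K <= _).
  by apply: leq_sum => u _; case: ifP => [|_]; [exact: hK | rewrite cards0].
by rewrite sum_nat_const leq_mul2r card_block_preim ?orbT.
Qed.

(* Colour by the residue of x_0 - x_1 and by the interval of length p containing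
   the residue of x_0. *)
Lemma chunk_bound M p : 0 < p -> M.+1 * (M %/ p).+1 * e <= 'C(n, 4) ->
  exists (W : {set T}) (N : T -> {set T}),
  [/\ #|W| <= 2 * p * (n %/ M.+1).+1, forall u, #|N u| <= 2 * (n %/ M.+1).+1 &
   forall A, A \in H -> exists u u', [/\ u \in A, u' \in A, u != u' &
     [/\ u \in W, u' \in W, u' \in N u & u \in N u']]].
Proof.
move=> p0 eN; pose b (A : {set 'I_n}) i : 'I_M.+1 := inZp (elt A i).
have bp A : b A 0 %/ p < (M %/ p).+1 by rewrite ltnS leq_div2r // -ltnS.
have [|[d c] [f fi fc]] := @unavoidable_color 4 n e T ('I_M.+1 * 'I_(M %/ p).+1)%type H
    (fun A => (b A 0 - b A 1, Ordinal (bp A))%R) unH.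
  by rewrite card_prod !card_ord.
pose C := [set x : 'I_M.+1 | x %/ p == c].
have cC : #|C| <= p.
  pose g (x : 'I_M.+1) : 'I_p := Ordinal (ltn_pmod x p0).
  rewrite -[X in _ <= X]card_ord -(@card_in_imset _ _ g) ?max_card // => x y.
  rewrite !inE => /eqP xc /eqP yc /(congr1 val) /= xy.
  by apply: val_inj; rewrite /= (divn_eq x p) (divn_eq y p) xc yc xy.
(* The residues at positions 0 and 1 differ by [d], so each of the two vertices determines the block
   of the other up to the sign of [d]. [W] gathers the blocks met while the residue at position 0
   runs through [C]. *)
exists (\bigcup_(x in C) (blk f x :|: blk f (x - d)%R)).
exists (fun u => blk f (inZp (f u) - d)%R :|: blk f (inZp (f u) + d)%R).
have c2 (x y : 'I_M.+1) : #|blk f x :|: blk f y| <= 2 * (n %/ M.+1).+1.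
  by rewrite mul2n -addnn (leq_trans (leq_card_setU _ _)) // leq_add //; exact: card_block_preim.
split=> [|u|A AH]; [|exact: c2|].
  apply: leq_trans (card_bigcup_leq _ _) _.
  apply: leq_trans (_ : \sum_(u in C) 2 * (n %/ M.+1).+1 <= _).
    by apply: leq_sum => u _; exact: c2.
  by rewrite sum_nat_const -mulnA mulnCA leq_mul2l leq_mul2r cC orbT.
have [|u1 u1A e1] := @eltS _ _ f A 0 fi; first by rewrite uH.
have [|u2 u2A e2] := @eltS _ _ f A 1 fi; first by rewrite uH.
have fe := fc _ AH; have /= := congr1 (fun x => val x.2) fe; have /= := congr1 fst fe => {fe}.
rewrite /b e1 e2; set b1 : 'I_M.+1 := inZp (f u1); set b2 : 'I_M.+1 := inZp (f u2) => bd bc.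
have b2E : b2 = (b1 - d)%R by rewrite -bd opprB addrC subrK.
exists u1, u2; split=> //.
  apply/eqP => uu; move: e2; rewrite -uu -e1 => /elt_inj.
  by rewrite card_imset // uH // => /(_ isT isT).
have b1C : b1 \in C by rewrite inE /= bc.
split; rewrite ?inE -/b1 -/b2 ?b2E ?subrK ?eqxx ?orbT //.
- by apply/bigcupP; exists b1 => //; rewrite !inE eqxx.
- by apply/bigcupP; exists b1 => //; rewrite !inE -/b2 b2E eqxx orbT.
Qed.
End Colourings.

(** * Random counting *)

Lemma card_supersets (T : finType) (S H : {set T}) e : H \subset S ->
  #|[set G : {set T} | [&& G \subset S, #|G| == e & H \subset G]]| <= 'C(#|S| - #|H|, e - #|H|).
Proof.
move=> HS; rewrite -(setIidPr HS) -cardsD -cards_draws (setIidPr HS).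
rewrite -(@card_in_imset _ _ (fun G => G :\: H)).
  apply: subset_leq_card; apply/subsetP => _ /imsetP[G + ->].
  rewrite !inE => /and3P[GS /eqP cG HG].
  by rewrite setSD //= cardsD (setIidPr HG) cG.
move=> G G'; rewrite !inE => /and3P[_ _ HG] /and3P[_ _ HG'] GG.
by rewrite -(setID G H) -(setID G' H) GG (setIidPr HG) (setIidPr HG').
Qed.

(** The quotient of the binomials is the product of (e - i)/(N - i) for i < m, each factor being at
    most e/N. It is the chance that a random e-set contains a given m-set. *)
Lemma bin_ratio N e m : m <= e <= N -> N ^ m * 'C(N - m, e - m) <= e ^ m * 'C(N, e).
Proof.
elim: m => [|m IH] /andP[me eN]; first by rewrite !subn0.
have {}IH : N ^ m * 'C(N - m, e - m) <= e ^ m * 'C(N, e) by apply: IH; lia.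
have step : N * 'C(N - m.+1, e - m.+1) <= e * 'C(N - m, e - m).
  have := mul_bin_diag (N - m) (e - m).-1; have em : 0 < e - m by lia.
  rewrite (prednK em).
  rewrite -!subnS => eq.
  rewrite -(@leq_pmul2l (N - m)); last by lia.
  rewrite mulnCA eq !mulnA leq_mul2r; apply/orP; right.
  by nia.
by rewrite !expnSr -mulnA (leq_trans (leq_mul (leqnn _) step)) // mulnCA [X in _ <= X]mulnAC [X in _ <= X]mulnC leq_mul.
Qed.

Lemma random_bound n e (T : finType) (H : {set {set T}}) : 0 < n ->
  uniform 4 H -> unavoidable 4 n e H -> #|H| <= e <= 'C(n, 4) ->
  'C(n, 4) ^ #|H| <= e ^ #|H| * n ^ #|cover H|.
Proof.
move=> n0 uH unH /andP[He eN]; set N := 'C(n, 4) in eN *.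
pose y0 := Ordinal n0.
pose S := [set A : {set 'I_n} | #|A| == 4].
have cS : #|S| = N by rewrite card_draws card_ord.
pose im (f : {ffun T -> 'I_n}) := [set f @: (A : {set T}) | A in H].
(* Maps are normalised to [y0] outside [cover H], so that isolated vertices of [T] do not enter the
   count. *)
pose FF := [set f in pffun_on y0 (mem (cover H)) predT | (#|im f| == #|H|) && (im f \subset S)].
have cF : #|FF| <= n ^ #|cover H|.
  have -> : n ^ #|cover H| = #|pffun_on y0 (mem (cover H)) (@predT 'I_n)|.
    by rewrite card_pffun_on card_ord.
  by apply: subset_leq_card; apply/subsetP => f; rewrite inE => /andP[].
have sub : [set G : {set {set 'I_n}} | G \subset S & #|G| == e] \subset
    \bigcup_(f in FF) [set G : {set {set 'I_n}} | [&& G \subset S, #|G| == e & im f \subset G]].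
  apply/subsetP => G; rewrite inE => /andP[GS cG].
  have [|f fi fH] := unH G _ (eqP cG).
    by move=> A /(subsetP GS); rewrite inE => /eqP.
  pose f' := [ffun x => if x \in cover H then f x else y0].
  have f'E A : A \in H -> f' @: A = f @: A.
    move=> AH; apply: eq_in_imset => x xA; rewrite ffunE ifT //.
    by apply/bigcupP; exists A.
  have imE : im f' = [set f @: (A : {set T}) | A in H] by apply: eq_in_imset.
  have imG : im f' \subset G by rewrite imE; apply/subsetP => _ /imsetP[A AH ->]; exact: fH.
  apply/bigcupP; exists f'; last by rewrite inE GS cG imG.
  rewrite inE (subset_trans imG GS) imE card_imset ?eqxx ?andbT; last exact: imset_inj.
  apply/pffun_onP; split => //.
  by apply/supportP => x xn; rewrite ffunE (negPf xn).
have h := subset_leq_card sub; rewrite cards_draws cS in h.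
have {}h : 'C(N, e) <= n ^ #|cover H| * 'C(N - #|H|, e - #|H|).
  apply: (leq_trans h); apply: (leq_trans (card_bigcup_leq _ _)).
  apply: leq_trans (_ : \sum_(f in FF) 'C(N - #|H|, e - #|H|) <= _).
    apply: leq_sum => f; rewrite inE => /and3P[_ /eqP ci iS].
    by have := card_supersets e iS; rewrite cS ci.
  by rewrite sum_nat_const leq_mul2r cF orbT.
have b0 : 0 < 'C(N, e) by rewrite bin_gt0.
rewrite -(leq_pmul2r b0); apply: (leq_trans (leq_mul (leqnn _) h)).
by rewrite mulnCA -[X in _ <= X]mulnA [X in _ <= X]mulnCA leq_mul2l bin_ratio ?He ?orbT.
Qed.

(** * Stars with few common vertices *)

Lemma four_elements (T : finType) (A : {set T}) x1 x2 x3 x4 : #|A| = 4 ->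
  uniq [:: x1; x2; x3; x4] -> {subset [:: x1; x2; x3; x4] <= A} ->
  A = [set x in [:: x1; x2; x3; x4]].
Proof.
move=> cA ux sub; apply/esym/eqP; rewrite eqEcard cA cardsE (card_uniqP ux) leqnn andbT.
by apply/subsetP => x; rewrite inE => /sub.
Qed.

(** Split by the pair u, u' of an edge. If v belongs to it, the partner lies in [N v]: at most
    [s * D] edges. If it avoids v but meets B, the partner is one of s vertices and the triple with
    v has at most K edges. Otherwise the edge consists of v, an element of B, u and u', so it lies
    inside v, B and W, where edges number at most L per vertex. *)
Lemma star_chunk_bound (T : finType) (H : {set {set T}}) v (B W : {set T}) (N : T -> {set T})
    s D K L :
  uniform 4 H -> (forall A, A \in H -> v \in A) ->
  (forall u1 u2 u3, uniq [:: u1; u2; u3] ->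
    #|[set A in H | [&& u1 \in A, u2 \in A & u3 \in A]]| <= K) ->
  (forall v w, v != w -> #|[set A in H | (v \in A) && (w \in A)]| <= D) ->
  (forall A, A \in H -> exists u, [/\ u \in A, u \in B & u != v]) ->
  (forall u, #|N u| <= s) ->
  (forall A, A \in H -> exists u u', [/\ u \in A, u' \in A, u != u' &
     [/\ u \in W, u' \in W, u' \in N u & u \in N u']]) ->
  (forall H' : {set {set T}}, H' \subset H -> #|H'| <= L * #|cover H'|) ->
  #|H| <= s * D + #|B| * (s * K) + L * (1 + #|B| + #|W|).
Proof.
move=> uH vH hK hD hB hN hW hL.
pose H1 := \bigcup_(x in N v) if v != x then [set A in H | (v \in A) && (x \in A)] else set0.
pose H2 := \bigcup_(x in B) \bigcup_(y in N x)
  if uniq [:: v; x; y] then [set A in H | [&& v \in A, x \in A & y \in A]] else set0.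
pose H3 := [set A in H | A \subset v |: (B :|: W)].
have c1 : #|H1| <= s * D.
  apply: leq_trans (card_bigcup_leq _ _) _; apply: leq_trans (_ : \sum_(x in N v) D <= _).
    by apply: leq_sum => x _; case: ifP => [|_]; [exact: hD | rewrite cards0].
  by rewrite sum_nat_const leq_mul2r hN orbT.
have c2 : #|H2| <= #|B| * (s * K).
  apply: leq_trans (card_bigcup_leq _ _) _; apply: leq_trans (_ : \sum_(x in B) s * K <= _).
    apply: leq_sum => x _; apply: leq_trans (card_bigcup_leq _ _) _.
    apply: leq_trans (_ : \sum_(y in N x) K <= _).
      by apply: leq_sum => y _; case: ifP => [|_]; [exact: hK | rewrite cards0].
    by rewrite sum_nat_const leq_mul2r hN orbT.
  by rewrite sum_nat_const.
have c3 : #|H3| <= L * (1 + #|B| + #|W|).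
  apply: leq_trans (hL _ _) _; first by apply/subsetP => A; rewrite inE => /andP[].
  rewrite leq_mul2l; apply/orP; right.
  apply: leq_trans (_ : #|v |: (B :|: W)| <= _).
    apply: subset_leq_card; apply/bigcupsP => A; rewrite inE => /andP[_ //].
  rewrite cardsU1 -addnA leq_add ?leq_card_setU //; exact: leq_b1.
suff sub : H \subset H1 :|: (H2 :|: H3).
  apply: leq_trans (subset_leq_card sub) _.
  apply: leq_trans (leq_card_setU _ _) _; rewrite -addnA leq_add //.
  by apply: leq_trans (leq_card_setU _ _) _; rewrite leq_add.
apply/subsetP => A AH; have vA := vH _ AH.
have in1 x : x \in A -> x != v -> x \in N v -> A \in H1.
  by move=> xA xv xN; apply/bigcupP; exists x => //; rewrite eq_sym xv inE AH vA xA.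
have in2 x y : x \in A -> y \in A -> x != v -> y != v -> x != y -> x \in B -> y \in N x -> A \in H2.
  move=> xA yA xv yv xy xB yN; apply/bigcupP; exists x => //; apply/bigcupP; exists y => //.
  by rewrite /= !inE negb_or ![v == _]eq_sym xv yv xy inE AH vA xA yA.
have [u [u' [uA u'A uu [uW u'W u'N uN]]]] := hW _ AH.
rewrite !inE -/H1 -/H2.
have [uv|uv] := eqVneq u v; first by rewrite (in1 u') // -uv // eq_sym.
have [u'v|u'v] := eqVneq u' v; first by rewrite (in1 u) // -u'v.
have [uB|uB] := boolP (u \in B); first by rewrite (in2 u u') // orbT.
have [u'B|u'B] := boolP (u' \in B); first by rewrite (in2 u' u) ?orbT // eq_sym.
have [b [bA bB bv]] := hB _ AH.
rewrite AH /=; apply/orP; right; apply/orP; right.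
rewrite [A](@four_elements _ _ v b u u') ?uH //.
- by apply/subsetP => x; rewrite !inE => /or4P[] /eqP->; rewrite ?eqxx ?bB ?uW ?u'W ?orbT.
- rewrite /= !inE !negb_or ![v == _]eq_sym bv uv u'v uu /= andbT.
  by apply/andP; split; [apply: contraNneq uB => <- | apply: contraNneq u'B => <-].
- by move=> x; rewrite !inE => /or4P[] /eqP->.
Qed.

Lemma card_cover_stars (T : finType) (H : {set {set T}}) (B : {set T}) :
  (forall A, A \in H -> exists2 v, v \in A & v \in B) ->
  forall m, (forall v, #|cover (star H v)| <= m) -> #|cover H| <= #|B| * m.
Proof.
move=> hB m hm; apply: leq_trans (_ : #|\bigcup_(v in B) cover (star H v)| <= _).
  apply: subset_leq_card; apply/bigcupsP => A AH; have [v vA vB] := hB _ AH.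
  apply/subsetP => x xA; apply/bigcupP; exists v => //; apply/bigcupP; exists A => //.
  by rewrite inE AH.
apply: leq_trans (card_bigcup_leq _ _) _; rewrite -sum_nat_const.
by apply: leq_sum => v _.
Qed.

Lemma card_stars (T : finType) (H : {set {set T}}) (B : {set T}) :
  (forall A, A \in H -> exists2 v, v \in A & v \in B) ->
  forall m, (forall v, #|star H v| <= m) -> #|H| <= #|B| * m.
Proof.
move=> hB m hm; apply: leq_trans (_ : #|\bigcup_(v in B) star H v| <= _).
  apply: subset_leq_card; apply/subsetP => A AH; have [v vA vB] := hB _ AH.
  by apply/bigcupP; exists v => //; rewrite inE AH.
apply: leq_trans (card_bigcup_leq _ _) _; rewrite -sum_nat_const.
by apply: leq_sum => v _.
Qed.

(** * Greedy embedding of star forests *)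

(** [P] is validity of one piece and [R] compatibility of two. [R] is demanded in both directions
    because the conclusion ranges over ordered pairs of indices. *)
Lemma greedy (X : Type) (P : X -> Prop) (R : X -> X -> Prop) r :
  (forall j (s : 'I_j -> X), j < r -> (forall i, P (s i)) ->
    exists2 x, P x & forall i, R (s i) x /\ R x (s i)) ->
  exists2 F : 'I_r -> X, (forall i, P (F i)) & forall i i', i != i' -> R (F i) (F i').
Proof.
elim: r => [|r IH] step.
  have F0 (i : 'I_0) : X by case: i.
  by exists F0 => -[].
have [j s jr|F PF RF] := IH; first by apply: step; exact: ltnW.
have [x Px Rx] := step r F (ltnSn r) PF.
exists (fun i => if unlift ord_max i is Some j then F j else x) => [i|i i'].
  by case: unliftP.
case: unliftP => [j ->|->]; case: unliftP => [j' ->|->] ii'; last by rewrite eqxx in ii'.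
- by apply: RF; apply: contraNneq ii' => ->.
- by have [] := Rx j.
- by have [] := Rx j'.
Qed.

Lemma uncurry_inj (I J : eqType) (V : Type) (F : I -> J -> V) :
  (forall i, injective (F i)) ->
  (forall i i', i != i' -> forall j j', F i j <> F i' j') ->
  injective (fun p => F p.1 p.2).
Proof.
move=> Fi Fd [i j] [i' j'] /= e; have [ii|/Fd/(_ j j')//] := eqVneq i i'.
by move: e; rewrite -ii => /Fi ->.
Qed.

(** Averaging. Later calls put a successor on the right, which turns the strict conclusion into
    [<=]; the added ones make the hypothesis strict once the index type is inhabited. *)
Lemma sum_ltn_ex (V : finType) (f h : V -> nat) :
  \sum_u f u < \sum_u h u -> exists u, f u < h u.
Proof.
move=> lt; apply/existsP; apply: contraLR lt => /existsPn nlt.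
by rewrite -leqNgt; apply: leq_sum => u _; rewrite leqNgt nlt.
Qed.

Section Embedding.
Variable V : finType.
Implicit Types (W : {set V}).
Let n := #|V|.

(** Nested sums over ordered tuples make fixing the leading vertices a partial application, as the
    level-by-level embedding requires. *)
Definition cnt2 (E : V -> V -> bool) : nat := \sum_x \sum_y E x y.
Definition cnt3 (E : V -> V -> V -> bool) : nat := \sum_w cnt2 (E w).
Definition cnt4 (E : V -> V -> V -> V -> bool) : nat := \sum_v cnt3 (E v).

Lemma leq_cnt2 (E E' : V -> V -> bool) : (forall x y, E x y <= E' x y) -> cnt2 E <= cnt2 E'.
Proof. by move=> EE; do 2!apply: leq_sum => ? _; exact: EE. Qed.

Lemma leq_cnt3 (E E' : V -> V -> V -> bool) : (forall w x y, E w x y <= E' w x y) -> cnt3 E <= cnt3 E'.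
Proof. by move=> EE; apply: leq_sum => ? _; apply: leq_cnt2 => *; exact: EE. Qed.

Lemma leq_cnt4 (E E' : V -> V -> V -> V -> bool) : (forall v w x y, E v w x y <= E' v w x y) -> cnt4 E <= cnt4 E'.
Proof. by move=> EE; apply: leq_sum => ? _; apply: leq_cnt3 => *; exact: EE. Qed.

Lemma cnt2D (E E1 E2 : V -> V -> bool) : (forall x y, E x y <= E1 x y + E2 x y) -> cnt2 E <= cnt2 E1 + cnt2 E2.
Proof.
move=> EE; rewrite /cnt2 -big_split /=; apply: leq_sum => x _.
by rewrite -big_split /=; apply: leq_sum => y _.
Qed.

Lemma cnt3D (E E1 E2 : V -> V -> V -> bool) : (forall w x y, E w x y <= E1 w x y + E2 w x y) ->
  cnt3 E <= cnt3 E1 + cnt3 E2.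
Proof.
by move=> EE; rewrite /cnt3 -big_split /=; apply: leq_sum => w _; exact: cnt2D.
Qed.

Lemma cnt4D (E E1 E2 : V -> V -> V -> V -> bool) : (forall v w x y, E v w x y <= E1 v w x y + E2 v w x y) ->
  cnt4 E <= cnt4 E1 + cnt4 E2.
Proof.
by move=> EE; rewrite /cnt4 -big_split /=; apply: leq_sum => v _; exact: cnt3D.
Qed.

(* [spreadI ... D E]: few of the tuples counted by E have a given coordinate in a
   set W no larger than the set of vertices already used by the greedy embedding. *)
Definition spread2 K b c D E :=
  (forall W, #|W| <= b -> K * cnt2 (fun x y => E x y && (x \in W)) <= 2 * D) /\
  (forall W, #|W| <= b * c -> K * cnt2 (fun x y => E x y && (y \in W)) <= 2 * D).

Definition spread3 K a b c D E :=
  [/\ forall W, #|W| <= a -> K * cnt3 (fun w x y => E w x y && (w \in W)) <= 2 * D,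
      forall W, #|W| <= a * b -> K * cnt3 (fun w x y => E w x y && (x \in W)) <= 2 * D &
      forall W, #|W| <= a * (b * c) -> K * cnt3 (fun w x y => E w x y && (y \in W)) <= 2 * D].

Definition spread4 K r a b c D E :=
  [/\ forall W, #|W| <= r.-1 -> K * cnt4 (fun v w x y => E v w x y && (v \in W)) <= 2 * D,
      forall W, #|W| <= r.-1 * a -> K * cnt4 (fun v w x y => E v w x y && (w \in W)) <= 2 * D,
      forall W, #|W| <= r.-1 * (a * b) -> K * cnt4 (fun v w x y => E v w x y && (x \in W)) <= 2 * D &
      forall W, #|W| <= r.-1 * (a * (b * c)) -> K * cnt4 (fun v w x y => E v w x y && (y \in W)) <= 2 * D].

Lemma spread2_sub K b c D (E E' : V -> V -> bool) : (forall x y, E x y <= E' x y) ->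
  spread2 K b c D E' -> spread2 K b c D E.
Proof.
move=> EE [h1 h2]; split=> W cW; [apply: leq_trans (h1 W cW)|apply: leq_trans (h2 W cW)];
  rewrite leq_mul2l leq_cnt2 ?orbT // => x y; move: (EE x y);
  by case: (E x y) => //=; case: (E' x y).
Qed.

Lemma spread3_sub K a b c D (E E' : V -> V -> V -> bool) : (forall w x y, E w x y <= E' w x y) ->
  spread3 K a b c D E' -> spread3 K a b c D E.
Proof.
move=> EE [h1 h2 h3]; split=> W cW; [apply: leq_trans (h1 W cW)|apply: leq_trans (h2 W cW)|apply: leq_trans (h3 W cW)];
  rewrite leq_mul2l leq_cnt3 ?orbT // => w x y; move: (EE w x y);
  by case: (E w x y) => //=; case: (E' w x y).
Qed.

Lemma card_used (I J : finType) (F : I * J -> V) k : #|I| <= k -> #|[set F p | p : I * J]| <= k * #|J|.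
Proof.
move=> Ik; apply: leq_trans (leq_imset_card _ _) _.
by rewrite card_prod leq_mul2r Ik orbT.
Qed.

(** [D] is the full degree to which [spread2] is relative, and [Q] a surplus. Used vertices destroy
    at most [4 * D / K], hence at most [D / P], of the pairs; what is left exceeds [n * c.-1], so
    some x has c free partners. *)
Lemma embed2 K P b c D Q E : 0 < c -> 4 * P <= K -> spread2 K b c D E ->
  D + Q <= P * cnt2 E -> P * (n * c.-1) < Q ->
  exists (X : 'I_b -> V) (Y : 'I_b * 'I_c -> V),
    [/\ injective X, injective Y & forall k l, E (X k) (Y (k, l))].
Proof.
move=> c0 KP [h1 h2] cE Qn.
have [|F PF RF] := @greedy (V * ('I_c -> V)) (fun o => injective o.2 /\ forall l, E o.1 (o.2 l))
   (fun o o' => o.1 <> o'.1 /\ forall l l', o.2 l <> o'.2 l') b; last first.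
  exists (fun k => (F k).1), (fun p => (F p.1).2 p.2); split.
  - by move=> k k'; have [//|/RF[]] := eqVneq k k'.
  - apply: (@uncurry_inj _ _ _ (fun k => (F k).2)) => [k|k k' /RF[]//].
    by have [] := PF k.
  - by move=> k l; have [_] := PF k.
move=> j s jb Ps.
pose W3 := [set (s i).1 | i : 'I_j]; pose W4 := [set (s p.1).2 p.2 | p : 'I_j * 'I_c].
have c3 : #|W3| <= b by apply: leq_trans (leq_imset_card _ _) _; rewrite card_ord ltnW.
have c4 : #|W4| <= b * c.
  by have := @card_used 'I_j 'I_c (fun p => (s p.1).2 p.2) b; rewrite !card_ord; apply; exact: ltnW.
pose E' x y := [&& E x y, x \notin W3 & y \notin W4].
have le : cnt2 E <= cnt2 E' + (cnt2 (fun x y => E x y && (x \in W3)) + cnt2 (fun x y => E x y && (y \in W4))).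
  apply: leq_trans (cnt2D (E1 := E') (E2 := fun x y => (E x y && (x \in W3)) || (E x y && (y \in W4))) _) _.
    by move=> x y; rewrite /E'; case: (E x y) => //=; case: (x \in W3) => //=; case: (y \in W4).
  rewrite leq_add2l cnt2D // => x y.
  by case: (E x y) => //=; case: (x \in W3) => //=; case: (y \in W4).
have k3 := h1 _ c3; have k4 := h2 _ c4.
have gt : n * c.-1 < cnt2 E' by nia.
have [x xc] : exists x, c.-1 < \sum_y E' x y.
  by apply: (@sum_ltn_ex _ (fun=> c.-1)); rewrite sum_nat_const.
rewrite prednK // in xc.
have cx : c <= #|[set y | E' x y]|.
  apply: leq_trans xc _; rewrite -sum1_card [X in _ <= X]big_mkcond /=.
  by apply: leq_sum => y _; rewrite inE; case: (E' x y).
exists (x, fun l : 'I_c => enum_val (widen_ord cx l)).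
  split=> [l l' /= /enum_val_inj /(congr1 val) /= /val_inj //|l /=].
  by have := enum_valP (widen_ord cx l); rewrite inE => /and3P[].
have [y0] : exists y, y \in [set y | E' x y] by apply/card_gt0P; exact: leq_trans cx.
rewrite inE => /and3P[_ xW _] i.
have xs : (s i).1 <> x by move=> e; case/imsetP: xW; exists i.
have ys l l' : (s i).2 l <> enum_val (widen_ord cx l').
  move=> e; have := enum_valP (widen_ord cx l'); rewrite inE => /and3P[_ _ /imsetP[]].
  by exists (i, l).
by split; split=> // [/esym//|l l' /esym]; exact: ys.
Qed.

(** The centre w is found by averaging against [D2 w + Q2]: the surviving edges at w are then still
    a fixed fraction of its full degree [D2 w], in which the spread of [E w] is measured. Used
    vertices cost at most [D1 / (2 * P)], so [P] doubles on the way down. *)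
Lemma embed3 K P a b c D1 (D2 : V -> nat) Q1 Q2 E : 0 < n -> 0 < b -> 0 < c -> 12 * P <= K ->
  spread3 K a b c D1 E -> (forall w, spread2 K b c (D2 w) (E w)) ->
  \sum_w D2 w <= D1 -> D1 + Q1 <= P * cnt3 E ->
  n * Q2 <= 2 * Q1 -> 2 * P * (n * c.-1) < Q2 ->
  exists (Z : 'I_a -> V) (X : 'I_a * 'I_b -> V) (Y : 'I_a * ('I_b * 'I_c) -> V),
    [/\ injective Z, injective X, injective Y & forall j k l, E (Z j) (X (j, k)) (Y (j, (k, l)))].
Proof.
move=> n0 b0 c0 KP [h1 h2 h3] h D12 cE Q12 Qn.
have [|F PF RF] := @greedy (V * (('I_b -> V) * ('I_b * 'I_c -> V)))
   (fun o => [/\ injective o.2.1, injective o.2.2 & forall k l, E o.1 (o.2.1 k) (o.2.2 (k, l))])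
   (fun o o' => [/\ o.1 <> o'.1, forall k k', o.2.1 k <> o'.2.1 k' & forall l l', o.2.2 l <> o'.2.2 l']) a; last first.
  exists (fun j => (F j).1), (fun p => (F p.1).2.1 p.2), (fun p => (F p.1).2.2 p.2); split.
  - by move=> k k'; have [//|/RF[]] := eqVneq k k'.
  - apply: (@uncurry_inj _ _ _ (fun k => (F k).2.1)) => [k|k k' /RF[]//].
    by have [] := PF k.
  - apply: (@uncurry_inj _ _ _ (fun k => (F k).2.2)) => [k|k k' /RF[]//].
    by have [] := PF k.
  - by move=> j k l; have [_ _ h'] := PF j; exact: h'.
move=> j s ja Ps.
pose W2 := [set (s i).1 | i : 'I_j]; pose W3 := [set (s p.1).2.1 p.2 | p : 'I_j * 'I_b].
pose W4 := [set (s p.1).2.2 p.2 | p : 'I_j * ('I_b * 'I_c)].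
have c2 : #|W2| <= a by apply: leq_trans (leq_imset_card _ _) _; rewrite card_ord ltnW.
have c3 : #|W3| <= a * b.
  by have := @card_used 'I_j 'I_b (fun p => (s p.1).2.1 p.2) a; rewrite !card_ord; apply; exact: ltnW.
have c4 : #|W4| <= a * (b * c).
  by have := @card_used 'I_j ('I_b * 'I_c)%type (fun p => (s p.1).2.2 p.2) a; rewrite card_prod !card_ord; apply; exact: ltnW.
pose E' w x y := [&& E w x y, w \notin W2, x \notin W3 & y \notin W4].
have le : cnt3 E <= cnt3 E' + (cnt3 (fun w x y => E w x y && (w \in W2)) +
   (cnt3 (fun w x y => E w x y && (x \in W3)) + cnt3 (fun w x y => E w x y && (y \in W4)))).
  apply: leq_trans (cnt3D (E1 := E') (E2 := fun w x y => [|| E w x y && (w \in W2), E w x y && (x \in W3) | E w x y && (y \in W4)]) _) _.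
    by move=> w x y; rewrite /E'; case: (E w x y) => //=; case: (w \in W2) => //=; case: (x \in W3) => //=; case: (y \in W4).
  rewrite leq_add2l; apply: leq_trans (cnt3D (E1 := fun w x y => E w x y && (w \in W2)) (E2 := fun w x y => (E w x y && (x \in W3)) || (E w x y && (y \in W4))) _) _.
    by move=> w x y; case: (E w x y) => //=; case: (w \in W2) => //=; case: (x \in W3) => //=; case: (y \in W4).
  rewrite leq_add2l cnt3D // => w x y.
  by case: (E w x y) => //=; case: (x \in W3) => //=; case: (y \in W4).
have k2 := h1 _ c2; have k3 := h2 _ c3; have k4 := h3 _ c4.
have [w cw] : exists w, D2 w + Q2 < (2 * P * cnt2 (E' w)).+1.
  apply: (@sum_ltn_ex _ (fun w => D2 w + Q2)).
  have -> : \sum_u (2 * P * cnt2 (E' u)).+1 = 2 * P * cnt3 E' + n.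
    by rewrite /n -sum1_card big_distrr /= -big_split /=; apply: eq_bigr => u _; rewrite addn1.
  rewrite big_split /= sum_nat_const.
  apply: leq_ltn_trans (leq_add D12 Q12) _.
  set A2 := cnt3 (fun w x y => E w x y && (w \in W2)) in le k2.
  set A3 := cnt3 (fun w x y => E w x y && (x \in W3)) in le k3.
  set A4 := cnt3 (fun w x y => E w x y && (y \in W4)) in le k4.
  have : 12 * P * (A2 + A3 + A4) <= 6 * D1.
    by apply: leq_trans (leq_mul KP (leqnn _)) _; lia.
  move=> kill; clear -le cE n0 kill; have := leq_mul (leqnn (2 * P)) le; lia.
have [|||X [Y [Xi Yi EXY]]] := @embed2 K (2 * P) b c (D2 w) Q2 (E' w) c0 _ _ _ Qn.
- lia.
- by apply: spread2_sub (h w) => x y; rewrite /E'; case: (E w x y); rewrite ?leq_b1.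
- by rewrite -ltnS.
exists (w, (X, Y)); first by split=> // k l; have /and4P[] := EXY k l.
pose k0 := Ordinal b0; pose l0 := Ordinal c0.
have nW w' : w' \in W2 -> w <> w'.
  by move=> wW e; have /and4P[_ + _ _] := EXY k0 l0; rewrite e wW.
have nX k x : x \in W3 -> X k <> x.
  by move=> xW e; have /and4P[_ _ + _] := EXY k l0; rewrite e xW.
have nY q y : y \in W4 -> Y q <> y.
  by case: q => k l yW e; have /and4P[_ _ _ +] := EXY k l; rewrite e yW.
move=> i; split; split=> /=.
- by apply/nesym/nW/imsetP; exists i.
- by move=> k k'; apply/nesym/nX/imsetP; exists (i, k).
- by move=> k k'; apply/nesym/nY/imsetP; exists (i, k).
- by apply/nW/imsetP; exists i.
- by move=> k k'; apply/nX/imsetP; exists (i, k').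
- by move=> k k'; apply/nY/imsetP; exists (i, k').
Qed.

(** The argument of [embed3] one level up. Here [P] grows by the factor 4, and [48 = 12 * 4] is what
    [embed3] then demands. The last hypothesis on [D0] funds the surplus of both lower levels. *)
Lemma embed4 K P r a b c D0 (D1 : V -> nat) (D2 : V -> V -> nat) E :
  0 < n -> 0 < a -> 0 < b -> 0 < c -> 48 * P <= K ->
  spread4 K r a b c D0 E -> (forall v, spread3 K a b c (D1 v) (E v)) ->
  (forall v w, spread2 K b c (D2 v w) (E v w)) ->
  \sum_v D1 v <= D0 -> (forall v, \sum_w D2 v w <= D1 v) -> D0 <= P * cnt4 E ->
  n * (n * (8 * P * (n * c.-1)).+1) <= D0 ->
  exists (U : 'I_r -> V) (Z : 'I_r * 'I_a -> V) (X : 'I_r * ('I_a * 'I_b) -> V)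
    (Y : 'I_r * ('I_a * ('I_b * 'I_c)) -> V),
    [/\ injective U, injective Z, injective X, injective Y &
      forall i j k l, E (U i) (Z (i, j)) (X (i, (j, k))) (Y (i, (j, (k, l))))].
Proof.
move=> n0 a0 b0 c0 KP [h1 h2 h3 h4] hv hvw D01 D12 cE Qn.
have [|F PF RF] := @greedy (V * (('I_a -> V) * (('I_a * 'I_b -> V) * ('I_a * ('I_b * 'I_c) -> V))))
   (fun o => [/\ injective o.2.1, injective o.2.2.1, injective o.2.2.2 &
      forall j k l, E o.1 (o.2.1 j) (o.2.2.1 (j, k)) (o.2.2.2 (j, (k, l)))])
   (fun o o' => [/\ o.1 <> o'.1, forall k k', o.2.1 k <> o'.2.1 k',
      forall k k', o.2.2.1 k <> o'.2.2.1 k' & forall l l', o.2.2.2 l <> o'.2.2.2 l']) r; last first.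
  exists (fun j => (F j).1), (fun p => (F p.1).2.1 p.2), (fun p => (F p.1).2.2.1 p.2), (fun p => (F p.1).2.2.2 p.2); split.
  - by move=> k k'; have [//|/RF[]] := eqVneq k k'.
  - apply: (@uncurry_inj _ _ _ (fun k => (F k).2.1)) => [k|k k' /RF[]//].
    by have [] := PF k.
  - apply: (@uncurry_inj _ _ _ (fun k => (F k).2.2.1)) => [k|k k' /RF[]//].
    by have [] := PF k.
  - apply: (@uncurry_inj _ _ _ (fun k => (F k).2.2.2)) => [k|k k' /RF[]//].
    by have [] := PF k.
  - by move=> i j k l; have [_ _ _ h'] := PF i; exact: h'.
move=> j s ja Ps.
pose W1 := [set (s i).1 | i : 'I_j]; pose W2 := [set (s p.1).2.1 p.2 | p : 'I_j * 'I_a].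
pose W3 := [set (s p.1).2.2.1 p.2 | p : 'I_j * ('I_a * 'I_b)].
pose W4 := [set (s p.1).2.2.2 p.2 | p : 'I_j * ('I_a * ('I_b * 'I_c))].
have jr : j <= r.-1 by rewrite -ltnS (leq_trans ja) // leqSpred.
have c1 : #|W1| <= r.-1 by apply: leq_trans (leq_imset_card _ _) _; rewrite card_ord.
have c2 : #|W2| <= r.-1 * a.
  by have := @card_used 'I_j 'I_a (fun p => (s p.1).2.1 p.2) r.-1; rewrite !card_ord; exact.
have c3 : #|W3| <= r.-1 * (a * b).
  by have := @card_used 'I_j ('I_a * 'I_b)%type (fun p => (s p.1).2.2.1 p.2) r.-1; rewrite card_prod !card_ord; exact.
have c4 : #|W4| <= r.-1 * (a * (b * c)).
  by have := @card_used 'I_j ('I_a * ('I_b * 'I_c))%type (fun p => (s p.1).2.2.2 p.2) r.-1; rewrite !card_prod !card_ord; exact.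
pose E' v w x y := [&& E v w x y, v \notin W1, w \notin W2, x \notin W3 & y \notin W4].
pose F1 v w x y := E v w x y && (v \in W1).
pose F2 v w x y := E v w x y && (w \in W2).
pose F3 v w x y := E v w x y && (x \in W3).
pose F4 v w x y := E v w x y && (y \in W4).
have le : cnt4 E <= cnt4 E' + (cnt4 F1 + (cnt4 F2 + (cnt4 F3 + cnt4 F4))).
  apply: leq_trans (cnt4D (E1 := E') (E2 := fun v w x y => [|| F1 v w x y, F2 v w x y, F3 v w x y | F4 v w x y]) _) _.
    by move=> v w x y; rewrite /E' /F1 /F2 /F3 /F4; case: (E v w x y) => //=; case: (v \in W1) => //=; case: (w \in W2) => //=; case: (x \in W3) => //=; case: (y \in W4).
  rewrite leq_add2l; apply: leq_trans (cnt4D (E1 := F1) (E2 := fun v w x y => [|| F2 v w x y, F3 v w x y | F4 v w x y]) _) _.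
    by move=> v w x y; case: (F1 v w x y) => //=; case: (_ || _).
  rewrite leq_add2l; apply: leq_trans (cnt4D (E1 := F2) (E2 := fun v w x y => F3 v w x y || F4 v w x y) _) _.
    by move=> v w x y; case: (F2 v w x y) => //=; case: (_ || _).
  rewrite leq_add2l cnt4D // => v w x y.
  by case: (F3 v w x y) => //=; case: (F4 v w x y).
have k1 := h1 _ c1; have k2 := h2 _ c2; have k3 := h3 _ c3; have k4 := h4 _ c4.
set Q2 := (_.+1) in Qn.
have [v cv] : exists v, D1 v + n * Q2 < (4 * P * cnt3 (E' v)).+1.
  apply: (@sum_ltn_ex _ (fun v => D1 v + n * Q2)).
  have -> : \sum_u (4 * P * cnt3 (E' u)).+1 = 4 * P * cnt4 E' + n.
    by rewrite /n -sum1_card big_distrr /= -big_split /=; apply: eq_bigr => u _; rewrite addn1.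
  rewrite big_split /= sum_nat_const.
  apply: leq_ltn_trans (leq_add D01 Qn) _.
  have kill : 48 * P * (cnt4 F1 + cnt4 F2 + cnt4 F3 + cnt4 F4) <= 8 * D0.
    by apply: leq_trans (leq_mul KP (leqnn _)) _; rewrite -/F1 -/F2 -/F3 -/F4 in k1 k2 k3 k4; lia.
  clear -le cE n0 kill; have := leq_mul (leqnn (4 * P)) le.
  lia.
have [|||||||Z [X [Y [Zi Xi Yi EXY]]]] := @embed3 K (4 * P) a b c (D1 v) (D2 v) (n * Q2) Q2 (E' v) n0 b0 c0.
- lia.
- by apply: spread3_sub (hv v) => w x y; rewrite /E'; case: (E v w x y); rewrite ?leq_b1.
- by move=> w; apply: spread2_sub (hvw v w) => x y; rewrite /E'; case: (E v w x y); rewrite ?leq_b1.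
- exact: D12.
- by rewrite -ltnS.
- by rewrite leq_pmull.
- by rewrite /Q2 ltnS leq_mul2r; apply/orP; right; lia.
exists (v, (Z, (X, Y))); first by split=> // j' k l; have /and5P[] := EXY j' k l.
pose j0 := Ordinal a0; pose k0 := Ordinal b0; pose l0 := Ordinal c0.
have nV v' : v' \in W1 -> v <> v'.
  by move=> wW e; have /and5P[_ + _ _ _] := EXY j0 k0 l0; rewrite e wW.
have nW q w : w \in W2 -> Z q <> w.
  by move=> wW e; have /and5P[_ _ + _ _] := EXY q k0 l0; rewrite e wW.
have nX q x : x \in W3 -> X q <> x.
  by case: q => q k xW e; have /and5P[_ _ _ + _] := EXY q k l0; rewrite e xW.
have nY q y : y \in W4 -> Y q <> y.
  by case: q => q [k l] yW e; have /and5P[_ _ _ _ +] := EXY q k l; rewrite e yW.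
move=> i; split; split=> /=.
- by apply/nesym/nV/imsetP; exists i.
- by move=> k k'; apply/nesym/nW/imsetP; exists (i, k).
- by move=> k k'; apply/nesym/nX/imsetP; exists (i, k).
- by move=> k k'; apply/nesym/nY/imsetP; exists (i, k).
- by apply/nV/imsetP; exists i.
- by move=> k k'; apply/nW/imsetP; exists (i, k').
- by move=> k k'; apply/nX/imsetP; exists (i, k').
- by move=> k k'; apply/nY/imsetP; exists (i, k').
Qed.
End Embedding.

(** * Heavy vertices and edge orderings *)

Section Heavy.
Variable V : finType.
Implicit Types (W : {set V}) (f : V -> nat).

(** The condition [0 < f u] matters when [f] vanishes identically: every vertex would otherwise
    qualify and [card_heavy] would fail. *)
Definition heavy m f := [set u | (0 < f u) && (\sum_z f z <= m * f u)].

Lemma card_heavy m f : #|heavy m f| <= m.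
Proof.
have [->|[u0]] := set_0Vmem (heavy m f); first by rewrite cards0.
rewrite inE => /andP[f0 _].
have S0 : 0 < \sum_z f z by rewrite (bigD1 u0) //= ltn_addr.
rewrite -(leq_pmul2r S0) -sum_nat_const.
apply: leq_trans (_ : \sum_(u in heavy m f) m * f u <= _).
  by apply: leq_sum => u; rewrite inE => /andP[].
rewrite -big_distrr /= leq_mul2l; apply/orP; right.
by rewrite big_mkcond; apply: leq_sum => u _; case: ifP.
Qed.

Lemma heavyS m m' f : m <= m' -> heavy m f \subset heavy m' f.
Proof.
move=> mm; apply/subsetP => u; rewrite !inE => /andP[-> h] /=.
by apply: leq_trans h _; rewrite leq_mul2r mm orbT.
Qed.

Lemma notin_heavyS m m' f u : m <= m' -> u \notin heavy m' f -> u \notin heavy m f.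
Proof. by move=> mm; apply: contraNN; apply/subsetP/heavyS. Qed.

Lemma notin_heavy m f u : u \notin heavy m f -> m * f u <= \sum_z f z.
Proof. by rewrite inE; case: posnP => [->|] /=; [rewrite muln0 | rewrite -ltnNge => _ /ltnW]. Qed.

(** A light vertex carries at most a 1/m share of the total, so m/K of them carry at most a 1/K
    share. *)
Lemma heavy_kill K m f W : K * #|W| <= m ->
  K * \sum_(u | (u \in W) && (u \notin heavy m f)) f u <= \sum_z f z.
Proof.
move=> KW; have [W0|W0] := posnP #|W|.
  by rewrite big1 ?muln0 // => u; rewrite (cards0_eq W0) inE.
rewrite -(leq_pmul2l W0) mulnA [X in X * _]mulnC.
apply: leq_trans (leq_mul KW (leqnn _)) _; rewrite big_distrr /=.
apply: leq_trans (_ : \sum_(u in W) \sum_z f z <= _); last by rewrite sum_nat_const.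
by rewrite big_mkcondr; apply: leq_sum => u _; case: ifP => // /notin_heavy.
Qed.
End Heavy.

Section Edges.
Variables (V : finType) (G : {set {set V}}).
Hypothesis uG : uniform 4 G.
Implicit Types (W : {set V}) (P : pred V).

(** Repeated arguments exclude themselves: the set would have fewer than four elements, against
    uniformity. *)
Definition edge v w x y := [set z in [:: v; w; x; y]] \in G.

Ltac setperm := apply: (f_equal (fun A => A \in G)); apply/setP => ?; rewrite !inE; do 4!case: (_ == _).

Lemma edgeC12 v w x y : edge v w x y = edge w v x y.
Proof. by rewrite /edge; setperm. Qed.
Lemma edgeC23 v w x y : edge v w x y = edge v x w y.
Proof. by rewrite /edge; setperm. Qed.
Lemma edgeC34 v w x y : edge v w x y = edge v w y x.
Proof. by rewrite /edge; setperm. Qed.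

Lemma edge_uniq v w x y : edge v w x y -> uniq [:: v; w; x; y].
Proof.
by move/uG; rewrite cardsE => c4; apply/card_uniqP.
Qed.

Definition d3 v w x : nat := \sum_y edge v w x y.
Definition d2 v w := \sum_x d3 v w x.
Definition d1 v := \sum_w d2 v w.
Definition d0 := \sum_v d1 v.

Lemma d3C v w x : d3 v w x = d3 w v x.
Proof. by apply: eq_bigr => y _; rewrite edgeC12. Qed.

Lemma d0E : d0 = cnt4 edge. Proof. by []. Qed.

Lemma cnt4_pair (E : V -> V -> V -> V -> bool) :
  cnt4 E = #|[set t : V * (V * (V * V)) | E t.1 t.2.1 t.2.2.1 t.2.2.2]|.
Proof.
rewrite -sum1_card [RHS]big_mkcond /=.
transitivity (\sum_(t : V * (V * (V * V))) E t.1 t.2.1 t.2.2.1 t.2.2.2 : nat); last first.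
  by apply: eq_bigr => t _; rewrite inE; case: (E _ _ _ _).
rewrite -(pair_big xpredT xpredT (fun v q => (E v q.1 q.2.1 q.2.2 : nat))) /=.
apply: eq_bigr => v _.
rewrite -(pair_big xpredT xpredT (fun w q => (E v w q.1 q.2 : nat))) /=.
apply: eq_bigr => w _.
by rewrite -(pair_big xpredT xpredT (fun x y => (E v w x y : nat))).
Qed.

(** Every edge may choose its own ordering, and a tuple determines its set, so distinct edges use
    distinct tuples. This turns case distinctions on orderings into counts. *)
Lemma card_edges_leq (E : V -> V -> V -> V -> bool) :
  (forall A, A \in G -> exists v w x y, A = [set z in [:: v; w; x; y]] /\ E v w x y) ->
  #|G| <= cnt4 E.
Proof.
move=> GE; rewrite cnt4_pair.
apply: leq_trans (leq_imset_card (fun t : V * (V * (V * V)) => [set z in [:: t.1; t.2.1; t.2.2.1; t.2.2.2]]) _).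
apply: subset_leq_card; apply/subsetP => A /GE[v [w [x [y [-> Evwxy]]]]].
by apply/imsetP; exists (v, (w, (x, y))); rewrite ?inE.
Qed.

Lemma edge_ex A : A \in G -> exists v w x y, A = [set z in [:: v; w; x; y]] /\ edge v w x y.
Proof.
move=> AG; have := uG AG; rewrite cardE => c4.
have AE : A = [set z in enum A] by apply/setP => z; rewrite inE mem_enum.
move: c4 AE; case: (enum A) => [|v [|w [|x [|y [|]]]]] //= _ AE.
by exists v, w, x, y; split=> //; rewrite /edge -AE.
Qed.

Lemma card_G_leq_d0 : #|G| <= d0.
Proof. by rewrite d0E; apply: card_edges_leq => A /edge_ex. Qed.

(** A crude count: [256 = 4 ^ 4] quadruples have their entries in a given edge. *)
Lemma d0_leq : d0 <= 256 * #|G|.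
Proof.
rewrite d0E cnt4_pair; set S := [set _ | _].
have sub : S \subset \bigcup_(A in G) setX A (setX A (setX A A)).
  apply/subsetP => -[v [w [x y]]]; rewrite inE /= => e.
  by apply/bigcupP; exists [set z in [:: v; w; x; y]] => //; rewrite !inE !eqxx ?orbT.
apply: leq_trans (subset_leq_card sub) _.
apply: leq_trans (card_bigcup_leq _ _) _; rewrite mulnC -sum_nat_const.
by apply: leq_sum => A /uG c4; rewrite !cardsX c4.
Qed.

(** Symmetry of [edge] moves a restriction on any coordinate to the first one, where [heavy_kill]
    applies; the companions for [cnt3] and [cnt4] serve the same end. *)
Lemma cnt2_P1 P v w : cnt2 (fun x y => edge v w x y && P x) = \sum_(x | P x) d3 v w x.
Proof.
rewrite [RHS]big_mkcond; apply: eq_bigr => x _.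
by case: (P x); [apply: eq_bigr | rewrite big1 //] => y _; rewrite ?andbT ?andbF.
Qed.

Lemma cnt2_P2 P v w : cnt2 (fun x y => edge v w x y && P y) = \sum_(x | P x) d3 v w x.
Proof.
rewrite -cnt2_P1 /cnt2 exchange_big; apply: eq_bigr => x _; apply: eq_bigr => y _.
by rewrite edgeC34.
Qed.

Lemma cnt3_P1 P v : cnt3 (fun w x y => edge v w x y && P w) = \sum_(w | P w) d2 v w.
Proof.
rewrite [RHS]big_mkcond; apply: eq_bigr => w _.
case: (P w); first by apply: eq_bigr => x _; apply: eq_bigr => y _; rewrite andbT.
by rewrite /cnt2 big1 // => x _; rewrite big1 // => y _; rewrite andbF.
Qed.

Lemma cnt3_P2 P v : cnt3 (fun w x y => edge v w x y && P x) = \sum_(w | P w) d2 v w.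
Proof.
rewrite -cnt3_P1 /cnt3 /cnt2 exchange_big; do 2!apply: eq_bigr => ? _.
by apply: eq_bigr => ? _; rewrite edgeC23.
Qed.

Lemma cnt3_P3 P v : cnt3 (fun w x y => edge v w x y && P y) = \sum_(w | P w) d2 v w.
Proof.
rewrite -cnt3_P2; apply: eq_bigr => w _; rewrite /cnt2 exchange_big.
by do 2!apply: eq_bigr => ? _; rewrite edgeC34.
Qed.

Lemma cnt4_P1 P : cnt4 (fun v w x y => edge v w x y && P v) = \sum_(v | P v) d1 v.
Proof.
rewrite [RHS]big_mkcond; apply: eq_bigr => v _.
case: (P v); first by do 3!apply: eq_bigr => ? _; rewrite andbT.
by rewrite /cnt3 /cnt2 big1 // => w _; rewrite big1 // => x _; rewrite big1 // => y _; rewrite andbF.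
Qed.

Lemma cnt4_P2 P : cnt4 (fun v w x y => edge v w x y && P w) = \sum_(v | P v) d1 v.
Proof.
rewrite -cnt4_P1 /cnt4 /cnt3 /cnt2 exchange_big; do 3!apply: eq_bigr => ? _.
by apply: eq_bigr => ? _; rewrite edgeC12.
Qed.

Lemma cnt4_P3 P : cnt4 (fun v w x y => edge v w x y && P x) = \sum_(v | P v) d1 v.
Proof. by rewrite -cnt4_P2; apply: eq_bigr => v _; rewrite cnt3_P2 cnt3_P1. Qed.

Lemma cnt4_P4 P : cnt4 (fun v w x y => edge v w x y && P y) = \sum_(v | P v) d1 v.
Proof. by rewrite -cnt4_P2; apply: eq_bigr => v _; rewrite cnt3_P3 cnt3_P1. Qed.

End Edges.

Section Orders.
Variables (V : finType) (G : {set {set V}}).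
Let edge := edge G.
Let h0 m := heavy m (d1 G).
Let h1 m v := heavy m (d2 G v).
Let h2 m v w := heavy m (d3 G v w).

Lemma h2C m v w : h2 m v w = h2 m w v.
Proof.
apply/setP => u; rewrite !inE d3C; congr (_ && (_ <= _)).
by apply: eq_bigr => z _; rewrite d3C.
Qed.

Definition spans (S : {set V}) v w x y := [set z in [:: v; w; x; y]] = S.

Ltac setperm := rewrite /spans => <-; apply/setP => ?; rewrite !inE; do 4!case: (_ == _).

Ltac spansof s := move: s; setperm.

Lemma spans12 S v w x y : spans S v w x y -> spans S w v x y.
Proof. by setperm. Qed.
Lemma spans23 S v w x y : spans S v w x y -> spans S v x w y.
Proof. by setperm. Qed.
Lemma spans34 S v w x y : spans S v w x y -> spans S v w y x.
Proof. by setperm. Qed.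

Section OrderI.
Variables A M c : nat.
Hypotheses (AM : A <= M) (cM : c <= M).

(* In an unordered edge either some ordering is good, i.e. fit for the greedy
   embedding, or some ordering lies in one of the exceptional configurations
   evI1, ..., evI5, each of which occurs rarely because heavy sets are small. *)
Definition goodI v w x y := [&& edge v w x y, w \notin h1 A v,
  (x \notin h1 M v) || (x \notin h2 M v w), (y \notin h1 M v) || (y \notin h2 M v w),
  x \notin h2 c v w & y \notin h2 c v w].

Definition evI1 i j l m := (l \in h2 c i j) && (m \in h2 c i l).
Definition evI2 i j l (m : V) := (j \in h1 M i) && (l \in h1 A j).
Definition evI3 i j l m := (j \in h1 A i) && (m \in h1 M l).
Definition evI4 i j l m := [&& j \in h1 M i, l \in h2 M i j & m \in h2 M j l].
Definition evI5 i j l m := [&& j \in h1 M i, l \in h2 M i j & m \in h2 M i l].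
Definition evI i j l m :=
  [|| evI1 i j l m, evI2 i j l m, evI3 i j l m, evI4 i j l m | evI5 i j l m].

(** Suppose every ordering of [S] fails both, and call [j \in h1 M i] an arrow from i to j. Then
    every vertex has an outgoing arrow ([arrow]) and every pair has a vertex heavy over it ([pair]),
    yet the pair joined by an arrow has none ([last]). Failure of [goodI] supplies heavy vertices;
    absence of [evI] forbids chaining them. *)
Lemma goodI_or_evI S v w x y : S \in G -> spans S v w x y ->
  exists v w x y, spans S v w x y /\ (goodI v w x y || evI v w x y).
Proof.
move=> SG Sp; apply: contrapT => no.
have {}no i j l m : spans S i j l m -> goodI i j l m = false /\ evI i j l m = false.
  move=> s; suff : ~~ (goodI i j l m || evI i j l m) by rewrite negb_or => /andP[/negbTE-> /negbTE->].
  by apply/negP => h; apply: no; exists i, j, l, m.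
have E i j l m : spans S i j l m -> edge i j l m by move=> s; move: SG; rewrite -s.
have nE i j l m (s : spans S i j l m) : [/\ ~~ evI1 i j l m, ~~ evI2 i j l m, ~~ evI3 i j l m,
    ~~ evI4 i j l m & ~~ evI5 i j l m].
  by have [_ /negbT] := no _ _ _ _ s; rewrite !negb_or => /and5P.
have clear1 i j l m : spans S i j l m -> l \notin h1 M i -> m \notin h1 M i -> j \notin h1 M i ->
    (l \in h2 c i j) || (m \in h2 c i j).
  move=> s li mi ji; have [+ _] := no _ _ _ _ s.
  rewrite /goodI (E _ _ _ _ s) li mi (notin_heavyS AM ji) /= -negb_or => /negbT.
  by rewrite negbK.
(* Over a vertex i without arrows, draw j -> l when [l \in h2 c i j]. By [clear1] each of j, l, m
   has an outgoing edge. Given j -> l, [evI1] forces l -> j, and then m -> j or m -> l starts a path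
   through all three, again an [evI1]. *)
have clear2 i j l m : spans S i j l m -> j \notin h1 M i -> l \notin h1 M i -> m \notin h1 M i ->
    l \notin h2 c i j.
  move=> s ji li mi; apply/negP => lj.
  have [n1 _ _ _ _] := nE _ _ _ _ s; rewrite /evI1 lj /= in n1.
  have := clear1 _ _ _ _ (spans23 s) ji mi li; rewrite (negPf n1) orbF => jl.
  have := clear1 _ _ _ _ (spans23 (spans34 s)) ji li mi => /orP[jm|lm].
    by have [] := nE _ _ _ _ (spans23 (spans34 s)); rewrite /evI1 jm lj.
  have [] := nE _ _ _ _ (spans34 (spans23 (spans34 s))).
  by rewrite /evI1 lm jl.
have arrow i j l m : spans S i j l m -> [|| j \in h1 M i, l \in h1 M i | m \in h1 M i].
  move=> s; apply: contraT; rewrite !negb_or => /and3P[ji li mi].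
  have := clear1 _ _ _ _ s li mi ji; rewrite (negPf (clear2 _ _ _ _ s ji li mi)).
  by rewrite (negPf (clear2 _ _ _ _ (spans34 s) ji mi li)).
have freeA i j l m : spans S i j l m -> l \notin h2 M i j -> m \notin h2 M i j -> j \in h1 A i.
  move=> s lij mij; apply: contraT => ji; have [+ _] := no _ _ _ _ s.
  by rewrite /goodI (E _ _ _ _ s) ji lij mij !orbT (notin_heavyS cM lij) (notin_heavyS cM mij).
(* If nothing is heavy over i, j, then [freeA] puts each of the two in [h1 A] of the other, and any
   arrow out of l completes an [evI2] or an [evI3]. *)
have pair i j l m : spans S i j l m -> (l \in h2 M i j) || (m \in h2 M i j).
  move=> s; apply: contraT; rewrite negb_or => /andP[lij mij].
  have ji := freeA _ _ _ _ s lij mij.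
  have ij : i \in h1 A j by apply: (freeA _ _ _ _ (spans12 s)); rewrite h2C.
  have := arrow _ _ _ _ (spans12 (spans23 s)) => /or3P[il|jl|ml].
  - by have [_ /negP[]] := nE _ _ _ _ (spans12 (spans23 s)); rewrite /evI2 il ji.
  - by have [_ /negP[]] := nE _ _ _ _ (spans23 (spans12 (spans23 s))); rewrite /evI2 jl ij.
  - by have [_ _ /negP[]] := nE _ _ _ _ s; rewrite /evI3 ji ml.
(* Excluding [evI4] and [evI5] makes each of i, j, l heavy over the other two; an arrow out of m
   into this triple then creates an [evI4]. *)
have last i j l m : spans S i j l m -> j \in h1 M i -> l \notin h2 M i j.
  move=> s ji; apply/negP => lij.
  have [_ _ _ n4 n5] := nE _ _ _ _ s; rewrite /evI4 /evI5 ji lij /= in n4 n5.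
  have := pair _ _ _ _ (spans23 (spans12 s)); rewrite (negPf n4) orbF => ijl.
  have := pair _ _ _ _ (spans23 s); rewrite (negPf n5) orbF => jil.
  have Smi : spans S m i j l by spansof s.
  have := arrow _ _ _ _ Smi => /or3P[im|jm|lm].
  - have := pair _ _ _ _ Smi => /orP[jmi|lmi].
      by have [_ _ _ /negP[]] := nE _ _ _ _ Smi; rewrite /evI4 im jmi lij.
    have s' : spans S m i l j by spansof s.
    by have [_ _ _ /negP[]] := nE _ _ _ _ s'; rewrite /evI4 im lmi jil.
  - have s' : spans S m j i l by spansof s.
    have s'' : spans S m j l i by spansof s.
    have := pair _ _ _ _ s' => /orP[imj|lmj].
      by have [_ _ _ /negP[]] := nE _ _ _ _ s'; rewrite /evI4 jm imj h2C lij.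
    by have [_ _ _ /negP[]] := nE _ _ _ _ s''; rewrite /evI4 jm lmj ijl.
  - have s' : spans S m l i j by spansof s.
    have s'' : spans S m l j i by spansof s.
    have := pair _ _ _ _ s' => /orP[iml|jml].
      by have [_ _ _ /negP[]] := nE _ _ _ _ s'; rewrite /evI4 lm iml h2C jil.
    by have [_ _ _ /negP[]] := nE _ _ _ _ s''; rewrite /evI4 lm jml h2C ijl.
have noarrow i j l m : spans S i j l m -> j \notin h1 M i.
  move=> s; apply/negP => ji; have := pair _ _ _ _ s.
  rewrite (negPf (last _ _ _ _ s ji)) /=.
  by rewrite (negPf (last _ _ _ _ (spans34 s) ji)).
have := arrow _ _ _ _ Sp; rewrite (negPf (noarrow _ _ _ _ Sp)).
rewrite (negPf (noarrow _ _ _ _ (spans23 Sp))).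
by rewrite (negPf (noarrow _ _ _ _ (spans23 (spans34 Sp)))).
Qed.
End OrderI.

Section OrderII.
Variables A B M b c S2 S3 S4 : nat.
Hypotheses (BM : B <= M) (S23 : S2 <= S3) (S34 : S3 <= S4).

(* The same alternative for edges meeting the set of vertices of large degree,
   started at such a vertex. *)
Definition goodII v w x y := [&& edge v w x y,
  [&& w \notin h0 S2, x \notin h0 S3 & y \notin h0 S4],
  [&& w \notin h1 A v, x \notin h1 B v & y \notin h1 M v],
  x \notin h2 b v w & y \notin h2 c v w].

Definition evIIa v w x y := [&& v \in h0 S4, (w \in h0 S4) || (w \in h1 M v),
  (x \in h0 S4) || (x \in h1 M v) & (y \in h0 S4) || (y \in h1 M v)].
Definition evIIb1 v w x (y : V) := [&& v \in h0 S3, w \in h0 S3 & x \in h0 S3].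
Definition evIIb2 v w x (y : V) := [&& v \in h0 S3, w \in h0 S3 & x \in h1 B v].
Definition evIIb3 v w x (y : V) := [&& v \in h0 S4, w \in h1 B v & x \in h1 B v].
Definition evIIc v w (x y : V) := (v \in h0 S2) && (w \in h0 S2).
Definition evIId v w (x y : V) := (v \in h0 S4) && (w \in h1 A v).
Definition evIIe v w x (y : V) := (v \in h0 S4) && (x \in h2 b v w).
Definition evIIf v w x y := [&& v \in h0 S4, x \in h2 c v w & y \in h2 c v w].
Definition evIIg v w x y := [&& v \in h0 S4, x \in h0 S4 & y \in h2 c v w].
Definition evIIh v w x y := [&& v \in h0 S4, x \in h1 M v & y \in h2 c v w].
Definition evII v w x y := [|| evIIa v w x y, evIIb1 v w x y, evIIb2 v w x y, evIIb3 v w x y |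
  [|| evIIc v w x y, evIId v w x y, evIIe v w x y, evIIf v w x y, evIIg v w x y | evIIh v w x y]].

(** The first vertex is taken in [h0 S2] if [S] meets it, else in [h0 S3], else in [h0 S4]; then no
    other vertex lies in [h0 S2], by [evIIc]. Without [evIIa] some other vertex can be put last
    ([main1]); without [evIIb1], [evIIb2], [evIIb3] one of the remaining two can be put third
    ([main2]). What can still go wrong, even after exchanging the last two, is listed in [evIId] to
    [evIIh]. *)
Lemma goodII_or_evII S v w x y : S \in G -> spans S v w x y -> v \in h0 S4 ->
  exists v w x y, spans S v w x y /\ (goodII v w x y || evII v w x y).
Proof.
move=> SG Sp v4; apply: contrapT => no.
have {}no i j l m : spans S i j l m -> goodII i j l m = false /\ evII i j l m = false.
  move=> s; suff : ~~ (goodII i j l m || evII i j l m) by rewrite negb_or => /andP[/negbTE-> /negbTE->].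
  by apply/negP => h; apply: no; exists i, j, l, m.
have E i j l m : spans S i j l m -> edge i j l m by move=> s; move: SG; rewrite -s.
have nE i j l m (s : spans S i j l m) : evII i j l m -> False by have [_ ->] := no _ _ _ _ s.
have main2 i j l m : spans S i j l m -> i \in h0 S4 ->
   j \notin h0 S2 -> l \notin h0 S3 -> l \notin h1 B i -> m \notin h0 S4 -> m \notin h1 M i -> False.
  move=> s i4 j2 l3 lB m4 mM.
  have s' := spans34 s.
  have jA : j \notin h1 A i.
    by apply/negP => jA; apply: (nE _ _ _ _ s); rewrite /evII /evIId i4 jA ?orbT.
  have lb : l \notin h2 b i j.
    by apply/negP => lb; apply: (nE _ _ _ _ s); rewrite /evII /evIIe i4 lb ?orbT.
  have mb : m \notin h2 b i j.
    by apply/negP => mb; apply: (nE _ _ _ _ s'); rewrite /evII /evIIe i4 mb ?orbT.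
  have mc : m \in h2 c i j.
    apply: contraT => mc; have [+ _] := no _ _ _ _ s.
    by rewrite /goodII (E _ _ _ _ s) j2 l3 m4 jA lB mM lb mc.
  have l4 : l \notin h0 S4.
    by apply/negP => l4; apply: (nE _ _ _ _ s); rewrite /evII /evIIg i4 l4 mc ?orbT.
  have lM : l \notin h1 M i.
    by apply/negP => lM; apply: (nE _ _ _ _ s); rewrite /evII /evIIh i4 lM mc ?orbT.
  have lc : l \notin h2 c i j.
    by apply/negP => lc; apply: (nE _ _ _ _ s); rewrite /evII /evIIf i4 lc mc ?orbT.
  have [+ _] := no _ _ _ _ s'.
  by rewrite /goodII (E _ _ _ _ s') j2 (notin_heavyS S34 m4) l4 jA (notin_heavyS BM mM) lM mb lc.
have main1 i j l m : spans S i j l m -> i \in h0 S4 ->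
   (forall u, u \in S -> u \in h0 S3 -> i \in h0 S3) ->
   (forall u, u \in [:: j; l; m] -> u \notin h0 S2) ->
   m \notin h0 S4 -> m \notin h1 M i -> False.
  move=> s i4 i3 i2 m4 mM.
  have inS u : u \in [:: i; j; l; m] -> u \in S by move: s; rewrite /spans => <- us; rewrite inE.
  have [] := boolP ((l \in h0 S3) || (l \in h1 B i)); last first.
    rewrite negb_or => /andP[l3 lB].
    by apply: (main2 _ _ _ _ s) => //; apply: i2; rewrite !inE eqxx.
  have [] := boolP ((j \in h0 S3) || (j \in h1 B i)); last first.
    rewrite negb_or => /andP[j3 jB] _.
    by apply: (main2 _ _ _ _ (spans23 s)) => //; apply: i2; rewrite !inE eqxx orbT.
  have s' := spans23 s.
  case/orP => hj /orP[] hl.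
  - apply: (nE _ _ _ _ s); rewrite /evII /evIIb1 hj hl (i3 j) ?orbT // inS //.
    by rewrite !inE eqxx ?orbT.
  - apply: (nE _ _ _ _ s); rewrite /evII /evIIb2 hj hl (i3 j) ?orbT // inS //.
    by rewrite !inE eqxx ?orbT.
  - apply: (nE _ _ _ _ s'); rewrite /evII /evIIb2 hj hl (i3 l) ?orbT // inS //.
    by rewrite !inE eqxx ?orbT.
  - by apply: (nE _ _ _ _ s); rewrite /evII /evIIb3 i4 hj hl ?orbT.
have main i j l m : spans S i j l m -> i \in h0 S4 ->
   (forall u, u \in S -> u \in h0 S3 -> i \in h0 S3) ->
   (forall u, u \in S -> u \in h0 S2 -> i \in h0 S2) -> False.
  move=> s i4 i3 i2.
  have inS u : u \in [:: i; j; l; m] -> u \in S by move: s; rewrite /spans => <- us; rewrite inE.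
  have no2 u p q : spans S i u p q -> u \notin h0 S2.
    move=> s'; apply/negP => u2; apply: (nE _ _ _ _ s'); rewrite /evII /evIIc u2 (i2 u) ?orbT //.
    by move: s'; rewrite /spans => <-; rewrite !inE eqxx ?orbT.
  have no2' u p q : spans S i u p q -> forall z, z \in [:: u; p; q] -> z \notin h0 S2.
    move=> s' z zl; have : [|| z == u, z == p | z == q] by move: zl; rewrite !inE.
    case/or3P => /eqP->.
    + exact: (no2 _ _ _ s').
    + exact: (no2 _ _ _ (spans23 s')).
    + exact: (no2 _ _ _ (spans23 (spans34 s'))).
  have bad4 u p q : spans S i u p q -> (q \in h0 S4) || (q \in h1 M i).
    move=> s'; apply: contraT; rewrite negb_or => /andP[q4 qM].
    by case: (main1 _ _ _ _ s' i4 i3 (no2' _ _ _ s') q4 qM).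
  apply: (nE _ _ _ _ s); rewrite /evII /evIIa i4 (bad4 _ _ _ s) (bad4 _ _ _ (spans34 s)).
  by rewrite (bad4 _ _ _ (spans34 (spans23 s))).
have lead u : u \in S -> exists p q t, spans S u p q t.
  move=> uS; have : [|| u == v, u == w, u == x | u == y].
    by move: Sp uS; rewrite /spans => <-; rewrite !inE.
  case/or4P => /eqP->.
  - by exists w, x, y; spansof Sp.
  - by exists v, x, y; spansof Sp.
  - by exists v, w, y; spansof Sp.
  - by exists v, w, x; spansof Sp.
have sub23 u : u \in h0 S2 -> u \in h0 S3 by apply/subsetP/heavyS.
have sub34 u : u \in h0 S3 -> u \in h0 S4 by apply/subsetP/heavyS.
have [/exists_inP[u uS u2]|/exists_inPn n2] := boolP [exists u in S, u \in h0 S2].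
  have [p [q [t s]]] := lead u uS.
  by apply: (main _ _ _ _ s) => *; auto.
have [/exists_inP[u uS u3]|/exists_inPn n3] := boolP [exists u in S, u \in h0 S3].
  have [p [q [t s]]] := lead u uS.
  by apply: (main _ _ _ _ s) => [|//|z /n2/negPf->//]; auto.
by apply: (main _ _ _ _ Sp) => [//|z /n3/negPf->//|z /n2/negPf->//].
Qed.
End OrderII.
End Orders.

(** * Finding star forests *)

Section Counting.
Variable V : finType.

Lemma sum_cap (S : {set V}) (f : V -> nat) p k :
  #|S| <= p -> (forall u, u \notin S -> f u = 0) -> (forall u, u \in S -> f u <= k) ->
  \sum_u f u <= p * k.
Proof.
move=> Sp f0 fk; rewrite (bigID (mem S)) /= addnC big1 //=.
apply: leq_trans (_ : \sum_(u in S) k <= _); first exact: leq_sum.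
by rewrite sum_nat_const leq_mul2r Sp orbT.
Qed.

Lemma cnt4_cap (E : V -> V -> V -> V -> bool) (P1 : {set V}) (P2 : V -> {set V})
    (P3 : V -> V -> {set V}) (P4 : V -> V -> V -> {set V}) p1 p2 p3 p4 :
  #|P1| <= p1 -> (forall v, #|P2 v| <= p2) -> (forall v w, #|P3 v w| <= p3) ->
  (forall v w x, #|P4 v w x| <= p4) ->
  (forall v w x y, E v w x y -> [&& v \in P1, w \in P2 v, x \in P3 v w & y \in P4 v w x]) ->
  cnt4 E <= p1 * (p2 * (p3 * p4)).
Proof.
move=> c1 c2 c3 c4 EP.
have h v w x y : ~~ [&& v \in P1, w \in P2 v, x \in P3 v w & y \in P4 v w x] -> E v w x y = false.
  by move=> nP; apply/negbTE; apply: contraNN nP; exact: EP.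
apply: (sum_cap c1) => v vP.
  rewrite /cnt3 /cnt2 big1 // => w _; rewrite big1 // => x _; rewrite big1 // => y _.
  by rewrite h // (negPf vP).
apply: (sum_cap (c2 v)) => w wP.
  by rewrite /cnt2 big1 // => x _; rewrite big1 // => y _; rewrite h // vP (negPf wP).
apply: (sum_cap (c3 v w)) => x xP.
  by rewrite big1 // => y _; rewrite h // vP wP (negPf xP).
rewrite -[p4]muln1; apply: (sum_cap (c4 v w x)) => y yP; last exact: leq_b1.
by rewrite h // vP wP xP (negPf yP).
Qed.

Definition col (i : nat) : 'I_4 := inord i.

Definition coloured (chi : V -> 'I_4) (E : V -> V -> V -> V -> bool) v w x y :=
  [&& E v w x y, chi v == col 0, chi w == col 1, chi x == col 2 & chi y == col 3].

(** A random colouring gives a tuple the pattern 0, 1, 2, 3 with probability 1/256, and some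
    colouring reaches the average. Distinct colours keep the four levels of a forest disjoint, so
    the embedding only has to separate vertices of the same level. *)
Lemma colouring (E : V -> V -> V -> V -> bool) :
  (forall v w x y, E v w x y -> uniq [:: v; w; x; y]) ->
  exists chi : V -> 'I_4, cnt4 E <= 256 * cnt4 (coloured chi E).
Proof.
move=> uE; pose Q := (V * (V * (V * V)))%type.
pose ok (chi : {ffun V -> 'I_4}) (t : Q) :=
  [&& chi t.1 == col 0, chi t.2.1 == col 1, chi t.2.2.1 == col 2 & chi t.2.2.2 == col 3].
pose S := [set t : Q | E t.1 t.2.1 t.2.2.1 t.2.2.2].
have okN t : t \in S -> #|{ffun V -> 'I_4}| <= 256 * #|[set chi | ok chi t]|.
  case: t => v [w [x y]]; rewrite inE /= => /uE.
  rewrite /= !inE !negb_or => /and4P[/and3P[vw vx vy] /andP[wx wy] xy _].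
  (* [g] overwrites the four colours by the prescribed pattern and records the old ones; this makes
     it injective and yields the factor 256. *)
  pose g (chi : {ffun V -> 'I_4}) : {ffun V -> 'I_4} * ('I_4 * ('I_4 * ('I_4 * 'I_4))) :=
    ([ffun u => if u == v then col 0 else if u == w then col 1 else if u == x then col 2
       else if u == y then col 3 else chi u], (chi v, (chi w, (chi x, chi y)))).
  have gi : injective g.
    move=> p q [/ffunP e ev ew ex ey]; apply/ffunP => u.
    have := e u; rewrite !ffunE; do 4![case: eqVneq => [->//|_]].
    by [].
  rewrite -(card_imset predT gi).
  have -> : 256 * #|[set chi | ok chi (v, (w, (x, y)))]| =
     #|setX [set chi | ok chi (v, (w, (x, y)))] [set: 'I_4 * ('I_4 * ('I_4 * 'I_4))]|.
    by rewrite cardsX cardsT !card_prod !card_ord mulnC.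
  apply: subset_leq_card; apply/subsetP => _ /imsetP[p _ ->].
  rewrite !inE /ok /= !ffunE !eqxx [w == v]eq_sym [x == v]eq_sym [x == w]eq_sym.
  by rewrite [y == v]eq_sym [y == w]eq_sym [y == x]eq_sym !(negPf vw, negPf vx, negPf vy, negPf wx, negPf wy, negPf xy) !eqxx.
have dbl : \sum_(chi : {ffun V -> 'I_4}) #|[set t in S | ok chi t]| =
           \sum_(t in S) #|[set chi | ok chi t]|.
  transitivity (\sum_(chi : {ffun V -> 'I_4}) \sum_(t in S) (ok chi t : nat)).
    apply: eq_bigr => chi _; rewrite -sum1_card [LHS]big_mkcond [RHS]big_mkcond.
    by apply: eq_bigr => t _; rewrite inE; case: (t \in S) => //=; case: (ok chi t).
  rewrite exchange_big; apply: eq_bigr => t _; rewrite -sum1_card [RHS]big_mkcond.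
  by apply: eq_bigr => chi _; rewrite inE; case: (ok chi t).
have le : #|{ffun V -> 'I_4}| * #|S| <= \sum_(chi : {ffun V -> 'I_4}) 256 * #|[set t in S | ok chi t]|.
  rewrite -big_distrr /= dbl big_distrr mulnC -sum_nat_const /=.
  by apply: leq_sum => t; exact: okN.
have [chi hchi] : exists chi : {ffun V -> 'I_4}, #|S| < (256 * #|[set t in S | ok chi t]|).+1.
  apply: (@sum_ltn_ex _ (fun=> #|S|)).
  have -> : \sum_(chi : {ffun V -> 'I_4}) (256 * #|[set t in S | ok chi t]|).+1 =
      \sum_(chi : {ffun V -> 'I_4}) 256 * #|[set t in S | ok chi t]| + #|{ffun V -> 'I_4}|.
    by rewrite -sum1_card -big_split /=; apply: eq_bigr => chi _; rewrite addn1.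
  rewrite sum_nat_const; apply: leq_trans (_ : _ < #|{ffun V -> 'I_4}| * #|S| + #|{ffun V -> 'I_4}|) _.
    by rewrite -addn1 leq_add2l; apply/card_gt0P; exists [ffun=> col 0].
  by rewrite leq_add2r.
exists chi; rewrite !cnt4_pair -ltnS; apply: leq_trans hchi _; rewrite ltnS leq_mul2l.
apply/orP; right; apply: subset_leq_card; apply/subsetP => t.
by rewrite !inE /coloured => /andP[-> /and4P[-> -> -> ->]].
Qed.
End Counting.

Section Spread.
Variables (V : finType) (G : {set {set V}}).
Let edge := edge G.
Let h0 m := heavy m (d1 G).
Let h1 m v := heavy m (d2 G v).
Let h2 m v w := heavy m (d3 G v w).
Variable K : nat.

Lemma spread2_light b c v w (E : V -> V -> bool) :
  (forall x y, E x y -> [&& edge v w x y, x \notin h2 (K * b) v w & y \notin h2 (K * (b * c)) v w]) ->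
  spread2 K b c (d2 G v w) E.
Proof.
move=> hE; split=> W cW.
- apply: leq_trans (_ : K * cnt2 (fun x y => edge v w x y && ((x \in W) && (x \notin h2 (K * b) v w))) <= _).
    rewrite leq_mul2l leq_cnt2 ?orbT // => x y.
    by case: (E x y) (hE x y) => //= /(_ isT)/and3P[-> -> _]; rewrite andbT.
  by rewrite cnt2_P1 (leq_trans (heavy_kill _ _)) ?leq_mul ?leq_pmull // /d2.
- apply: leq_trans (_ : K * cnt2 (fun x y => edge v w x y && ((y \in W) && (y \notin h2 (K * (b * c)) v w))) <= _).
    rewrite leq_mul2l leq_cnt2 ?orbT // => x y.
    by case: (E x y) (hE x y) => //= /(_ isT)/and3P[-> _ ->]; rewrite andbT.
  by rewrite cnt2_P2 (leq_trans (heavy_kill _ _)) ?leq_mul ?leq_pmull // /d2.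
Qed.

Lemma spread3_light A B M a b c v (E : V -> V -> V -> bool) :
  K * a <= A -> K * (a * b) <= B -> K * (a * (b * c)) <= M ->
  (forall w x y, E w x y -> [&& edge v w x y, w \notin h1 A v,
     (x \notin h1 B v) || (x \notin h2 B v w) & (y \notin h1 M v) || (y \notin h2 M v w)]) ->
  spread3 K a b c (d1 G v) E.
Proof.
move=> KA KB KM hE.
(* A vertex x of [W] is light over v or over the pair v, w. Each alternative costs d1/K, which is
   the origin of the factor 2 in the [spread] predicates. *)
have two (W : {set V}) m : K * #|W| <= m ->
    K * (cnt3 (fun w x y => edge v w x y && ((x \in W) && (x \notin h1 m v))) +
         cnt3 (fun w x y => edge v w x y && ((x \in W) && (x \notin h2 m v w)))) <= 2 * d1 G v.
  move=> Wm; rewrite mulnDr mul2n -addnn leq_add //.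
    by rewrite cnt3_P2; apply: heavy_kill Wm.
  rewrite /cnt3 big_distrr; apply: leq_sum => w _ /=.
  by rewrite cnt2_P1; apply: heavy_kill Wm.
split=> W cW.
- apply: leq_trans (_ : K * cnt3 (fun w x y => edge v w x y && ((w \in W) && (w \notin h1 A v))) <= _).
    rewrite leq_mul2l leq_cnt3 ?orbT // => w x y.
    by case: (E w x y) (hE w x y) => //= /(_ isT)/and4P[-> -> _ _]; rewrite andbT.
  rewrite cnt3_P1 (leq_trans (heavy_kill _ _)) ?leq_pmull //.
  by apply: leq_trans KA; rewrite leq_mul2l cW orbT.
- apply: leq_trans (two W B _); last by apply: leq_trans KB; rewrite leq_mul2l cW orbT.
  rewrite leq_mul2l; apply/orP; right; apply: cnt3D => w x y.
  case: (E w x y) (hE w x y) => //= /(_ isT)/and4P[-> _ + _] /=.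
  by case: (x \in W) => //= /orP[->|->]; rewrite ?addn1 ?add1n.
- have two' : K * (cnt3 (fun w x y => edge v w x y && ((y \in W) && (y \notin h1 M v))) +
         cnt3 (fun w x y => edge v w x y && ((y \in W) && (y \notin h2 M v w)))) <= 2 * d1 G v.
    apply: leq_trans (two W M _); last by apply: leq_trans KM; rewrite leq_mul2l cW orbT.
    rewrite cnt3_P3 -cnt3_P2 leq_mul2l; apply/orP; right; rewrite leq_add2l; apply: leq_sum => w _.
    by rewrite cnt2_P2 -cnt2_P1.
  apply: leq_trans two'.
  rewrite leq_mul2l; apply/orP; right; apply: cnt3D => w x y.
  case: (E w x y) (hE w x y) => //= /(_ isT)/and4P[-> _ _] /=.
  by case: (y \in W) => //= /orP[->|->]; rewrite ?addn1 ?add1n.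
Qed.

Lemma spread4_light S2 S3 S4 r a b c (E : V -> V -> V -> V -> bool) :
  K * (r * a) <= S2 -> K * (r * (a * b)) <= S3 -> K * (r * (a * (b * c))) <= S4 ->
  K * (r * #|V| ^ 3) <= d0 G ->
  (forall v w x y, E v w x y -> [&& edge v w x y, w \notin h0 S2, x \notin h0 S3 & y \notin h0 S4]) ->
  spread4 K r a b c (d0 G) E.
Proof.
move=> K2 K3 K4 Kn hE; have rr : r.-1 <= r by exact: leq_pred.
have le2 m : m <= d0 G -> m <= 2 * d0 G by move=> mm; apply: leq_trans mm _; rewrite leq_pmull.
split=> W cW; apply: le2.
(* The first coordinate is controlled by size alone: at most [r * #|V| ^ 3] tuples start in [W]. *)
- apply: leq_trans Kn; rewrite leq_mul2l; apply/orP; right.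
  rewrite -[r * _]/(r * (#|V| * (#|V| * #|V|))).
  apply: (@cnt4_cap _ _ W (fun=> setT) (fun _ _ => setT) (fun _ _ _ => setT)); rewrite ?cardsT //.
    exact: leq_trans rr.
  by move=> v w x y /andP[_ vW]; rewrite !inE vW.
- apply: leq_trans (_ : K * cnt4 (fun v w x y => edge v w x y && ((w \in W) && (w \notin h0 S2))) <= _).
    rewrite leq_mul2l leq_cnt4 ?orbT // => v w x y.
    by case: (E v w x y) (hE v w x y) => //= /(_ isT)/and4P[-> -> _ _]; rewrite andbT.
  rewrite cnt4_P2; apply: (@heavy_kill _ K _ (d1 G)); apply: leq_trans K2; rewrite leq_mul2l; apply/orP; right.
  by rewrite (leq_trans cW) // leq_mul2r rr orbT.
- apply: leq_trans (_ : K * cnt4 (fun v w x y => edge v w x y && ((x \in W) && (x \notin h0 S3))) <= _).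
    rewrite leq_mul2l leq_cnt4 ?orbT // => v w x y.
    by case: (E v w x y) (hE v w x y) => //= /(_ isT)/and4P[-> _ -> _]; rewrite andbT.
  rewrite cnt4_P3; apply: (@heavy_kill _ K _ (d1 G)); apply: leq_trans K3; rewrite leq_mul2l; apply/orP; right.
  by rewrite (leq_trans cW) // leq_mul2r rr orbT.
- apply: leq_trans (_ : K * cnt4 (fun v w x y => edge v w x y && ((y \in W) && (y \notin h0 S4))) <= _).
    rewrite leq_mul2l leq_cnt4 ?orbT // => v w x y.
    by case: (E v w x y) (hE v w x y) => //= /(_ isT)/and4P[-> _ _ ->]; rewrite andbT.
  rewrite cnt4_P4; apply: (@heavy_kill _ K _ (d1 G)); apply: leq_trans K4; rewrite leq_mul2l; apply/orP; right.
  by rewrite (leq_trans cW) // leq_mul2r rr orbT.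
Qed.

(** The bounds in [spread4] carry [r.-1], the largest number of stars present when the next one is
    sought; for a single star every [W] is empty. *)
Lemma spread4_single a b c D (E : V -> V -> V -> V -> bool) : spread4 K 1 a b c D E.
Proof.
by split=> W; rewrite /= ?mul0n leqn0 cards_eq0 => /eqP->; rewrite /cnt4 /cnt3 /cnt2 big1 ?muln0 // => v _;
  rewrite big1 // => w _; rewrite big1 // => x _; rewrite big1 // => y _; rewrite inE andbF.
Qed.
End Spread.

Lemma cnt4_or (V : finType) (E1 E2 : V -> V -> V -> V -> bool) :
  cnt4 (fun v w x y => E1 v w x y || E2 v w x y) <= cnt4 E1 + cnt4 E2.
Proof. by apply: cnt4D => v w x y; case: (E1 v w x y) => //=; case: (E2 v w x y). Qed.

Lemma leq_cnt4_or (V : finType) (E1 E2 : V -> V -> V -> V -> bool) k1 k2 :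
  cnt4 E1 <= k1 -> cnt4 E2 <= k2 -> cnt4 (fun v w x y => E1 v w x y || E2 v w x y) <= k1 + k2.
Proof. by move=> h1 h2; apply: leq_trans (cnt4_or _ _) _; exact: leq_add. Qed.

Section Stars.
Variables (V : finType) (G : {set {set V}}).
Hypothesis uG : uniform 4 G.
Let n := #|V|.
Let edge := edge G.
Let h0 m := heavy m (d1 G).
Let h1 m v := heavy m (d2 G v).
Let h2 m v w := heavy m (d3 G v w).

(** Each summand multiplies, coordinate by coordinate, the size of the heavy set that must contain
    the coordinate, or [n] where it is free. *)
Lemma cnt_evI A M c : cnt4 (evI G A M c) <=
  n * (n * (c * c)) + (n * (M * (A * n)) + (n * (A * (n * M)) +
    (n * (M * (M * M)) + n * (M * (M * M))))).
Proof.
rewrite /evI; apply: leq_cnt4_or; [|apply: leq_cnt4_or; [|apply: leq_cnt4_or; [|apply: leq_cnt4_or]]].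
- apply: (@cnt4_cap _ _ setT (fun=> setT) (fun v w => h2 c v w) (fun v w x => h2 c v x));
    rewrite ?cardsT // => *; rewrite ?card_heavy // ?in_setT //.
- apply: (@cnt4_cap _ _ setT (fun v => h1 M v) (fun v w => h1 A w) (fun v w x => setT));
    rewrite ?cardsT // => *; rewrite ?card_heavy // ?in_setT ?andbT //.
- apply: (@cnt4_cap _ _ setT (fun v => h1 A v) (fun v w => setT) (fun v w x => h1 M x));
    rewrite ?cardsT // => *; rewrite ?card_heavy // ?in_setT //.
- apply: (@cnt4_cap _ _ setT (fun v => h1 M v) (fun v w => h2 M v w) (fun v w x => h2 M w x));
    rewrite ?cardsT // => *; rewrite ?card_heavy // ?in_setT //.
- apply: (@cnt4_cap _ _ setT (fun v => h1 M v) (fun v w => h2 M v w) (fun v w x => h2 M v x));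
    rewrite ?cardsT // => *; rewrite ?card_heavy // ?in_setT //.
Qed.

Lemma cnt_evII A B M b c S2 S3 S4 : cnt4 (evII G A B M b c S2 S3 S4) <=
  (S4 * ((S4 + M) * ((S4 + M) * (S4 + M))) + (S3 * (S3 * (S3 * n)) + (S3 * (S3 * (B * n)) +
    S4 * (B * (B * n))))) +
  (S2 * (S2 * (n * n)) + (S4 * (A * (n * n)) + (S4 * (n * (b * n)) + (S4 * (n * (c * c)) +
    (S4 * (n * (S4 * c)) + S4 * (n * (M * c))))))).
Proof.
have cU (P Q : {set V}) p q : #|P| <= p -> #|Q| <= q -> #|P :|: Q| <= p + q.
  by move=> hp hq; apply: leq_trans (leq_card_setU _ _) _; exact: leq_add.
rewrite /evII -!addnA.
apply: leq_cnt4_or; [|apply: leq_cnt4_or; [|apply: leq_cnt4_or; [|apply: leq_cnt4_or; [|apply: leq_cnt4_or; [|apply: leq_cnt4_or; [|apply: leq_cnt4_or; [|apply: leq_cnt4_or; [|apply: leq_cnt4_or]]]]]]]].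
- apply: (@cnt4_cap _ _ (h0 S4) (fun v => h0 S4 :|: h1 M v) (fun v w => h0 S4 :|: h1 M v) (fun v w x => h0 S4 :|: h1 M v)).
  1-4: by move=> *; rewrite ?cU ?card_heavy.
  by move=> v w x y; rewrite !in_setU.
- apply: (@cnt4_cap _ _ (h0 S3) (fun v => h0 S3) (fun v w => h0 S3) (fun v w x => setT));
    rewrite ?cardsT // => *; rewrite ?card_heavy // ?in_setT ?andbT //.
- apply: (@cnt4_cap _ _ (h0 S3) (fun v => h0 S3) (fun v w => h1 B v) (fun v w x => setT));
    rewrite ?cardsT // => *; rewrite ?card_heavy // ?in_setT ?andbT //.
- apply: (@cnt4_cap _ _ (h0 S4) (fun v => h1 B v) (fun v w => h1 B v) (fun v w x => setT));
    rewrite ?cardsT // => *; rewrite ?card_heavy // ?in_setT ?andbT //.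
- apply: (@cnt4_cap _ _ (h0 S2) (fun v => h0 S2) (fun v w => setT) (fun v w x => setT));
    rewrite ?cardsT // => *; rewrite ?card_heavy // ?in_setT ?andbT //.
- apply: (@cnt4_cap _ _ (h0 S4) (fun v => h1 A v) (fun v w => setT) (fun v w x => setT));
    rewrite ?cardsT // => *; rewrite ?card_heavy // ?in_setT ?andbT //.
- apply: (@cnt4_cap _ _ (h0 S4) (fun v => setT) (fun v w => h2 b v w) (fun v w x => setT));
    rewrite ?cardsT // => *; rewrite ?card_heavy // ?in_setT ?andbT //.
- apply: (@cnt4_cap _ _ (h0 S4) (fun v => setT) (fun v w => h2 c v w) (fun v w x => h2 c v w));
    rewrite ?cardsT // => *; rewrite ?card_heavy // ?in_setT ?andbT //.
- apply: (@cnt4_cap _ _ (h0 S4) (fun v => setT) (fun v w => h0 S4) (fun v w x => h2 c v w));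
    rewrite ?cardsT // => *; rewrite ?card_heavy // ?in_setT ?andbT //.
- apply: (@cnt4_cap _ _ (h0 S4) (fun v => setT) (fun v w => h1 M v) (fun v w x => h2 c v w));
    rewrite ?cardsT // => *; rewrite ?card_heavy // ?in_setT ?andbT //.
Qed.

(** [chi] belongs to the conclusion because it separates vertices of different levels; the
    injectivity clauses act within one level. *)
Definition has_star_forest r a b c :=
  exists (U : 'I_r -> V) (Z : 'I_r * 'I_a -> V) (X : 'I_r * ('I_a * 'I_b) -> V)
    (Y : 'I_r * ('I_a * ('I_b * 'I_c)) -> V) (chi : V -> 'I_4),
    [/\ injective U, injective Z, injective X, injective Y &
      forall i j k l, coloured chi edge (U i) (Z (i, j)) (X (i, (j, k))) (Y (i, (j, (k, l))))].

Variables (P K r a b c : nat).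
(** [P] collects the losses between [d0] and the coloured good tuples: 256 from orderings, 4 from
    discarded edges, 256 from the colouring. [48 * P] is what [embed4] asks of [K]. *)
Hypotheses (hP : 256 * (256 * 4) <= P) (hK : K = 48 * P).
Hypotheses (n0 : 0 < n) (a0 : 0 < a) (b0 : 0 < b) (c0 : 0 < c).

Lemma embed_good (E : V -> V -> V -> V -> bool) :
  (forall v w x y, E v w x y -> edge v w x y) -> #|G| <= 4 * cnt4 E ->
  spread4 K r a b c (d0 G) E ->
  (forall v, spread3 K a b c (d1 G v) (E v)) ->
  (forall v w, spread2 K b c (d2 G v w) (E v w)) ->
  n * (n * (8 * P * (n * c.-1)).+1) <= #|G| ->
  has_star_forest r a b c.
Proof.
move=> Ee GE s4 s3 s2 nG.
have [chi hchi] := colouring (fun v w x y h => edge_uniq uG (Ee v w x y h)).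
have [||||||||U [Z [X [Y [Ui Zi Xi Yi EE]]]]] := @embed4 V K P r a b c (d0 G) (d1 G) (d2 G) (coloured chi E) n0 a0 b0 c0.
- by rewrite hK.
- move: s4; have sub v w x y : coloured chi E v w x y -> E v w x y by case/and5P.
  case=> t1 t2 t3 t4; split=> W cW; [apply: leq_trans (t1 W cW)|apply: leq_trans (t2 W cW)|apply: leq_trans (t3 W cW)|apply: leq_trans (t4 W cW)];
  rewrite leq_mul2l leq_cnt4 ?orbT // => v w x y; move: (sub v w x y);
  by case: (coloured chi E v w x y) => //= /(_ isT) ->.
- move=> v; apply: spread3_sub (s3 v) => w x y.
  by rewrite /coloured; case: (E v w x y); rewrite //= leq_b1.
- move=> v w; apply: spread2_sub (s2 v w) => x y.
  by rewrite /coloured; case: (E v w x y); rewrite //= leq_b1.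
- exact: leqnn.
- by move=> v; exact: leqnn.
- apply: leq_trans (d0_leq uG) _; apply: leq_trans (_ : 256 * (4 * (256 * cnt4 (coloured chi E))) <= _).
    by rewrite leq_mul2l /= (leq_trans GE) // leq_mul2l.
  by apply: leq_trans (leq_mul hP (leqnn _)); lia.
- by apply: leq_trans nG _; exact: card_G_leq_d0.
exists U, Z, X, Y, chi; split=> // i j k l.
by have /and5P[e e1 e2 e3 e4] := EE i j k l; rewrite /coloured e1 e2 e3 e4 (Ee _ _ _ _ e).
Qed.

Let A := K * a.
Let B := K * (a * b).
Let M := K * (a * (b * c)).
Let bb := K * b.
Let cc := K * (b * c).

Let ab : a <= a * b. Proof. exact: leq_pmulr. Qed.
Let AB : A <= B. Proof. by rewrite leq_mul2l ab orbT. Qed.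
Let BM : B <= M. Proof. by rewrite leq_mul2l !leq_mul2l leq_pmulr ?orbT. Qed.
Let AM : A <= M. Proof. exact: leq_trans AB BM. Qed.
Let cM : cc <= M. Proof. by rewrite leq_mul2l leq_pmull ?orbT. Qed.
Let bcc : bb <= cc. Proof. by rewrite leq_mul2l leq_pmulr ?orbT. Qed.

Lemma embed_goodI (E : V -> V -> V -> V -> bool) :
  (forall v w x y, E v w x y -> goodI G A M cc v w x y) -> #|G| <= 4 * cnt4 E ->
  spread4 K r a b c (d0 G) E ->
  n * (n * (8 * P * (n * c.-1)).+1) <= #|G| ->
  has_star_forest r a b c.
Proof.
move=> Eg GE s4; apply: (@embed_good E) => //.
- by move=> v w x y /Eg/and5P[].
- move=> v; apply: (@spread3_light _ _ _ A M M) => // w x y /Eg/and5P[-> -> -> -> _] //.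
- move=> v w; apply: spread2_light => x y /Eg/and5P[-> _ _ _ /andP[xc ->]].
  by rewrite (notin_heavyS bcc xc).
Qed.

(** For one star [spread4] is vacuous, so the conditions in [goodI] over a vertex and over a pair
    suffice; exceptional orderings take at most half of the edges. *)
Lemma single_star : r = 1 ->
  2 * (n * (n * (cc * cc)) + (n * (M * (A * n)) + (n * (A * (n * M)) +
    (n * (M * (M * M)) + n * (M * (M * M)))))) <= #|G| ->
  n * (n * (8 * P * (n * c.-1)).+1) <= #|G| ->
  has_star_forest r a b c.
Proof.
move=> r1 few nG; apply: (@embed_goodI (goodI G A M cc)) => //; last by rewrite r1; exact: spread4_single.
have : #|G| <= cnt4 (fun v w x y => goodI G A M cc v w x y || evI G A M cc v w x y).
  apply: card_edges_leq => S SG; have [v [w [x [y [-> e]]]]] := edge_ex uG SG.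
  have [|v' [w' [x' [y' [s h]]]]] := @goodI_or_evI V G A M cc AM cM _ v w x y _ erefl; first exact: e.
  by exists v', w', x', y'; split.
move/leq_trans/(_ (cnt4_or _ _)).
have := cnt_evI A M cc; move: few; set X := (X in 2 * X <= _); lia.
Qed.

Let S2 := K * (r * a).
Let S3 := K * (r * (a * b)).
Let S4 := K * (r * (a * (b * c))).

(** Edges avoiding [h0 S4] are ordered by [goodI_or_evI], the others by [goodII_or_evII] from a
    vertex of [h0 S4]. At most a quarter of the edges is exceptional, so one of the two good
    families retains a quarter. *)
Lemma many_stars : 0 < r ->
  4 * ((n * (n * (cc * cc)) + (n * (M * (A * n)) + (n * (A * (n * M)) +
    (n * (M * (M * M)) + n * (M * (M * M)))))) +
  ((S4 * ((S4 + M) * ((S4 + M) * (S4 + M))) + (S3 * (S3 * (S3 * n)) + (S3 * (S3 * (B * n)) +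
    S4 * (B * (B * n))))) +
  (S2 * (S2 * (n * n)) + (S4 * (A * (n * n)) + (S4 * (n * (bb * n)) + (S4 * (n * (cc * cc)) +
    (S4 * (n * (S4 * cc)) + S4 * (n * (M * cc))))))))) <= #|G| ->
  K * (r * n ^ 3) <= #|G| ->
  n * (n * (8 * P * (n * c.-1)).+1) <= #|G| ->
  has_star_forest r a b c.
Proof.
move=> r0 few rn nG.
have S23 : S2 <= S3 by rewrite leq_mul2l !leq_mul2l ab ?orbT.
have S34 : S3 <= S4 by rewrite leq_mul2l !leq_mul2l leq_pmulr ?orbT.
have rnd : K * (r * n ^ 3) <= d0 G by apply: leq_trans rn _; exact: card_G_leq_d0.
(* Since these edges miss [h0 S4] altogether, [spread4_light] applies to them with [S4] as all three
   thresholds. *)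
pose E1 v w x y := [&& goodI G A M cc v w x y, v \notin h0 S4, w \notin h0 S4, x \notin h0 S4 & y \notin h0 S4].
pose E2 := goodII G A B M bb cc S2 S3 S4.
have cG : #|G| <= cnt4 (fun v w x y => (E1 v w x y || evI G A M cc v w x y) ||
   (E2 v w x y || evII G A B M bb cc S2 S3 S4 v w x y)).
  apply: card_edges_leq => S SG; have [v [w [x [y [SE e]]]]] := edge_ex uG SG.
  have Sp : spans S v w x y by [].
  have [/exists_inP[u uS u4]|/exists_inPn nS] := boolP [exists u in S, u \in h0 S4].
    have [p [q [t s]]] : exists p q t, spans S u p q t.
      move: uS; rewrite SE !inE => /or4P[] /eqP->.
      - by exists w, x, y.
      - by exists v, x, y; apply: spans12.
      - by exists v, w, y; apply: spans12; apply: spans23.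
      - by exists v, w, x; apply: spans12; apply: spans23; apply: spans34.
    have [|v' [w' [x' [y' [s' h]]]]] := @goodII_or_evII V G A B M bb cc S2 S3 S4 BM S23 S34 _ u p q t SG s; first exact: u4.
    by exists v', w', x', y'; rewrite /E2 h orbT; split.
  have [v' [w' [x' [y' [s' h]]]]] := @goodI_or_evI V G A M cc AM cM _ v w x y SG Sp.
  exists v', w', x', y'; split=> //.
  have nin u : u \in [:: v'; w'; x'; y'] -> u \notin h0 S4.
    by move=> us; apply: nS; rewrite -s' inE.
  by rewrite /E1 !nin ?inE ?eqxx ?orbT // !andbT h.
have {}cG : #|G| <= (cnt4 E1 + cnt4 (evI G A M cc)) + (cnt4 E2 + cnt4 (evII G A B M bb cc S2 S3 S4)).
  apply: leq_trans cG _; apply: leq_trans (cnt4_or _ _) _.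
  by apply: leq_add; exact: cnt4_or.
have hI := cnt_evI A M cc; have hII := cnt_evII A B M bb cc S2 S3 S4.
have {few cG hI hII} [hE|hE] : #|G| <= 4 * cnt4 E1 \/ #|G| <= 4 * cnt4 E2.
  move: few (leq_add hI hII) cG; set X := (X in 4 * X <= _); lia.
- apply: (@embed_goodI E1) => //; first by move=> v w x y /andP[].
  apply: (@spread4_light _ _ _ S4 S4 S4) => //.
  + by apply: leq_trans S34; exact: leq_trans S23.
  + by move=> v w x y /and5P[/and5P[-> _ _ _ _] _ -> -> ->].
- apply: (@embed_good E2) => //.
  + by move=> v w x y /and5P[].
  + apply: (@spread4_light _ _ _ S2 S3 S4) => //.
    by move=> v w x y /and5P[-> h _ _ _].
  + move=> v; apply: (@spread3_light _ _ _ A B M) => // w x y /and5P[-> _ /and3P[-> -> ->] _ _] //.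
  + by move=> v w; apply: spread2_light => x y /and5P[-> _ _ -> ->].
Qed.
End Stars.

(** * Star forests as abstract 4-graphs *)

Section StarForest.
Variables r a b c : nat.

Let leafT := ('I_r * ('I_a * ('I_b * 'I_c)))%type.
(** A vertex is its path from the centre of its star, with one summand per level, so ancestors are
    read off from indices. *)
Definition forestT := (('I_r + 'I_r * 'I_a) + ('I_r * ('I_a * 'I_b) + leafT))%type.

Definition fedge (q : leafT) : {set forestT} :=
  let: (i, (j, (k, l))) := q in
  [set z in [:: inl (inl i); inl (inr (i, j)); inr (inl (i, (j, k))); inr (inr (i, (j, (k, l))))]].

Definition forest : {set {set forestT}} := [set fedge q | q : leafT].

Lemma uniform_forest : uniform 4 forest.
Proof.
move=> _ /imsetP[[i [j [k l]]] _ ->]; rewrite cardsE.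
by apply/card_uniqP.
Qed.

Lemma card_forest : #|forest| = r * (a * (b * c)).
Proof.
rewrite card_imset; first by rewrite !card_prod !card_ord.
have leafE q q' : (inr (inr q) \in fedge q') -> q = q'.
  case: q' => [i [j [k l]]]; rewrite inE 3!in_cons mem_seq1 => /or4P[] // /eqP e.
  by have := congr1 (fun z : forestT => if z is inr (inr t) then t else q) e.
move=> q q' qq; apply: leafE; rewrite -qq.
by case: q {qq} => [i [j [k l]]]; rewrite inE 3!in_cons mem_seq1 eqxx !orbT.
Qed.

Lemma attains_forest n e : 0 < a -> 0 < b -> 0 < c ->
  (forall G : {set {set 'I_n}}, uniform 4 G -> #|G| = e -> has_star_forest G r a b c) ->
  attains_un 4 n e (r * (a * (b * c))).
Proof.
move=> a0 b0 c0 hG; exists forestT, forest; split; [exact: uniform_forest| |exact: card_forest].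
move=> G uG cG; have [U [Z [X [Y [chi [Ui Zi Xi Yi E]]]]]] := hG G uG cG.
pose j0 := Ordinal a0; pose k0 := Ordinal b0; pose l0 := Ordinal c0.
have cU i : chi (U i) = col 0 by have /and5P[_ /eqP] := E i j0 k0 l0.
have cZ p : chi (Z p) = col 1 by case: p => i j; have /and5P[_ _ /eqP] := E i j k0 l0.
have cX p : chi (X p) = col 2 by case: p => i [j k]; have /and5P[_ _ _ /eqP] := E i j k l0.
have cY p : chi (Y p) = col 3 by case: p => i [j [k l]]; have /and5P[_ _ _ _ /eqP] := E i j k l.
have colE i j : i < 4 -> j < 4 -> (col i == col j) = (i == j).
  by move=> i4 j4; rewrite -val_eqE /= !inordK.
pose f (z : forestT) : 'I_n := match z with
  | inl (inl i) => U i | inl (inr p) => Z p | inr (inl p) => X p | inr (inr p) => Y p end.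
exists f.
  move=> z z' e'; have := congr1 chi e'; move: e'.
  case: z => [[i|p]|[p|p]]; case: z' => [[i'|p']|[p'|p']] /=;
    rewrite ?cU ?cZ ?cX ?cY => e' /eqP; rewrite colE //= => _.
  - by rewrite (Ui _ _ e').
  - by rewrite (Zi _ _ e').
  - by rewrite (Xi _ _ e').
  - by rewrite (Yi _ _ e').
move=> _ /imsetP[[i [j [k l]]] _ ->]; have /and5P[+ _ _ _ _] := E i j k l.
rewrite /edge; congr (_ \in G); apply/setP => u; rewrite inE.
apply/idP/imsetP => [|[z + ->]]; last by rewrite inE /= !inE => /or4P[] /eqP-> /=; rewrite eqxx ?orbT.
rewrite !inE => /or4P[] /eqP->.
- by exists (inl (inl i)); rewrite // inE 3!in_cons mem_seq1 eqxx.
- by exists (inl (inr (i, j))); rewrite // inE 3!in_cons mem_seq1 eqxx ?orbT.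
- by exists (inr (inl (i, (j, k)))); rewrite // inE 3!in_cons mem_seq1 eqxx ?orbT.
- by exists (inr (inr (i, (j, (k, l))))); rewrite // inE 3!in_cons mem_seq1 eqxx ?orbT.
Qed.
End StarForest.

(** * Finding forests of bicliques *)

(** The side [X] is chosen vertex by vertex while a set [Y] of common neighbours shrinks inside
    [Y0], the vertices of degree at least n/(2D). Fewer than q <= n/(4D) vertices are used before
    each choice, so every y keeps n/(4D) candidates, and some candidate retains a 1/(4D) share of
    [Y]. *)
Lemma biclique (V : finType) (F : V -> V -> bool) D q m : let n := #|V| in
  0 < n -> n ^ 2 <= D * cnt2 F -> 4 * D * q <= n -> (4 * D) ^ q * (2 * D * m) <= n ->
  exists (X : 'I_q -> V) (Y : 'I_m -> V),
    [/\ injective X, injective Y & forall k l, F (X k) (Y l)].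
Proof.
move=> n n0 Fn Dq Dm.
have D0 : 0 < D by case: (D) Fn => //; rewrite mul0n leqn0 expn_eq0 andbT eqn0Ngt n0.
pose deg y := \sum_x (F x y : nat).
pose Y0 := [set y | n <= 2 * D * deg y].
have cY0 : n <= 2 * D * #|Y0|.
  have degn y : deg y <= n by rewrite /n -sum1_card; apply: leq_sum => x _; exact: leq_b1.
  have : 2 * D * cnt2 F <= 2 * D * n * #|Y0| + n * n.
    rewrite /cnt2 exchange_big /= -/deg (bigID (mem Y0)) /= mulnDr leq_add //.
      rewrite -[X in _ <= X]mulnA leq_mul2l [n * _]mulnC -sum_nat_const; apply/orP; right.
      by apply: leq_sum => y _; exact: degn.
    rewrite big_distrr /=; apply: leq_trans (_ : \sum_(y | y \notin Y0) n <= _).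
      by apply: leq_sum => y; rewrite inE -ltnNge => /ltnW.
    by rewrite sum_nat_const leq_mul2r max_card orbT.
  by move: Fn; rewrite -mulnn; nia.
have step j : j <= q -> exists (s : seq V) (Y : {set V}),
    [/\ uniq s, size s = j, forall x y, x \in s -> y \in Y -> F x y, Y \subset Y0 &
        #|Y0| <= (4 * D) ^ j * #|Y|].
  elim: j => [|j IH] jq; first by exists [::], Y0; rewrite mul1n; split.
  have [s [Y [us ss sF YY cY]]] := IH (ltnW jq).
  have Yn : 0 < #|Y|.
    by rewrite lt0n; apply/eqP => Y00; move: cY cY0; rewrite Y00 muln0 leqn0 => /eqP->; rewrite muln0 leqNgt n0.
  pose c x := \sum_(y in Y) ((x \notin s) && F x y : nat).
  have [x cx] : exists x, #|Y| < (4 * D * c x).+1.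
    apply: (@sum_ltn_ex _ (fun=> #|Y|)).
    have -> : \sum_x (4 * D * c x).+1 = 4 * D * (\sum_x c x) + n.
      by rewrite /n -sum1_card big_distrr /= -big_split /=; apply: eq_bigr => u _; rewrite addn1.
    rewrite sum_nat_const -/n; apply: (@leq_ltn_trans (4 * D * \sum_x c x)); last by rewrite -addn1 leq_add2l.
    rewrite exchange_big big_distrr /= mulnC -sum_nat_const; apply: leq_sum => y yY.
    have yd : n <= 2 * D * deg y by have := subsetP YY y yY; rewrite inE.
    have : deg y <= \sum_x ((x \notin s) && F x y : nat) + j.
      rewrite -ss -(card_uniqP us) -sum1_card [X in _ + X]big_mkcond /= -big_split /=.
      by apply: leq_sum => x _; case: (x \in s) => //=; case: (F x y).
    move: (\sum_x _) => z dz; have := leq_mul (leqnn (4 * D)) dz.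
    have : 4 * D * j <= n by apply: leq_trans Dq; rewrite leq_mul2l ltnW ?orbT.
    by move: yd; clear; nia.
  have cxE : c x = if x \in s then 0 else #|[set y in Y | F x y]|.
    rewrite /c; case: ifP => xs /=; first by rewrite big1.
    rewrite -sum1_card [LHS]big_mkcond [RHS]big_mkcond; apply: eq_bigr => y _.
    by rewrite inE; case: (y \in Y) => //=; case: (F x y).
  have xs : x \notin s by apply/negP => xs; move: cx; rewrite cxE xs muln0 ltnNge Yn.
  exists (x :: s), [set y in Y | F x y]; split=> //=.
  - by rewrite xs us.
  - by rewrite ss.
  - by move=> z y; rewrite !inE => /orP[/eqP->|zs] /andP[yY //]; move=> _; exact: sF.
  - by apply/subsetP => y; rewrite inE => /andP[/(subsetP YY)].
  - apply: leq_trans cY _; rewrite expnSr -mulnA leq_mul2l; apply/orP; right.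
    by move: cx; rewrite cxE (negPf xs) ltnS.
have [s [Y [us ss sF YY cY]]] := step q (leqnn q).
have mY : m <= #|Y|.
  have : (4 * D) ^ q * (2 * D * m) <= (4 * D) ^ q * (2 * D * #|Y|).
    apply: leq_trans Dm _; apply: leq_trans cY0 _; rewrite [X in _ <= X]mulnCA leq_mul2l.
    by rewrite cY orbT.
  by rewrite leq_pmul2l ?expn_gt0 ?muln_gt0 ?D0 // leq_pmul2l ?muln_gt0.
exists (fun k => tnth (Tuple (introT eqP ss)) k), (fun l => enum_val (widen_ord mY l)); split.
- by move=> k k'; apply/tuple_uniqP.
- by move=> l l' /enum_val_inj /(congr1 val) /= /val_inj.
- by move=> k l; apply: sF (enum_valP _); rewrite -[s]/(tval (Tuple (introT eqP ss))) mem_tnth.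
Qed.

Section Bicliques.
Variables (V : finType) (G : {set {set V}}).
Hypothesis uG : uniform 4 G.
Let n := #|V|.

Definition has_biclique_forest r q m :=
  exists (U : 'I_r -> V) (Z : 'I_r -> V) (X : 'I_r * 'I_q -> V)
    (Y : 'I_r * 'I_m -> V) (chi : V -> 'I_4),
    [/\ injective U, injective Z, injective X, injective Y &
      forall i k l, coloured chi (edge G) (U i) (Z i) (X (i, k)) (Y (i, l))].

Variables (P K r q m D : nat).
(** The factor 2 pays for edges inside the heavy set and 256 for the colouring. [K] is such that
    [d0 <= 256 * #|G|] limits the loss at the last coordinate to [#|G| / (4 * P)]. *)
Hypotheses (hP : 256 * 2 <= P) (hK : K = 256 * (4 * P)).
Hypotheses (n0 : 0 < n) (q0 : 0 < q) (m0 : 0 < m).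

(** The [2 * r + r * q] used vertices of the other kinds are few enough to be charged n^3 tuples
    each; only the [r * m] vertices of the large sides call for lightness. An edge with no light
    vertex to put last lies inside [h], and such edges make up at most half of [G]. Averaging over v
    and then w leaves a pair graph of density at least 1/D for [biclique]. *)
Lemma many_bicliques :
  2 * (K * (r * m)) ^ 4 <= #|G| ->
  4 * P * ((2 * r + r * q) * n ^ 3) <= #|G| ->
  4 * P * n ^ 4 <= D * #|G| ->
  4 * D * q <= n -> (4 * D) ^ q * (2 * D * m) <= n ->
  has_biclique_forest r q m.
Proof.
move=> few used nD Dq Dm; set S4 := K * (r * m) in few.
pose h := heavy S4 (d1 G).
pose E0 v w x y := edge G v w x y && (y \notin h).
pose E1 v w x y := [&& edge G v w x y, v \in h, w \in h, x \in h & y \in h].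
have cG : #|G| <= 2 * cnt4 E0.
  have c1 : cnt4 E1 <= S4 * (S4 * (S4 * S4)).
    apply: (@cnt4_cap _ _ h (fun=> h) (fun _ _ => h) (fun _ _ _ => h)); try (by move=> *; exact: card_heavy).
    by move=> v w x y /and5P[_ -> -> -> ->].
  have : #|G| <= cnt4 (fun v w x y => E0 v w x y || E1 v w x y).
    apply: card_edges_leq => S SG; have [v [w [x [y [SE e]]]]] := edge_ex uG SG.
    have Sp : spans S v w x y by [].
    have ok v' w' x' y' : spans S v' w' x' y' -> y' \notin h -> E0 v' w' x' y'.
      by move=> s yh; rewrite /E0 yh andbT /edge s.
    have [yh|yh] := boolP (y \in h); last by exists v, w, x, y; rewrite ok.
    have [xh|xh] := boolP (x \in h); last first.
      by have s := spans34 Sp; exists v, w, y, x; rewrite ok.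
    have [wh|wh] := boolP (w \in h); last first.
      by have s := spans34 (spans23 Sp); exists v, x, y, w; rewrite ok.
    have [vh|vh] := boolP (v \in h); last first.
      by have s := spans34 (spans23 (spans12 Sp)); exists w, x, y, v; rewrite ok.
    by exists v, w, x, y; rewrite /E1 e vh wh xh yh orbT.
  move/leq_trans/(_ (cnt4_or _ _)); move: few c1.
  by rewrite -[S4 ^ 4]/(S4 * (S4 * (S4 * S4))); lia.
have [chi hchi] : exists chi : V -> 'I_4, cnt4 E0 <= 256 * cnt4 (coloured chi E0).
  by apply: colouring => v w x y /andP[/(edge_uniq uG)].
pose E := coloured chi E0.
have GE : #|G| <= P * cnt4 E.
  apply: leq_trans cG _; apply: leq_trans (_ : 2 * (256 * cnt4 E) <= _); first by rewrite leq_mul2l.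
  by apply: leq_trans (leq_mul hP (leqnn _)); lia.
have [|F PF RF] := @greedy (V * (V * (('I_q -> V) * ('I_m -> V))))
   (fun o => [/\ injective o.2.2.1, injective o.2.2.2 & forall k l, E o.1 o.2.1 (o.2.2.1 k) (o.2.2.2 l)])
   (fun o o' => [/\ o.1 <> o'.1, o.2.1 <> o'.2.1,
      forall k k', o.2.2.1 k <> o'.2.2.1 k' & forall l l', o.2.2.2 l <> o'.2.2.2 l']) r; last first.
  exists (fun j => (F j).1), (fun p => (F p).2.1), (fun p => (F p.1).2.2.1 p.2), (fun p => (F p.1).2.2.2 p.2), chi; split.
  - by move=> k k'; have [//|/RF[]] := eqVneq k k'.
  - by move=> k k'; have [//|/RF[]] := eqVneq k k'.
  - apply: (@uncurry_inj _ _ _ (fun k => (F k).2.2.1)) => [k|k k' /RF[]//].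
    by have [] := PF k.
  - apply: (@uncurry_inj _ _ _ (fun k => (F k).2.2.2)) => [k|k k' /RF[]//].
    by have [] := PF k.
  - move=> i k l; have [_ _ /(_ k l)] := PF i.
    by rewrite /coloured => /and5P[/andP[-> _] -> -> -> ->].
move=> j s ja Ps.
pose W1 := [set (s i).1 | i : 'I_j]; pose W2 := [set (s p).2.1 | p : 'I_j].
pose W3 := [set (s p.1).2.2.1 p.2 | p : 'I_j * 'I_q].
pose W4 := [set (s p.1).2.2.2 p.2 | p : 'I_j * 'I_m].
have jr : j <= r by exact: ltnW.
have c1 : #|W1| <= r by apply: leq_trans (leq_imset_card _ _) _; rewrite card_ord.
have c2 : #|W2| <= r by apply: leq_trans (leq_imset_card _ _) _; rewrite card_ord.
have c3 : #|W3| <= r * q.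
  by have := @card_used _ 'I_j 'I_q (fun p => (s p.1).2.2.1 p.2) r; rewrite !card_ord; exact.
have c4 : #|W4| <= r * m.
  by have := @card_used _ 'I_j 'I_m (fun p => (s p.1).2.2.2 p.2) r; rewrite !card_ord; exact.
pose E' v w x y := [&& E v w x y, v \notin W1, w \notin W2, x \notin W3 & y \notin W4].
pose F1 v w x y := E v w x y && (v \in W1).
pose F2 v w x y := E v w x y && (w \in W2).
pose F3 v w x y := E v w x y && (x \in W3).
pose F4 v w x y := E v w x y && (y \in W4).
have le : cnt4 E <= cnt4 E' + (cnt4 F1 + (cnt4 F2 + (cnt4 F3 + cnt4 F4))).
  apply: leq_trans (_ : cnt4 (fun v w x y => [|| E' v w x y, F1 v w x y, F2 v w x y, F3 v w x y | F4 v w x y]) <= _).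
    apply: leq_cnt4 => v w x y; rewrite /E' /F1 /F2 /F3 /F4; case: (E v w x y) => //=.
    by case: (v \in W1) => //=; case: (w \in W2) => //=; case: (x \in W3) => //=; case: (y \in W4).
  by apply: leq_cnt4_or => //; apply: leq_cnt4_or => //; apply: leq_cnt4_or => //; exact: cnt4_or.
have k1 : cnt4 F1 <= r * n ^ 3.
  apply: (@cnt4_cap _ _ W1 (fun=> setT) (fun _ _ => setT) (fun _ _ _ => setT)); rewrite ?cardsT //.
  by move=> v w x y /andP[_ vW]; rewrite !in_setT vW.
have k2 : cnt4 F2 <= r * n ^ 3.
  apply: leq_trans (_ : n * (r * (n * n)) <= _); last by rewrite mulnCA.
  apply: (@cnt4_cap _ _ setT (fun=> W2) (fun _ _ => setT) (fun _ _ _ => setT)); rewrite ?cardsT //.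
  by move=> v w x y /andP[_ vW]; rewrite !in_setT vW.
have k3 : cnt4 F3 <= r * q * n ^ 3.
  apply: leq_trans (_ : n * (n * (r * q * n)) <= _); last first.
    by rewrite -[n ^ 3]/(n * (n * n)) [X in _ <= X]mulnCA; rewrite (mulnCA n (r * q)).
  apply: (@cnt4_cap _ _ setT (fun=> setT) (fun _ _ => W3) (fun _ _ _ => setT)); rewrite ?cardsT //.
  by move=> v w x y /andP[_ vW]; rewrite !in_setT vW.
have k4 : K * cnt4 F4 <= 256 * #|G|.
  apply: leq_trans (_ : K * cnt4 (fun v w x y => edge G v w x y && ((y \in W4) && (y \notin h))) <= _).
    rewrite leq_mul2l leq_cnt4 ?orbT // => v w x y; rewrite /F4 /E /coloured /E0.
    case: (edge G v w x y) => //=; case: (y \in W4); rewrite ?andbF //= andbT.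
    by case: (y \notin h) => //=; rewrite leq_b1.
  rewrite cnt4_P4; apply: leq_trans (d0_leq uG).
  by apply: (@heavy_kill _ K _ (d1 G)); rewrite leq_mul2l c4 orbT.
have E'big : #|G| <= 4 * P * cnt4 E'.
  have : 4 * P * cnt4 F4 <= #|G| by move: k4; rewrite hK -mulnA leq_mul2l.
  have : 4 * P * (cnt4 F1 + cnt4 F2 + cnt4 F3) <= #|G|.
    by apply: leq_trans used; rewrite leq_mul2l; apply/orP; right; lia.
  have := leq_mul (leqnn (4 * P)) le; clear -GE; lia.
have Gn : 0 < #|G|.
  have r0 : 0 < r by exact: leq_ltn_trans ja.
  apply: leq_trans used; rewrite muln_gt0; apply/andP; split.
    by rewrite muln_gt0 /= (leq_trans _ hP).
  rewrite muln_gt0; apply/andP; split; last by rewrite expn_gt0 n0.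
  by rewrite addn_gt0 muln_gt0 r0.
have [v cv] : exists v, #|G| < (4 * P * n * cnt3 (E' v)).+1.
  apply: (@sum_ltn_ex _ (fun=> #|G|)).
  have -> : \sum_u (4 * P * n * cnt3 (E' u)).+1 = n * (4 * P * cnt4 E') + n.
    rewrite mulnA [n * (4 * P)]mulnC /n -[X in _ + X]sum1_card [X in X + _]big_distrr /= -big_split /=.
    by apply: eq_bigr => u _; rewrite addn1.
  rewrite sum_nat_const; apply: leq_ltn_trans (leq_mul (leqnn _) E'big) _.
  by rewrite -addn1 leq_add2l.
have [w cw] : exists w, #|G| < (4 * P * n * n * cnt2 (E' v w)).+1.
  apply: (@sum_ltn_ex _ (fun=> #|G|)).
  have -> : \sum_u (4 * P * n * n * cnt2 (E' v u)).+1 = n * (4 * P * n * cnt3 (E' v)) + n.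
    rewrite mulnA [n * (4 * P * n)]mulnC /n -[X in _ + X]sum1_card [X in X + _]big_distrr /= -big_split /=.
    by apply: eq_bigr => u _; rewrite addn1.
  rewrite sum_nat_const; rewrite ltnS in cv; apply: leq_ltn_trans (leq_mul (leqnn _) cv) _.
  by rewrite -addn1 leq_add2l.
have [|||X [Y [Xi Yi EXY]]] := @biclique V (E' v w) D q m n0 => //.
  rewrite ltnS in cw.
  have P0 : 0 < 4 * P * (n * n) by rewrite !muln_gt0 n0 (leq_trans _ hP).
  rewrite -(leq_pmul2l P0); apply: leq_trans (_ : 4 * P * n ^ 4 <= _).
    by rewrite -/n; clear; nia.
  apply: leq_trans nD _; apply: leq_trans (leq_mul (leqnn D) cw) _.
  by clear; nia.
pose k0 := Ordinal q0; pose l0 := Ordinal m0.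
exists (v, (w, (X, Y))); first by split=> // k l; have /and5P[] := EXY k l.
have nV v' : v' \in W1 -> v <> v'.
  by move=> wW e; have /and5P[_ + _ _ _] := EXY k0 l0; rewrite e wW.
have nW w' : w' \in W2 -> w <> w'.
  by move=> wW e; have /and5P[_ _ + _ _] := EXY k0 l0; rewrite e wW.
have nX k x : x \in W3 -> X k <> x.
  by move=> xW e; have /and5P[_ _ _ + _] := EXY k l0; rewrite e xW.
have nY l y : y \in W4 -> Y l <> y.
  by move=> yW e; have /and5P[_ _ _ _ +] := EXY k0 l; rewrite e yW.
move=> i; split; split=> /=.
- by apply/nesym/nV/imsetP; exists i.
- by apply/nesym/nW/imsetP; exists i.
- by move=> k k'; apply/nesym/nX/imsetP; exists (i, k).
- by move=> k k'; apply/nesym/nY/imsetP; exists (i, k).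
- by apply/nV/imsetP; exists i.
- by apply/nW/imsetP; exists i.
- by move=> k k'; apply/nX/imsetP; exists (i, k').
- by move=> k k'; apply/nY/imsetP; exists (i, k').
Qed.
End Bicliques.

(** * Biclique forests as abstract 4-graphs *)

Section BicliqueForest.
Variables r q m : nat.

Definition bforestT := (('I_r + 'I_r) + ('I_r * 'I_q + 'I_r * 'I_m))%type.

Definition bedge (p : 'I_r * ('I_q * 'I_m)) : {set bforestT} :=
  let: (i, (k, l)) := p in
  [set z in [:: inl (inl i); inl (inr i); inr (inl (i, k)); inr (inr (i, l))]].

Definition bforest : {set {set bforestT}} := [set bedge p | p : 'I_r * ('I_q * 'I_m)].

Lemma uniform_bforest : uniform 4 bforest.
Proof.
move=> _ /imsetP[[i [k l]] _ ->]; rewrite cardsE.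
by apply/card_uniqP.
Qed.

Lemma card_bforest : #|bforest| = r * (q * m).
Proof.
rewrite card_imset; first by rewrite !card_prod !card_ord.
have leaf1 i k l p : inr (inl (i, k)) \in bedge (p, l) -> p = i /\ l.1 = k.
  case: l => k' l'; rewrite inE 3!in_cons mem_seq1 => /or4P[] // /eqP e.
  have := congr1 (fun z : bforestT => if z is inr (inl t) then t else (i, k)) e.
  by move=> h; split; [exact/esym/(congr1 fst h) | exact/esym/(congr1 snd h)].
have leaf2 i k l p : inr (inr (i, k)) \in bedge (p, l) -> l.2 = k.
  case: l => k' l'; rewrite inE 3!in_cons mem_seq1 => /or4P[] // /eqP e.
  have h := congr1 (fun z : bforestT => if z is inr (inr t) then t else (i, k)) e.
  exact/esym/(congr1 snd h).
move=> [i [k l]] [i' [k' l']] e.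
have m1 : inr (inl (i, k)) \in bedge (i', (k', l')).
  by rewrite -e inE 3!in_cons mem_seq1 eqxx !orbT.
have m2 : inr (inr (i, l)) \in bedge (i', (k', l')).
  by rewrite -e inE 3!in_cons mem_seq1 eqxx !orbT.
have [-> /= ->] := leaf1 _ _ _ _ m1.
by have /= -> := leaf2 _ _ _ _ m2.
Qed.

Lemma attains_bforest n e : 0 < q -> 0 < m ->
  (forall G : {set {set 'I_n}}, uniform 4 G -> #|G| = e -> has_biclique_forest G r q m) ->
  attains_un 4 n e (r * (q * m)).
Proof.
move=> q0 m0 hG; exists bforestT, bforest; split; [exact: uniform_bforest| |exact: card_bforest].
move=> G uG cG; have [U [Z [X [Y [chi [Ui Zi Xi Yi E]]]]]] := hG G uG cG.
pose k0 := Ordinal q0; pose l0 := Ordinal m0.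
have cU i : chi (U i) = col 0 by have /and5P[_ /eqP] := E i k0 l0.
have cZ i : chi (Z i) = col 1 by have /and5P[_ _ /eqP] := E i k0 l0.
have cX p : chi (X p) = col 2 by case: p => i k; have /and5P[_ _ _ /eqP] := E i k l0.
have cY p : chi (Y p) = col 3 by case: p => i l; have /and5P[_ _ _ _ /eqP] := E i k0 l.
have colE i j : i < 4 -> j < 4 -> (col i == col j) = (i == j).
  by move=> i4 j4; rewrite -val_eqE /= !inordK.
pose f (z : bforestT) : 'I_n := match z with
  | inl (inl i) => U i | inl (inr p) => Z p | inr (inl p) => X p | inr (inr p) => Y p end.
exists f.
  move=> z z' e'; have := congr1 chi e'; move: e'.
  case: z => [[i|p]|[p|p]]; case: z' => [[i'|p']|[p'|p']] /=;
    rewrite ?cU ?cZ ?cX ?cY => e' /eqP; rewrite colE //= => _.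
  - by rewrite (Ui _ _ e').
  - by rewrite (Zi _ _ e').
  - by rewrite (Xi _ _ e').
  - by rewrite (Yi _ _ e').
move=> _ /imsetP[[i [k l]] _ ->]; have /and5P[+ _ _ _ _] := E i k l.
rewrite /edge; congr (_ \in G); apply/setP => u; rewrite inE.
apply/idP/imsetP => [|[z + ->]]; last by rewrite inE /= !inE => /or4P[] /eqP-> /=; rewrite eqxx ?orbT.
rewrite !inE => /or4P[] /eqP->.
- by exists (inl (inl i)); rewrite // inE 3!in_cons mem_seq1 eqxx.
- by exists (inl (inr i)); rewrite // inE 3!in_cons mem_seq1 eqxx ?orbT.
- by exists (inr (inl (i, k))); rewrite // inE 3!in_cons mem_seq1 eqxx ?orbT.
- by exists (inr (inr (i, l))); rewrite // inE 3!in_cons mem_seq1 eqxx ?orbT.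
Qed.
End BicliqueForest.

(** * Explicit sufficient conditions *)

Lemma attains_single : exists2 C, 0 < C & forall n e a b, 0 < n -> 0 < a -> 0 < b ->
  C * (n ^ 2 * b ^ 2) <= e -> C * (n ^ 2 * (a ^ 2 * b)) <= e -> C * (n * (a * b) ^ 3) <= e ->
  n ^ 2 <= e -> attains_un 4 n e (a * b).
Proof.
(* The constants enter as variables, so that arithmetic treats them as opaque instead of evaluating
   unary numerals. *)
have [P hP] : exists P, 256 * (256 * 4) <= P by eexists; apply: leqnn.
have [K hK] : exists K, K = 48 * P by exists (48 * P).
have K0 : 0 < K by rewrite hK muln_gt0 /=; apply: leq_trans hP.
exists (20 * K ^ 3); first by rewrite muln_gt0 expn_gt0 K0.
move=> n e a b n0 a0 b0 h1 h2 h3 h4.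
rewrite -[a * b]mul1n -[X in 1 * (a * X)]muln1; apply: attains_forest => // G uG cG.
apply: (@single_star _ G uG P K 1 a b 1 hP hK) => //; rewrite ?card_ord //; last first.
  by rewrite muln0 cG -mulnn in h4 *; rewrite muln0 muln1.
rewrite cG muln1; move: h1 h2 h3; rewrite -!mulnn !expnS !expn0 !muln1.
set X1 := n * n * (b * b); set X2 := n * n * (a * a * b).
set X3 := n * _ => h1 h2 h3.
have KK X : K * K * X <= K * K * K * X by rewrite leq_mul2r leq_pmulr ?orbT.
have e1 : n * (n * (K * b * (K * b))) = K * K * X1 by rewrite /X1; lia.
have e2 : n * (K * (a * b) * (K * a * n)) = K * K * X2 by rewrite /X2; lia.
have e3 : n * (K * a * (n * (K * (a * b)))) = K * K * X2 by rewrite /X2; lia.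
have e4 : n * (K * (a * b) * (K * (a * b) * (K * (a * b)))) = K * K * K * X3 by rewrite /X3; lia.
rewrite e1 e2 e3 e4; have := KK X1; have := KK X2.
move: h1 h2 h3; rewrite -!(mulnA 20) !(mulnA K).
clear; lia.
Qed.

(** Here [b = a] and [c = r]: the number of edges depends only on [r * a], which leaves the ratio of
    [r] to [a] free to be adapted to e. *)
Lemma attains_many : exists2 C, 0 < C & forall n e r a, 0 < n -> 0 < r -> 0 < a ->
  C * (n ^ 2 * (r ^ 2 * a ^ 3)) <= e -> C * (n * (r * a ^ 2) ^ 3) <= e ->
  C * (r * a) ^ 8 <= e -> C * ((r * a) ^ 5 * n) <= e -> C * (r * n ^ 3) <= e ->
  attains_un 4 n e ((r * a) ^ 2).
Proof.
have [P hP] : exists P, 256 * (256 * 4) <= P by eexists; apply: leqnn.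
have [K hK] : exists K, K = 48 * P by exists (48 * P).
have P0 : 0 < P by exact: leq_trans hP.
have K0 : 0 < K by rewrite hK muln_gt0 /=.
(* [K ^ 4] because one term contains the fourth power of [S4]. With multiplicities, 22 copies of the
   monomials [Y1], [Y2], [Y3], [Y4] bound the terms of [many_stars], and [4 * 22 <= 100]. *)
exists (100 * K ^ 4); first by rewrite muln_gt0 expn_gt0 K0.
move=> n e r a n0 r0 a0 h1 h2 h3 h4 h5.
have -> : (r * a) ^ 2 = r * (a * (a * r)) by rewrite -mulnn; lia.
apply: attains_forest => // G uG cG.
have K4 : K <= 100 * K ^ 4 by rewrite expnS mulnCA leq_pmulr // muln_gt0 expn_gt0 K0.
have rn : K * (r * n ^ 3) <= e by apply: leq_trans h5; rewrite leq_mul2r K4 orbT.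
apply: (@many_stars _ G uG P K r a a r hP hK) => //; rewrite ?card_ord // ?cG //; last first.
  apply: leq_trans rn; rewrite hK -[n ^ 3]/(n * (n * n)).
  have -> : n * (n * (8 * P * (n * r.-1)).+1) = 8 * P * (n * n * n * r.-1) + n * n by lia.
  have -> : 48 * P * (r * (n * (n * n))) = 48 * P * (n * n * n * r) by lia.
  have l1 : n * n * n * r.-1 <= n * n * n * r by rewrite leq_mul2l leq_pred orbT.
  have l2 : n * n <= n * n * n * r by rewrite -mulnA leq_pmulr // muln_gt0 n0.
  have l3 : n * n * n * r <= P * (n * n * n * r) by rewrite leq_pmull.
  by move: l2 l3 (leq_mul (leqnn (8 * P)) l1); clear; lia.
pose Y1 := n * n * (r * r * (a * a * a)); pose Y2 := n * (r * r * r * (a * a * a * (a * a * a))).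
pose q := r * a; pose q4 := q * q * (q * q); pose Y3 := q4 * q4; pose Y4 := q4 * q * n.
have E1 : n ^ 2 * (r ^ 2 * a ^ 3) = Y1 by rewrite /Y1 -!mulnn !expnS !expn0; lia.
have E2 : n * (r * a ^ 2) ^ 3 = Y2 by rewrite /Y2 -!mulnn !expnS !expn0; lia.
have E3 : (r * a) ^ 8 = Y3 by rewrite /Y3 /q4 /q !expnS !expn0; lia.
have E4 : (r * a) ^ 5 * n = Y4 by rewrite /Y4 /q4 /q !expnS !expn0; lia.
rewrite {}E1 {}E2 {}E3 {}E4 in h1 h2 h3 h4.
have mono X Y k : 0 < k -> X * k = Y -> X <= Y by move=> k0 <-; rewrite leq_pmulr.
set KK := K ^ 4 in h1 h2 h3 h4.
have K24 : K * K <= KK by rewrite /KK !expnS expn0 muln1 mulnA leq_pmulr // muln_gt0 K0.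
have K34 : K * K * K <= KK by rewrite /KK !expnS expn0 muln1 !mulnA leq_pmulr.
have up2 X Y : X <= Y -> K * K * X <= KK * Y by move=> XY; exact: leq_mul.
have up3 X Y : X <= Y -> K * K * K * X <= KK * Y by move=> XY; exact: leq_mul.
have T1 : n * (n * (K * (a * r) * (K * (a * r)))) <= KK * Y1.
  apply: leq_trans (up2 (n * n * (r * r * (a * a))) _ _); first by lia.
  by apply: (mono _ _ a) => //; rewrite /Y1; lia.
have T2 : n * (K * (a * (a * r)) * (K * a * n)) <= KK * Y1.
  apply: leq_trans (up2 (n * n * (r * (a * a * a))) _ _); first by lia.
  by apply: (mono _ _ r) => //; rewrite /Y1; lia.
have T3 : n * (K * a * (n * (K * (a * (a * r))))) <= KK * Y1.
  by apply: leq_trans T2; lia.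
have T4 : n * (K * (a * (a * r)) * (K * (a * (a * r)) * (K * (a * (a * r))))) <= KK * Y2.
  by apply: leq_trans (up3 Y2 _ (leqnn _)); rewrite /Y2; lia.
set S4 := K * (r * (a * (a * r))).
have S4E : S4 = K * (q * q) by rewrite /S4 /q; lia.
have MS : K * (a * (a * r)) <= S4 by rewrite leq_mul2l [r * _]mulnC leq_pmulr ?orbT.
have T5 : S4 * ((S4 + K * (a * (a * r))) * ((S4 + K * (a * (a * r))) * (S4 + K * (a * (a * r))))) <= 8 * (KK * Y3).
  have h : S4 + K * (a * (a * r)) <= 2 * S4 by rewrite mul2n -addnn leq_add2l.
  apply: leq_trans (leq_mul (leqnn S4) (leq_mul h (leq_mul h h))) _.
  by rewrite S4E /KK /Y3 /q4 !expnS expn0; lia.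
have T6 : K * (r * (a * a)) * (K * (r * (a * a)) * (K * (r * (a * a)) * n)) <= KK * Y2.
  by apply: leq_trans (up3 Y2 _ (leqnn _)); rewrite /Y2; lia.
have T7 : K * (r * (a * a)) * (K * (r * (a * a)) * (K * (a * a) * n)) <= KK * Y2.
  apply: leq_trans (up3 (n * (r * r * (a * a * a * (a * a * a)))) _ _); first by lia.
  by apply: (mono _ _ r) => //; rewrite /Y2; lia.
have T8 : S4 * (K * (a * a) * (K * (a * a) * n)) <= KK * Y2.
  apply: leq_trans (up3 (n * (r * r * (a * a * a * (a * a * a)))) _ _); first by rewrite /S4; lia.
  by apply: (mono _ _ r) => //; rewrite /Y2; lia.
have T9 : K * (r * a) * (K * (r * a) * (n * n)) <= KK * Y1.
  by apply: leq_trans T1; lia.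
have T10 : S4 * (K * a * (n * n)) <= KK * Y1.
  by apply: leq_trans (up2 Y1 _ (leqnn _)); rewrite /Y1 /S4; lia.
have T11 : S4 * (n * (K * a * n)) <= KK * Y1.
  by apply: leq_trans T10; lia.
have T13 : S4 * (n * (S4 * (K * (a * r)))) <= KK * Y4.
  by apply: leq_trans (up3 Y4 _ (leqnn _)); rewrite /Y4 S4E /q4 /q; lia.
have T14 : S4 * (n * (K * (a * (a * r)) * (K * (a * r)))) <= KK * Y4.
  apply: leq_trans T13; rewrite leq_mul2l; apply/orP; right; rewrite leq_mul2l; apply/orP; right.
  by rewrite leq_mul2r MS orbT.
have T12 : S4 * (n * (K * (a * r) * (K * (a * r)))) <= KK * Y4.
  apply: leq_trans T14; rewrite leq_mul2l; apply/orP; right; rewrite leq_mul2l; apply/orP; right.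
  by rewrite leq_mul2r leq_mul2l leq_pmull ?orbT.
rewrite -!(mulnA 100) in h1 h2 h3 h4.
move: T1 T2 T3 T4 T5 T6 T7 T8 T9 T10 T11 T12 T13 T14 h1 h2 h3 h4.
move: (KK * Y1) (KK * Y2) (KK * Y3) (KK * Y4) => y1 y2 y3 y4.
clear; lia.
Qed.

Lemma attains_bicliques : exists2 C, 0 < C & forall n e r q m D, 0 < n -> 0 < q -> 0 < m ->
  C * (r * m) ^ 4 <= e -> C * (r * q * n ^ 3) <= e -> C * n ^ 4 <= D * e ->
  4 * D * q <= n -> (4 * D) ^ q * (2 * D * m) <= n ->
  attains_un 4 n e (r * (q * m)).
Proof.
have [P hP] : exists P, 256 * 2 <= P by eexists; apply: leqnn.
have [K hK] : exists K, K = 256 * (4 * P) by exists (256 * (4 * P)).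
exists (12 * P + 2 * K ^ 4).
  by rewrite addn_gt0 muln_gt0 /= (leq_trans _ hP).
move=> n e r q m D n0 q0 m0 h1 h2 h3 h4 h5.
apply: attains_bforest => // G uG cG.
have le (C X Y : nat) : C <= 12 * P + 2 * K ^ 4 -> (12 * P + 2 * K ^ 4) * X <= Y -> C * X <= Y.
  by move=> CC; apply: leq_trans; rewrite leq_mul2r CC orbT.
apply: (@many_bicliques _ G uG P K r q m D hP hK) => //; rewrite ?card_ord // cG.
- by rewrite expnMn mulnA; apply: le h1; rewrite leq_addl.
- apply: leq_trans (_ : 12 * P * (r * q * n ^ 3) <= _); last by apply: le h2; rewrite leq_addr.
  have rq : 2 * r + r * q <= 3 * (r * q).
    by have : r <= r * q by [rewrite leq_pmulr]; lia.
  apply: leq_trans (leq_mul (leqnn (4 * P)) (leq_mul rq (leqnn (n ^ 3)))) _.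
  by move: (n ^ 3) => z; clear; lia.
- by apply: le h3; apply: leq_trans (leq_addr _ _); rewrite leq_mul2r orbT.
Qed.

(** * Elementary properties of un *)

Section UnBasic.
Variables n e : nat.
Hypothesis eN : e <= 'C(n, 4).

Lemma unavoidable_card (T : finType) (H : {set {set T}}) :
  unavoidable 4 n e H -> #|H| <= e.
Proof.
move=> uH; have [G GS cG] : exists2 G : {set {set 'I_n}}, G \subset [set A : {set 'I_n} | #|A| == 4] & #|G| = e.
  by apply: subset_of_card; rewrite card_draws card_ord.
have [|f fi fH] := uH G _ cG; first by move=> A /(subsetP GS); rewrite inE => /eqP.
rewrite -cG -(card_imset (mem H) (imset_inj fi)); apply: subset_leq_card.
by apply/subsetP => _ /imsetP[A AH ->]; exact: fH.
Qed.

Lemma un_ge m : attains_un 4 n e m -> m <= un 4 n e.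
Proof. by move=> am; have [_] := un_spec eN; exact. Qed.

Lemma un_le B : (forall (T : finType) (H : {set {set T}}), uniform 4 H ->
  unavoidable 4 n e H -> #|H| <= B) -> un 4 n e <= B.
Proof. by move=> h; have [[T [H [uH unH <-]]] _] := un_spec eN; exact: h. Qed.

End UnBasic.

Lemma un_witness n e : e <= 'C(n, 4) -> exists (T : finType) (H : {set {set T}}),
  [/\ uniform 4 H, unavoidable 4 n e H & #|H| = un 4 n e].
Proof. by move=> eN; have [[T [H ?]] _] := un_spec eN; exists T, H. Qed.

Lemma un_mono n e e' : e <= e' -> e' <= 'C(n, 4) -> un 4 n e <= un 4 n e'.
Proof.
move=> ee eN; apply: un_le; first exact: leq_trans eN.
move=> T H uH unH; apply: un_ge => //; exists T, H; split=> //.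
exact: unavoidable_mono unH.
Qed.

Lemma un_gt0 n e : 0 < e -> e <= 'C(n, 4) -> 0 < un 4 n e.
Proof.
move=> e0 eN; apply: un_ge => //; exists 'I_4, [set [set: 'I_4]]; split.
- by move=> A; rewrite inE => /eqP->; rewrite cardsT card_ord.
- move=> G uG cG; have [A AG] : exists A, A \in G by apply/card_gt0P; rewrite cG.
  have c4 := uG A AG; pose f (i : 'I_4) := enum_val (cast_ord (esym c4) i).
  exists f; first by move=> i j /enum_val_inj /cast_ord_inj.
  move=> B; rewrite inE => /eqP->; suff -> : f @: [set: 'I_4] = A by [].
  apply/eqP; rewrite eqEcard card_imset ?cardsT ?card_ord ?c4 ?leqnn ?andbT.
    by apply/subsetP => _ /imsetP[i _ ->]; exact: enum_valP.
  by move=> i j /enum_val_inj /cast_ord_inj.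
- exact: cards1.
Qed.

Lemma bin4_ge n : 12 <= n -> n ^ 4 <= 48 * 'C(n, 4).
Proof.
move=> n12; have := bin_ffact n 4.
case: n n12 => [|[|[|[|n]]]] // n12.
rewrite !ffactnS /= ffactn0 (_ : 4`! = 24) // => h.
have -> : 48 * 'C(n.+4, 4) = 2 * ('C(n.+4, 4) * 24) by lia.
rewrite h !expnS expn0 !muln1; nia.
Qed.

Lemma bin4_le n : 24 * 'C(n, 4) <= n ^ 4.
Proof.
have := bin_ffact n 4; rewrite (_ : 4`! = 24) // mulnC => ->.
case: n => [|[|[|[|n]]]] //.
rewrite !ffactnS /= ffactn0 !expnS expn0 !muln1; nia.
Qed.

Local Open Scope ring_scope.

(** * Rounding and 24th roots *)

Section Real.
Variable R : realType.
Implicit Types (x y : R).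

(** Rounding down, in the form [M.+1] that the colourings use. The additive bound serves where a
    factor 2 is too coarse. *)
Lemma nat_below (z : R) : 1 <= z -> exists M : nat, [/\ M.+1%:R <= z, z <= 2 * M.+1%:R & z < M.+1%:R + 1].
Proof.
move=> z1; have z0 : 0 <= z by lra.
have /andP[h1 h2] := truncn_itv z0.
have t0 : (0 < Num.truncn z)%N by rewrite truncn_gt0.
exists (Num.truncn z).-1; rewrite prednK //; split=> //.
  have : 1 <= (Num.truncn z)%:R :> R by rewrite ler1n.
  by rewrite -natr1 in h2; lra.
by rewrite -natr1 in h2.
Qed.

Lemma root24 (n : nat) : (0 < n)%N -> exists2 y : R, 0 < y & y ^+ 24 = n%:R.
Proof.
move=> n0; exists (n%:R `^ (24%:R^-1)); first by apply: powR_gt0; rewrite ltr0n.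
by rewrite -powR_mulrn ?powR_ge0 // -powRrM mulVf ?pnatr_eq0 // powRr1 ?ler0n.
Qed.

Lemma powR_root (z : R) (p q k : nat) : 0 < z -> (0 < q)%N -> (24 * p = k * q)%N ->
  (z ^+ 24) `^ (p%:R / q%:R) = z ^+ k.
Proof.
move=> z0 q0 e; rewrite -powR_mulrn ?ltW // -powRrM mulrA -natrM e natrM mulfK.
  by rewrite powR_mulrn // ltW.
by rewrite pnatr_eq0 -lt0n.
Qed.

Lemma root24_large (C : R) : exists n0 : nat, forall n : nat, (n0 <= n)%N ->
  forall y, 0 < y -> y ^+ 24 = n%:R -> C <= y.
Proof.
exists (Num.truncn (`|C| ^+ 24)).+1 => n nn y y0 yn.
rewrite leNgt; apply/negP => yC; have yC' : y < `|C| by apply: lt_le_trans yC (ler_norm _).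
have : y ^+ 24 < `|C| ^+ 24 by rewrite ltr_pXn2r // ?nnegrE ?ltW.
rewrite yn ltNge => /negP; apply.
apply: le_trans (ltW (truncnS_gt _)) _; by rewrite ler_nat.
Qed.
End Real.

Lemma leq_exp2rW a b m : (a <= b)%N -> (a ^ m <= b ^ m)%N.
Proof. by move=> ab; case: m => [//|m]; rewrite leq_exp2r. Qed.

(** Since [e <= n ^ 3], the ratio of binomial to e is at least n/48, and [random_bound] gives n^m <=
    48^m n^c for m edges and c vertices. As 48^2 <= n, the factor 48^m costs at most half of the
    exponent m. *)
Lemma random_half n e (T : finType) (H : {set {set T}}) : (48 ^ 2 <= n)%N -> (e <= n ^ 3)%N ->
  uniform 4 H -> unavoidable 4 n e H -> (#|H| <= 2 * #|cover H|)%N.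
Proof.
move=> n48 en uH unH; have n1 : (1 < n)%N by apply: leq_trans n48.
have n12 : (12 <= n)%N by apply: leq_trans n48.
have n0 : (0 < n)%N by exact: ltnW.
have eN : (e <= 'C(n, 4))%N.
  rewrite -(@leq_pmul2l 48) //; apply: leq_trans (bin4_ge n12).
  rewrite (expnS n 3); apply: leq_mul en; apply: leq_trans n48; by rewrite leq_pmull.
have := random_bound n0 uH unH; rewrite (unavoidable_card eN unH) eN => /(_ isT) h.
set m := #|H| in h *; set c := #|cover H| in h *.
have h1 : (n ^ m <= 48 ^ m * n ^ c)%N.
  have nm0 : (0 < (n ^ 3) ^ m)%N by rewrite !expn_gt0 n0.
  rewrite -(leq_pmul2l nm0) -expnMn -(expnSr n 3).
  apply: leq_trans (_ : (48 * 'C(n, 4)) ^ m <= _)%N; first by rewrite leq_exp2rW // bin4_ge.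
  rewrite expnMn [X in (_ <= X)%N]mulnCA leq_mul2l; apply/orP; right.
  by apply: leq_trans h _; rewrite leq_mul2r leq_exp2rW // orbT.
have h2 : (n ^ (2 * m) <= n ^ m * n ^ (2 * c))%N.
  rewrite mulnC expnM; apply: leq_trans (leq_exp2rW 2 h1) _.
  rewrite expnMn -!expnM [(c * 2)%N]mulnC leq_mul2r; apply/orP; right.
  by rewrite mulnC expnM leq_exp2rW.
by move: h2; rewrite -expnD leq_exp2l //; lia.
Qed.

Lemma natr_odd (R : realType) (M : nat) : (M.*2.+3)%:R = 2 * M.+1%:R + 1 :> R.
Proof.
have -> : M.*2.+3 = (2 * M.+1 + 1)%N by lia.
by rewrite natrD natrM.
Qed.

(** * Upper bounds over the reals *)

(* All exponents in the theorem are multiples of 1/24, so with x = e^(1/24) and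
   y = n^(1/24) every quantity becomes a monomial in x and y. *)
Section UpperReal.
Variable R : realType.
Variables (n e : nat) (x y : R).
Hypotheses (x0 : 0 < x) (y0 : 0 < y) (xe : x ^+ 24 = e%:R) (yn : y ^+ 24 = n%:R).
Hypothesis n12 : (12 <= n)%N.
Let xw : 0 <= x := ltW x0.
Let yw : 0 <= y := ltW y0.

Lemma leq_bin4 (a : nat) : 48 * a%:R <= (n%:R : R) ^+ 4 -> (a <= 'C(n, 4))%N.
Proof.
move=> h; rewrite -(@leq_pmul2l 48) //; apply: leq_trans (bin4_ge n12).
by rewrite -(ler_nat R) natrM natrX.
Qed.

Lemma colours_leq M j (z : R) : 0 <= z -> M.+1%:R <= z -> 48 * (z ^+ j * x ^+ 24) <= y ^+ 96 ->
  (M.+1 ^ j * e <= 'C(n, 4))%N.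
Proof.
move=> z0 Mz h; apply: leq_bin4; rewrite -yn -exprM; apply: le_trans h.
rewrite natrM natrX -xe ler_pM2l ?ltr0n // ler_wpM2r ?exprn_ge0 //.
by apply: lerXn2r; rewrite ?nnegrE ?ler0n.
Qed.

(** Rounding the modulus costs a factor 2, and the incomplete last period adds 1, which is at most
    n/z. *)
Lemma block_le M (z : R) : 1 <= z <= y ^+ 24 -> z <= 2 * M.+1%:R ->
  ((n %/ M.+1).+1)%:R <= 3 * (y ^+ 24 / z).
Proof.
move=> /andP[z1 zn] zM; have z0 : 0 < z by lra.
have h1 : 1 <= y ^+ 24 / z by rewrite ler_pdivlMr // mul1r.
have M0 : 0 < M.+1%:R :> R by rewrite ltr0n.
have h2 : (n %/ M.+1)%:R <= y ^+ 24 / M.+1%:R.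
  by rewrite ler_pdivlMr // yn -natrM ler_nat leq_trunc_div.
have h3 : y ^+ 24 / M.+1%:R <= 2 * (y ^+ 24 / z).
  rewrite ler_pdivrMr //; have qz : y ^+ 24 / z * z = y ^+ 24 by rewrite divfK // gt_eqF.
  have : y ^+ 24 / z * z <= y ^+ 24 / z * (2 * M.+1%:R) by rewrite ler_wpM2l // (le_trans _ h1).
  by rewrite qz => /le_trans; apply; rewrite (_ : _ * (2 * _) = 2 * (y ^+ 24 / z) * M.+1%:R) //; ring.
rewrite -natr1; move: h1 (le_trans h2 h3); move: (y ^+ 24 / z) (_%:R) => q p; lra.
Qed.

Variables (T : finType) (H : {set {set T}}).
Hypotheses (uH : uniform 4 H) (unH : unavoidable 4 n e H).

(** The modulus is about n/(3 e^(1/4)): [48 < 3 ^ 4] keeps the number of colours admissible, and 36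
    is 4 positions times 3 from [block_le] times 3. *)
Lemma clique_real : 3 * x ^+ 6 <= y ^+ 24 -> 1 <= 3 * x ^+ 6 -> #|cover H|%:R <= 36 * x ^+ 6.
Proof.
move=> h h'; pose z := y ^+ 24 / (3 * x ^+ 6).
have x6 : 0 < 3 * x ^+ 6 by lra.
have z1 : 1 <= z by rewrite ler_pdivlMr // mul1r.
have zn : z <= y ^+ 24.
  by rewrite ler_pdivrMr // ler_peMr // exprn_ge0 // ltW.
have [M [M1 M2 _]] := nat_below z1.
have := clique_bound uH unH (@colours_leq M 4 z _ M1 _).
have -> : 36 * x ^+ 6 = 4 * (3 * (y ^+ 24 / z)).
  by rewrite /z; field; rewrite !gt_eqF // ?exprn_gt0.
move=> hc; apply: le_trans (_ : (4 * (n %/ M.+1).+1)%:R <= _).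
  rewrite ler_nat; apply: hc; first lra.
  have -> : 48 * (z ^+ 4 * x ^+ 24) = 48 / 81 * y ^+ 96.
    by rewrite /z; field; rewrite gt_eqF.
  have : 0 <= y ^+ 96 by rewrite exprn_ge0 // ltW.
  lra.
rewrite natrM ler_pM2l ?ltr0n //; apply: block_le => //; lra.
Qed.
Lemma star_real v : y ^+ 8 <= 4 * x ^+ 8 -> 4 * x ^+ 8 <= y ^+ 32 ->
  #|cover (star H v)|%:R <= 192 * (x ^+ 8 / y ^+ 8).
Proof.
move=> h h'; pose z := y ^+ 32 / (4 * x ^+ 8).
have x8 : 0 < 4 * x ^+ 8 by rewrite mulr_gt0 ?ltr0n // exprn_gt0.
have z1 : 1 <= z by rewrite ler_pdivlMr // mul1r.
have zn : z <= y ^+ 24.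
  by rewrite ler_pdivrMr // -[32%N]/(24 + 8)%N exprD ler_wpM2l ?exprn_ge0.
have [M [M1 M2 _]] := nat_below z1.
have hc := star_cover_bound uH unH v (@colours_leq M 3 z _ M1 _).
have -> : 192 * (x ^+ 8 / y ^+ 8) = 16 * (3 * (y ^+ 24 / z)).
  by rewrite /z; field; rewrite !gt_eqF.
apply: le_trans (_ : (16 * (n %/ M.+1).+1)%:R <= _).
  rewrite ler_nat; apply: hc; first lra.
  have -> : 48 * (z ^+ 3 * x ^+ 24) = 48 / 64 * y ^+ 96.
    by rewrite /z; field; rewrite gt_eqF.
  have : 0 <= y ^+ 96 by rewrite exprn_ge0.
  lra.
rewrite natrM ler_pM2l ?ltr0n //; apply: block_le => //; lra.
Qed.

Lemma cover_real (z : R) : 1 <= z <= y ^+ 24 -> 48 * (z * x ^+ 24) <= y ^+ 96 ->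
  exists2 B : {set T}, #|B|%:R <= 3 * (y ^+ 24 / z) &
    forall A, A \in H -> exists2 v, v \in A & v \in B.
Proof.
move=> /andP[z1 zn] h; have [M [M1 M2 _]] := nat_below z1.
have hM : (M.+1 * e <= 'C(n, 4))%N.
  by have := @colours_leq M 1 z; rewrite expn1 expr1; apply => //; lra.
have [B cB hB] := cover_bound uH unH hM; exists B => //.
apply: le_trans (_ : (n %/ M.+1).+1%:R <= _); first by rewrite ler_nat.
by apply: block_le => //; rewrite z1.
Qed.

(** There are at most n/48 intervals of length 96, and n/48 times n^3 is at most the number of
    4-subsets. *)
Lemma triple_real : x ^+ 24 <= y ^+ 72 -> (96 <= n)%N ->
  forall u1 u2 u3, uniq [:: u1; u2; u3] ->
  (#|[set A in H | [&& u1 \in A, u2 \in A & u3 \in A]]| <= 96)%N.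
Proof.
move=> en n96; apply: (triple_bound uH unH) => //; first exact: leq_trans n96.
apply: leq_bin4; rewrite natrM -xe -yn -exprM.
have h1 : ((n.-1 %/ 96).+1)%:R <= y ^+ 24 / 48.
  have : ((n.-1 %/ 96).+1 * 48 <= n)%N.
    have := leq_trunc_div n.-1 96; have : (48 <= n)%N by apply: leq_trans n96.
    lia.
  by rewrite -(ler_nat R) natrM yn ler_pdivlMr ?ltr0n.
apply: le_trans (_ : 48 * (y ^+ 24 / 48 * y ^+ 72) <= _).
  by rewrite ler_pM2l ?ltr0n // ler_pM // exprn_ge0.
by rewrite (_ : _ * _ = y ^+ 96) //; field.
Qed.

(** [ka] is (e/n^2)^(1/4); the target in (ii) is its cube. *)
Let ka := x ^+ 6 / y ^+ 12.

(** In [star_chunk_bound] the partner sets have O(ka) elements, [B] and the pair degrees are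
    O(ka^2), [W] is O(ka^3), triple degrees are at most 96, and [random_half] gives L = 2. Every
    summand is thus O(ka^3). *)
Lemma chunk_star_real v : (forall A, A \in H -> v \in A) -> x ^+ 24 <= y ^+ 72 ->
  (48 ^ 2 <= n)%N -> y ^+ 2 <= x -> 21 * x ^+ 12 <= y ^+ 48 -> 96 * x ^+ 18 <= y ^+ 60 ->
  #|H|%:R <= 500 * 500 * ka ^+ 3.
Proof.
move=> vH en n48 yx hz hp.
have n96 : (96 <= n)%N by apply: leq_trans n48.
have ka1 : 1 <= ka.
  rewrite ler_pdivlMr ?exprn_gt0 // mul1r -[12%N]/(2 * 6)%N exprM.
  by apply: lerXn2r; rewrite ?nnegrE ?exprn_ge0.
have hT := triple_real en n96.
(* [z] is n/(7 ka^2), so blocks have O(ka^2) vertices; [48 < 7 ^ 2] keeps the number of colours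
   admissible. *)
pose z := y ^+ 48 / (7 * x ^+ 12).
have x12 : 0 < 7 * x ^+ 12 by rewrite mulr_gt0 ?ltr0n // exprn_gt0.
have z3 : 3 <= z by rewrite ler_pdivlMr //; lra.
have zn : z <= y ^+ 24.
  rewrite ler_pdivrMr // -[48%N]/(24 + 2 * 12)%N exprD exprM ler_wpM2l ?exprn_ge0 //.
  have h : (y ^+ 2) ^+ 12 <= x ^+ 12 by apply: lerXn2r; rewrite ?nnegrE ?exprn_ge0.
  by have := exprn_gt0 12 x0; rewrite -exprM in h *; lra.
have zE : y ^+ 24 / z = 7 * ka ^+ 2 by rewrite /z /ka; field; rewrite !gt_eqF.
have z2 : 48 * (z ^+ 2 * x ^+ 24) <= y ^+ 96.
  have -> : 48 * (z ^+ 2 * x ^+ 24) = 48 / 49 * y ^+ 96 by rewrite /z; field; rewrite gt_eqF.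
  have : 0 <= y ^+ 96 by rewrite exprn_ge0.
  lra.
have [B cB hB] : exists2 B : {set T}, #|B|%:R <= 42 * ka ^+ 2 &
    forall A u, A \in H -> exists w, [/\ w \in A, w \in B & w != u].
  have [|M [M1 M2 _]] := @nat_below _ z; first lra.
  have [|B cB hB] := @pair_cover_bound n e T H uH unH M; first by apply: colours_leq M1 _ => //; lra.
  exists B => //; apply: le_trans (_ : (2 * (n %/ M.+1).+1)%:R <= _); first by rewrite ler_nat.
  have := @block_le M z; rewrite zE zn natrM => /(_ _ M2); rewrite andbT => h.
  have := h _; lra.
have [b [hb hD]] : exists b : nat, b%:R <= 21 * ka ^+ 2 /\
   forall v w, v != w -> (#|[set A in H | (v \in A) && (w \in A)]| <= 16 * (b * 96))%N.
  (* Chosen so that the odd modulus 2 (M + 1) + 1 is at most [z] but larger than z - 2. *)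
  have [|M [M1 M2 M3]] := @nat_below _ ((z - 1) / 2); first lra.
  have MM := natr_odd R M.
  exists (n %/ M.*2.+3).+1; split.
    have := @block_le M.*2.+2 z; rewrite zE zn MM andbT => h.
    suff : (n %/ M.*2.+3).+1%:R <= 3 * (7 * ka ^+ 2) by lra.
    by apply: h; lra.
  apply: (pair_degree_bound uH unH hT); apply: (@colours_leq _ _ z) => //; first lra.
  by rewrite MM; lra.
have [p [hp1 hp2]] : exists p : nat, 96 * ka ^+ 2 <= p%:R /\ p%:R <= 97 * ka ^+ 2.
  have k2 : 1 <= ka ^+ 2 by rewrite exprn_ege1.
  have [|M [M1 M2 M3]] := @nat_below _ (97 * ka ^+ 2); first lra.
  by exists M.+1; split; lra.
have p0 : (0 < p)%N by rewrite -(ltr_nat R); have : 1 <= ka ^+ 2 by [rewrite exprn_ege1]; lra.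
pose z' := y ^+ 24 / ka.
have ka0 : 0 < ka by lra.
have z'n : z' <= y ^+ 24 by rewrite ler_pdivrMr // ler_peMr // exprn_ge0.
have z'1 : 1 <= z'.
  rewrite ler_pdivlMr // mul1r ler_pdivrMr ?exprn_gt0 // -exprD.
  have h : 1 <= y ^+ 24 by rewrite yn ler1n; apply: leq_trans n12.
  have h2 : x ^+ 24 <= y ^+ 144.
    by apply: le_trans en _; rewrite -[144%N]/(72 + 24 * 3)%N exprD exprM ler_peMr ?exprn_ge0 // exprn_ege1.
  by move: h2; rewrite (exprM x 6 4) (exprM y 36 4) ler_pXn2r ?nnegrE ?exprn_ge0.
have [|M [M1 M2 _]] := @nat_below _ z'; first by [].
have [|W [Nb [cW cN hW]]] := @chunk_bound n e T H uH unH M p p0.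
  apply: leq_bin4; rewrite !natrM -xe -yn -exprM.
  have h1 : ((M %/ p).+1)%:R <= z' / (96 * ka ^+ 2) + 1.
    rewrite -natr1 lerD2r ler_pdivlMr; last by rewrite mulr_gt0 ?ltr0n ?exprn_gt0.
    apply: le_trans (_ : (M %/ p)%:R * p%:R <= _); first by rewrite ler_wpM2l.
    rewrite -natrM; apply: le_trans M1; rewrite ler_nat; apply: leq_trans (leq_trunc_div _ _) _.
    exact: leqnSn.
  apply: le_trans (_ : 48 * (z' * (z' / (96 * ka ^+ 2) + 1) * x ^+ 24) <= _).
    rewrite ler_pM2l ?ltr0n // ler_wpM2r ?exprn_ge0 // ler_pM //.
  (* As ka^4 = e/n^2, the product term is exactly half of n^4; the summand caused by rounding up the
     number of intervals is left to [hp]. *)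
  have -> : 48 * (z' * (z' / (96 * ka ^+ 2) + 1) * x ^+ 24) =
     (y ^+ 96 + 96 * x ^+ 18 * y ^+ 36) / 2.
    by rewrite /z' /ka; field; rewrite !gt_eqF.
  have : 96 * x ^+ 18 * y ^+ 36 <= y ^+ 60 * y ^+ 36 by rewrite ler_wpM2r ?exprn_ge0.
  by rewrite -exprD; lra.
have bl : (n %/ M.+1).+1%:R <= 3 * ka.
  have := @block_le M z'; rewrite z'1 z'n => /(_ isT M2).
  have -> : y ^+ 24 / z' = ka by rewrite /z' invf_div mulrCA divff ?mulr1 // gt_eqF // exprn_gt0.
  by [].
have cW' : #|W|%:R <= 582 * ka ^+ 3.
  apply: le_trans (_ : (2 * p * (n %/ M.+1).+1)%:R <= _); first by rewrite ler_nat.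
  rewrite !natrM (_ : 582 * ka ^+ 3 = 2 * (97 * ka ^+ 2) * (3 * ka)); last by ring.
  by rewrite ler_pM // ?ler_pM2l ?mulr_ge0.
have := @star_chunk_bound T H v B W Nb (2 * (n %/ M.+1).+1) (16 * (b * 96)) 96 2 uH vH hT hD (fun A AH => hB A v AH) cN hW.
have hH' (H' : {set {set T}}) : H' \subset H -> (#|H'| <= 2 * #|cover H'|)%N.
  move=> sub; apply: (random_half n48 _ (uniform_sub sub uH) (unavoidable_sub sub unH)).
  by rewrite -(ler_nat R) natrX -xe -yn -exprM.
move=> /(_ hH'); rewrite -(ler_nat R) => /le_trans; apply.
rewrite 2!natrD !natrM (natrD _ (1 + #|B|)) (natrD _ 1).
move: bl hb cB cW' (ler0n R (n %/ M.+1).+1) (ler0n R b) (ler0n R #|B|).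
move: ((_.+1)%:R) (#|B|%:R) (#|W|%:R) (b%:R) => s be w bb bl hb cB' cW' s0 bb0 be0.
have k2 : ka ^+ 2 <= ka ^+ 3 by rewrite ler_weXn2l.
have k1 : 1 <= ka ^+ 3 by rewrite exprn_ege1.
have e1 : s * bb <= 63 * ka ^+ 3.
  by rewrite (_ : 63 * _ = 3 * ka * (21 * ka ^+ 2)) ?ler_pM //; ring.
have e2 : s * be <= 126 * ka ^+ 3.
  by rewrite (_ : 126 * _ = 3 * ka * (42 * ka ^+ 2)) ?ler_pM //; ring.
rewrite (_ : _ + _ + _ = 3072 * (s * bb) + 192 * (s * be) + 2 + 2 * be + 2 * w); last by ring.
move: k2 k1 cB' cW' e1 e2; move: (ka ^+ 2) (ka ^+ 3) (s * bb) (s * be) => q2 q3 u1 u2.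
lra.
Qed.
End UpperReal.

Lemma random_ln (R : realType) n e (T : finType) (H : {set {set T}}) :
  (0 < n)%N -> (0 < e)%N -> (e <= 'C(n, 4))%N ->
  uniform 4 H -> unavoidable 4 n e H ->
  #|H|%:R * ln ('C(n, 4)%:R / e%:R) <= #|cover H|%:R * ln n%:R :> R.
Proof.
move=> n0 e0 eN uH unH; have := random_bound n0 uH unH.
rewrite (unavoidable_card eN unH) eN => /(_ isT) h.
have N0 : (0 < 'C(n, 4))%N by exact: leq_trans eN.
have Nr : 0 < 'C(n, 4)%:R :> R by rewrite ltr0n.
have er : 0 < e%:R :> R by rewrite ltr0n.
have nr : 0 < n%:R :> R by rewrite ltr0n.
rewrite ![_%:R * ln _]mulr_natl -!lnXn ?divr_gt0 // ler_ln ?posrE ?exprn_gt0 ?divr_gt0 //.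
rewrite expr_div_n ler_pdivrMr ?exprn_gt0 // mulrC.
by rewrite -!natrX -natrM ler_nat.
Qed.

(** * Upper bounds range by range *)

Section UnUpper.
Variable R : realType.
Variables (n e : nat) (x y : R).
Hypotheses (x0 : 0 < x) (y0 : 0 < y) (xe : x ^+ 24 = e%:R) (yn : y ^+ 24 = n%:R).
Hypothesis y100 : 100 <= y.
Let xw : 0 <= x := ltW x0.
Let yw : 0 <= y := ltW y0.

Let y1 : 1 <= y. Proof. by apply: le_trans y100; rewrite ler1n. Qed.

Lemma expr_ge100 k : (0 < k)%N -> 100 <= y ^+ k.
Proof.
move=> k0; apply: le_trans y100 _; rewrite -[X in X <= _]expr1.
by rewrite ler_weXn2l.
Qed.

Lemma n_large : (48 ^ 2 <= n)%N.
Proof.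
rewrite -(ler_nat R) natrX -yn -[24%N]/(12 * 2)%N exprM.
by apply: lerXn2r; rewrite ?nnegrE ?exprn_ge0 //; have := @expr_ge100 12 isT; lra.
Qed.

Let n48 := n_large.
Let n12 : (12 <= n)%N. Proof. by apply: leq_trans n48. Qed.
Let e0 : (0 < e)%N. Proof. by rewrite -(ltr_nat R) -xe exprn_gt0. Qed.

Lemma le_e_n3 : x <= y ^+ 3 -> (e <= n ^ 3)%N.
Proof.
move=> xy; rewrite -(ler_nat R) natrX -xe -yn -exprM mulnC exprM.
by apply: lerXn2r; rewrite ?nnegrE ?exprn_ge0.
Qed.

Lemma le_e_bin : x <= y ^+ 3 -> (e <= 'C(n, 4))%N.
Proof.
move=> xy; rewrite -(@leq_pmul2l 48) //; apply: leq_trans (bin4_ge n12).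
rewrite (expnS n 3); apply: leq_mul (le_e_n3 xy); apply: leq_trans n48; by rewrite leq_pmull.
Qed.

Variables (T : finType) (H : {set {set T}}).
Hypotheses (uH : uniform 4 H) (unH : unavoidable 4 n e H).

(** For e <= n^3 about n/48 residue classes are admissible, so one class has bounded size; 144 is 3
    * 48. *)
Lemma cover_small : x <= y ^+ 3 -> exists2 B : {set T}, (#|B| <= 144)%N &
    forall A, A \in H -> exists2 v, v \in A & v \in B.
Proof.
move=> xy; have y24 := @expr_ge100 24 isT.
have [||B cB hB] := @cover_real R n e x y x0 xe yn n12 T H uH unH (y ^+ 24 / 48).
- by apply/andP; split; lra.
- have : x ^+ 24 <= y ^+ 72.
    by rewrite -[72%N]/(3 * 24)%N exprM; apply: lerXn2r; rewrite ?nnegrE ?exprn_ge0.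
  move=> h; rewrite mulrA [48 * _]mulrC divfK ?pnatr_eq0 // -[96%N]/(24 + 72)%N exprD.
  by rewrite ler_wpM2l ?exprn_ge0.
exists B => //; rewrite -(ler_nat R); apply: le_trans cB _.
by rewrite (_ : 3 * _ = 144) //; field; rewrite gt_eqF.
Qed.

(** Boundedly many stars, each on O((e/n)^(1/3)) vertices, cover everything, and [random_half]
    passes from vertices to edges. *)
Lemma card_t : x <= y ^+ 3 -> y ^+ 2 <= x -> #|H|%:R <= 2 * 144 * 192 * (x ^+ 8 / y ^+ 8).
Proof.
move=> xy yx; have [B cB hB] := cover_small xy.
have ya : y <= x by apply: le_trans yx; rewrite -[X in X <= _]expr1 ler_weXn2l.
have s v := @star_real R n e x y x0 y0 xe yn n12 T H uH unH v.
have h1 : y ^+ 8 <= 4 * x ^+ 8.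
  have : y ^+ 8 <= x ^+ 8 by apply: lerXn2r; rewrite ?nnegrE.
  have : 0 <= x ^+ 8 by rewrite exprn_ge0.
  lra.
have h2 : 4 * x ^+ 8 <= y ^+ 32.
  have h : x ^+ 8 <= y ^+ 24.
    by rewrite -[24%N]/(3 * 8)%N exprM; apply: lerXn2r; rewrite ?nnegrE ?exprn_ge0.
  rewrite -[32%N]/(8 + 24)%N exprD ler_pM ?exprn_ge0 //.
  by have := @expr_ge100 8 isT; lra.
have [v0|noT] := pickP (fun v : T => true); last first.
  have H0 : H = set0.
    apply/setP => A; rewrite inE; apply/negP => AH; have [v] := hB A AH.
    by have := noT v.
  by rewrite H0 cards0 !mulr_ge0 ?ler0n ?invr_ge0 ?exprn_ge0.
move=> _; pose m := (\max_v #|cover (star H v)|)%N.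
have T0 : (0 < #|T|)%N by apply/card_gt0P; exists v0.
have [v1 mE] := @bigop.eq_bigmax T (fun v => #|cover (star H v)|) T0; rewrite -/m in mE.
have hm v : (#|cover (star H v)| <= m)%N by apply: (@bigop.leq_bigmax _ _ v).
have c := card_cover_stars hB hm.
have r := random_half n48 (le_e_n3 xy) uH unH.
have : (#|H| <= 2 * (144 * m))%N.
  by apply: leq_trans r _; rewrite leq_mul2l; apply: leq_trans c _; rewrite leq_mul2r cB orbT.
rewrite -(ler_nat R) !natrM => /le_trans; apply.
have := s v1 h1 h2; rewrite -mE; move: (m%:R) (x ^+ 8 / y ^+ 8) => p q; lra.
Qed.

(** [x ^+ 10 <= y ^+ 28] says that (e/n^2)^(3/4) is the smaller term of the minimum. It also yields
    the bound on [96 * x ^+ 18] that [chunk_star_real] needs for its number of colours. *)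
Lemma card_k : x <= y ^+ 3 -> y ^+ 2 <= x -> x ^+ 10 <= y ^+ 28 ->
  #|H|%:R <= 144 * (500 * 500 * (x ^+ 6 / y ^+ 12) ^+ 3).
Proof.
move=> xy yx xk; have [B cB hB] := cover_small xy.
have xe3 : x ^+ 24 <= y ^+ 72.
  by rewrite -[72%N]/(3 * 24)%N exprM; apply: lerXn2r; rewrite ?nnegrE ?exprn_ge0.
have h1 : 21 * x ^+ 12 <= y ^+ 48.
  have h : x ^+ 12 <= y ^+ 36.
    by rewrite -[36%N]/(3 * 12)%N exprM; apply: lerXn2r; rewrite ?nnegrE ?exprn_ge0.
  rewrite -[48%N]/(12 + 36)%N exprD ler_pM ?exprn_ge0 //.
  by have := @expr_ge100 12 isT; lra.
have h2 : 96 * x ^+ 18 <= y ^+ 60.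
  have hh : x ^+ 20 <= y ^+ 56.
    rewrite -[20%N]/(10 * 2)%N -[56%N]/(28 * 2)%N (exprM x) (exprM y).
    by apply: lerXn2r; rewrite ?nnegrE ?exprn_ge0.
  have h3 : x ^+ 18 <= y ^+ 52.
    rewrite -(@ler_pM2r _ (y ^+ 4)) ?exprn_gt0 // -exprD; apply: le_trans hh.
    rewrite -[20%N]/(18 + 2)%N exprD ler_wpM2l ?exprn_ge0 //.
    by rewrite -[4%N]/(2 * 2)%N exprM; apply: lerXn2r; rewrite ?nnegrE ?exprn_ge0.
  rewrite -[60%N]/(8 + 52)%N exprD ler_pM ?exprn_ge0 //.
  by have := @expr_ge100 8 isT; lra.
pose m := (\max_v #|star H v|)%N.
have hm v : (#|star H v| <= m)%N by apply: (@bigop.leq_bigmax _ _ v).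
have c := card_stars hB hm.
have sub v : star H v \subset H by apply/subsetP => A; rewrite inE => /andP[].
have st v : #|star H v|%:R <= 500 * 500 * (x ^+ 6 / y ^+ 12) ^+ 3.
  apply: (@chunk_star_real R n e x y x0 y0 xe yn n12 T _ (uniform_sub (sub v) uH) (unavoidable_sub (sub v) unH) v) => //.
  by move=> A; rewrite inE => /andP[].
have mle : m%:R <= 500 * 500 * (x ^+ 6 / y ^+ 12) ^+ 3.
  have [v0 _|noT] := pickP (fun v : T => true); last first.
    have h : 0 <= (x ^+ 6 / y ^+ 12) ^+ 3 by rewrite exprn_ge0 // divr_ge0 // exprn_ge0.
    by rewrite /m big_pred0 //; apply: mulr_ge0 h; apply: mulr_ge0; rewrite ler0n.
  have T0 : (0 < #|T|)%N by apply/card_gt0P; exists v0.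
  have [v1 mE] := @bigop.eq_bigmax T (fun v => #|star H v|) T0; rewrite /m mE; exact: st.
apply: le_trans (_ : (144 * m)%:R <= _).
  by rewrite ler_nat; apply: leq_trans c _; rewrite leq_mul2r cB orbT.
by rewrite natrM ler_pM2l ?ltr0n.
Qed.

(** A cover of O(e/n^3) vertices times O((e/n)^(1/3)) vertices per star gives e^(4/3)/n^(10/3). *)
Lemma cover_big : y ^+ 3 <= x -> 100 * x ^+ 24 <= y ^+ 96 ->
  #|cover H|%:R <= 144 * 192 * (x ^+ 32 / y ^+ 80).
Proof.
move=> xy h; have x24 : 0 < x ^+ 24 by rewrite exprn_gt0.
have xy3 : y ^+ 72 <= x ^+ 24.
  by rewrite -[72%N]/(3 * 24)%N exprM; apply: lerXn2r; rewrite ?nnegrE ?exprn_ge0.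
have [||B cB hB] := @cover_real R n e x y x0 xe yn n12 T H uH unH (y ^+ 96 / (48 * x ^+ 24)).
- apply/andP; split; first by rewrite ler_pdivlMr ?mulr_gt0 ?ltr0n // mul1r; lra.
  rewrite ler_pdivrMr ?mulr_gt0 ?ltr0n // -[96%N]/(24 + 72)%N exprD ler_wpM2l ?exprn_ge0 //; lra.
- by rewrite (_ : 48 * _ = y ^+ 96) //; field; rewrite gt_eqF.
have ya : y <= x by apply: le_trans xy; rewrite -[X in X <= _]expr1 ler_weXn2l.
have s v := @star_real R n e x y x0 y0 xe yn n12 T H uH unH v.
have h1 : y ^+ 8 <= 4 * x ^+ 8.
  have : y ^+ 8 <= x ^+ 8 by apply: lerXn2r; rewrite ?nnegrE.
  have : 0 <= x ^+ 8 by rewrite exprn_ge0.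
  lra.
have h2 : 4 * x ^+ 8 <= y ^+ 32.
  have : (4 * x ^+ 8) ^+ 3 <= (y ^+ 32) ^+ 3.
    have -> : (4 * x ^+ 8) ^+ 3 = 64 * x ^+ 24 by ring.
    by rewrite -exprM; lra.
  by rewrite ler_pXn2r // nnegrE ?exprn_ge0 // mulr_ge0 // exprn_ge0.
have [v0 _|noT] := pickP (fun v : T => true); last first.
  suff -> : cover H = set0 by rewrite cards0 !mulr_ge0 ?ler0n ?invr_ge0 ?exprn_ge0.
  by apply/setP => v; have := noT v.
pose m := (\max_v #|cover (star H v)|)%N.
have T0 : (0 < #|T|)%N by apply/card_gt0P; exists v0.
have [v1 mE] := @bigop.eq_bigmax T (fun v => #|cover (star H v)|) T0; rewrite -/m in mE.
have hm v : (#|cover (star H v)| <= m)%N by apply: (@bigop.leq_bigmax _ _ v).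
have c := card_cover_stars hB hm.
apply: le_trans (_ : (#|B| * m)%:R <= _); first by rewrite ler_nat.
rewrite natrM mE; have -> : 144 * 192 * (x ^+ 32 / y ^+ 80) =
  3 * (y ^+ 24 / (y ^+ 96 / (48 * x ^+ 24))) * (192 * (x ^+ 8 / y ^+ 8)).
  by field; rewrite !gt_eqF.
by rewrite ler_pM // s.
Qed.

Lemma clique_big : y ^+ 3 <= x -> 100 * x ^+ 24 <= y ^+ 96 -> #|cover H|%:R <= 36 * x ^+ 6.
Proof.
move=> xy h; apply: (@clique_real R n e x y x0 y0 xe yn n12 T H uH unH).
  have : (3 * x ^+ 6) ^+ 4 <= (y ^+ 24) ^+ 4.
    have -> : (3 * x ^+ 6) ^+ 4 = 81 * x ^+ 24 by ring.
    have : 0 <= x ^+ 24 by rewrite exprn_ge0.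
    by rewrite -exprM; lra.
  by rewrite ler_pXn2r // nnegrE ?exprn_ge0 // mulr_ge0 // exprn_ge0.
have x1 : 1 <= x by apply: le_trans xy; rewrite exprn_ege1.
have : 1 <= x ^+ 6 by rewrite exprn_ege1.
lra.
Qed.
End UnUpper.

Lemma ler_exp2rW (R : realType) (a b : R) k : 0 <= a -> a <= b -> a ^+ k <= b ^+ k.
Proof. by move=> a0 ab; apply: lerXn2r; rewrite ?nnegrE // (le_trans a0). Qed.

(** * Lower bounds over the reals *)

Section Budgets.
Variable R : realType.
Implicit Types C n r a b : nat.

Lemma natr_budget1 C n b : (C * (n ^ 2 * b ^ 2))%:R = C%:R * (n%:R ^+ 2 * b%:R ^+ 2) :> R.
Proof. by rewrite natrM natrM natrX natrX. Qed.
Lemma natr_budget2 C n a b : (C * (n ^ 2 * (a ^ 2 * b)))%:R = C%:R * (n%:R ^+ 2 * (a%:R ^+ 2 * b%:R)) :> R.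
Proof. by rewrite natrM natrM natrX natrM natrX. Qed.
Lemma natr_budget3 C n a b : (C * (n * (a * b) ^ 3))%:R = C%:R * (n%:R * (a%:R * b%:R) ^+ 3) :> R.
Proof. by rewrite natrM natrM natrX natrM. Qed.
Lemma natr_budget4 C n r a : (C * (n ^ 2 * (r ^ 2 * a ^ 3)))%:R = C%:R * (n%:R ^+ 2 * (r%:R ^+ 2 * a%:R ^+ 3)) :> R.
Proof. by rewrite natrM natrM natrX natrM natrX natrX. Qed.
Lemma natr_budget5 C n r a : (C * (n * (r * a ^ 2) ^ 3))%:R = C%:R * (n%:R * (r%:R * a%:R ^+ 2) ^+ 3) :> R.
Proof. by rewrite natrM natrM natrX natrM natrX. Qed.
Lemma natr_budget6 C r a k : (C * (r * a) ^ k)%:R = C%:R * (r%:R * a%:R) ^+ k :> R.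
Proof. by rewrite natrM natrX natrM. Qed.
Lemma natr_budget7 C n r a : (C * ((r * a) ^ 5 * n))%:R = C%:R * ((r%:R * a%:R) ^+ 5 * n%:R) :> R.
Proof. by rewrite natrM natrM natrX natrM. Qed.
Lemma natr_budget8 C n r : (C * (r * n ^ 3))%:R = C%:R * (r%:R * n%:R ^+ 3) :> R.
Proof. by rewrite natrM natrM natrX. Qed.
End Budgets.

Lemma lower_ii (R : realType) : exists2 c : R, 0 < c & forall (n e : nat) (x y : R),
  0 < x -> 0 < y -> x ^+ 24 = e%:R -> y ^+ 24 = n%:R -> 100 <= y -> y ^+ 2 <= x -> x <= y ^+ 3 ->
  c * Num.min ((x / y ^+ 2) ^+ 18) ((x / y) ^+ 8) <= (un 4 n e)%:R.
Proof.
have [C C0 hC] := attains_single; have C1 : 1 <= C%:R :> R by rewrite ler1n.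
set D : R := C%:R in C1; have D0 : 0 < D by lra.
exists (D ^- 2 / 4); first by rewrite divr_gt0 ?ltr0n // invr_gt0 exprn_gt0.
move=> n e x y x0 y0 xe yn y100 yx xy.
have eN := le_e_bin x0 y0 xe yn y100 xy.
have e0 : (0 < e)%N by rewrite -(ltr_nat R) -xe exprn_gt0.
have n0 : (0 < n)%N by rewrite -(ltr_nat R) -yn exprn_gt0.
have u1 : 1 <= (un 4 n e)%:R :> R by rewrite ler1n; exact: un_gt0.
have y2 : 0 < y ^+ 2 by rewrite exprn_gt0.
pose p := x / y ^+ 2.
have p1 : 1 <= p by rewrite ler_pdivlMr // mul1r.
have p0 : 0 < p by lra.
have D2 : 0 < D ^+ 2 by rewrite exprn_gt0.
(* In the small case (e/n^2)^(3/4) is at most [D ^+ 2], so a single edge meets the bound. *)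
have [small|big] := ltrP (p ^+ 12) D.
  apply: le_trans u1; rewrite mulrAC ler_pdivrMr ?ltr0n // mul1r mulrC ler_pdivrMr //.
  rewrite ge_min; apply/orP; left; rewrite -/p.
  apply: le_trans (_ : D ^+ 2 <= _); last by lra.
  apply: le_trans (_ : (p ^+ 12) ^+ 2 <= _); last by apply: ler_exp2rW; rewrite ?ltW // exprn_gt0.
  by rewrite -exprM ler_weXn2l.
have q1 : 1 <= p ^+ 12 / D by rewrite ler_pdivlMr // mul1r.
have [b' [b1 b2 _]] := nat_below q1.
(* [b] is about (e/n^2)^(1/2). The entries of [al] are the limits that the conditions on a^2 b and
   on (a b)^3 put on [a]; multiplied by [p ^+ 12] they are the two terms of the minimum. *)
pose al := Num.min (p ^+ 6) (y ^+ 16 / x ^+ 4).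
have al1 : 1 <= al.
  rewrite le_min exprn_ege1 //= ler_pdivlMr ?exprn_gt0 // mul1r.
  apply: le_trans (_ : (y ^+ 3) ^+ 4 <= _); first by apply: ler_exp2rW => //; exact: ltW.
  by rewrite -exprM ler_weXn2l //; lra.
have [a' [a1 a2 _]] := nat_below al1.
have aR : a'.+1%:R <= p ^+ 6 by apply: le_trans a1 _; rewrite ge_min lexx.
have aR' : a'.+1%:R <= y ^+ 16 / x ^+ 4 by apply: le_trans a1 _; rewrite ge_min lexx orbT.
have xw : 0 <= x by lra.
have yw : 0 <= y by lra.
have pe : p ^+ 24 * y ^+ 48 = x ^+ 24 by rewrite /p; field; rewrite gt_eqF.
have y48 : 0 <= y ^+ 48 by rewrite exprn_ge0.
have at1 : attains_un 4 n e (a'.+1 * b'.+1).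
  apply: hC => //; rewrite -(ler_nat R) -?xe.
  - rewrite natr_budget1 -/D -yn; apply: le_trans (_ : D * ((y ^+ 24) ^+ 2 * (p ^+ 12 / D) ^+ 2) <= _).
      by rewrite ler_pM2l // ler_wpM2l ?exprn_ge0 // ler_exp2rW.
    rewrite (_ : D * _ = (p ^+ 24 * y ^+ 48) / D); last by field; rewrite gt_eqF.
    by rewrite pe ler_pdivrMr // ler_peMr // exprn_ge0.
  - rewrite natr_budget2 -/D -yn; apply: le_trans (_ : D * ((y ^+ 24) ^+ 2 * ((p ^+ 6) ^+ 2 * (p ^+ 12 / D))) <= _).
      rewrite ler_pM2l // ler_wpM2l ?exprn_ge0 // ler_pM ?exprn_ge0 ?ler0n //.
      by rewrite ler_exp2rW.
    rewrite (_ : D * _ = p ^+ 24 * y ^+ 48); first by rewrite pe.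
    by field; rewrite gt_eqF.
  - rewrite natr_budget3 -/D -yn; apply: le_trans (_ : D * (y ^+ 24 * ((y ^+ 16 / x ^+ 4) * (p ^+ 12 / D)) ^+ 3) <= _).
      rewrite ler_pM2l // ler_wpM2l ?exprn_ge0 // ler_exp2rW ?mulr_ge0 ?ler0n //.
      by rewrite ler_pM ?ler0n.
    rewrite (_ : D * _ = x ^+ 24 / D ^+ 2); last by rewrite /p; field; rewrite !gt_eqF.
    by rewrite ler_pdivrMr ?exprn_gt0 // ler_peMr ?exprn_ge0 // exprn_ege1.
  - rewrite natrX -yn -exprM; apply: le_trans (_ : (y ^+ 2) ^+ 24 <= _); first by rewrite -exprM.
    by rewrite ler_exp2rW // exprn_ge0.
have := un_ge eN at1; rewrite -(ler_nat R) natrM => /(le_trans _); apply.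
have ab : (al / 2) * (p ^+ 12 / D / 2) <= a'.+1%:R * b'.+1%:R.
  move: al1 a2 q1 b2; clear; move: (p ^+ 12 / D) (a'.+1%:R) (b'.+1%:R) => t u v ? ? ? ?.
  by apply: ler_pM; lra.
apply: le_trans ab.
have -> : al / 2 * (p ^+ 12 / D / 2) = D^-1 / 4 * (al * p ^+ 12) by field; rewrite gt_eqF.
have -> : al * p ^+ 12 = Num.min (p ^+ 18) ((x / y) ^+ 8).
  rewrite minr_pMl ?exprn_ge0 ?ltW // -exprD; congr (Num.min _ _).
  by rewrite /p; field; rewrite !gt_eqF.
rewrite ler_wpM2r //.
  by rewrite le_min !exprn_ge0 // ?divr_ge0 // ltW.
rewrite ler_wpM2r ?invr_ge0 ?ler0n // lef_pV2 ?posrE //.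
by rewrite expr2 ler_peMr // ltW.
Qed.

Lemma lower_iii (R : realType) : exists c C : R, [/\ 0 < c, 1 <= C & forall (n e : nat) (x y : R),
  0 < x -> 0 < y -> x ^+ 24 = e%:R -> y ^+ 24 = n%:R -> 100 <= y -> C <= y ->
  y ^+ 3 <= x -> (e <= 'C(n, 4))%N ->
  c * Num.min (x ^+ 32 / y ^+ 80) (x ^+ 6) <= (un 4 n e)%:R].
Proof.
have [c2 c20 low2] := lower_ii R.
have [C C0 hC] := attains_many; have C1 : 1 <= C%:R :> R by rewrite ler1n.
set D : R := C%:R in C1; have D0 : 0 < D by lra.
have D2 : 0 < D ^+ 2 by rewrite exprn_gt0.
exists (Num.min (c2 / D ^+ 2) (D ^- 2 / 16)), D; split=> //.
  by rewrite lt_min !divr_gt0 ?ltr0n // invr_gt0.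
move=> n e x y x0 y0 xe yn y100 yD yx eN.
have xw : 0 <= x by lra.
have yw : 0 <= y by lra.
have y1 : 1 <= y by lra.
have n0 : (0 < n)%N by rewrite -(ltr_nat R) -yn exprn_gt0.
pose d := x ^+ 24 / y ^+ 72.
pose p := x / y ^+ 3.
have y3 : 0 < y ^+ 3 by rewrite exprn_gt0.
have p1 : 1 <= p by rewrite ler_pdivlMr // mul1r.
have dE : d = p ^+ 24 by rewrite /d /p; field; rewrite gt_eqF.
(* For e < D n^3 the bound at [n ^ 3] edges and monotonicity suffice: the target exceeds its value
   there by at most a constant factor. *)
have [small|big] := ltrP d D.
  have x'e : (y ^+ 3) ^+ 24 = (n ^ 3)%:R by rewrite natrX -yn -!exprM.
  have ne : (n ^ 3 <= e)%N by rewrite -(ler_nat R) -x'e -xe ler_exp2rW // ltW.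
  apply: le_trans (_ : (un 4 n (n ^ 3))%:R <= _); last by rewrite ler_nat un_mono.
  have := low2 n (n ^ 3)%N (y ^+ 3) y y3 y0 x'e yn y100 _ (lexx _).
  rewrite ler_weXn2l // => /(_ isT).
  have -> : y ^+ 3 / y ^+ 2 = y by field; rewrite gt_eqF.
  have -> : y ^+ 3 / y = y ^+ 2 by field; rewrite gt_eqF.
  rewrite -exprM min_r; last by rewrite ler_weXn2l.
  apply: le_trans; apply: le_trans (_ : c2 / D ^+ 2 * (x ^+ 32 / y ^+ 80) <= _).
    rewrite ler_pM //; rewrite ?ge_min ?lexx //.
      by rewrite le_min !divr_ge0 ?ler0n ?invr_ge0 // ltW.
    by rewrite le_min divr_ge0 ?exprn_ge0.
  have -> : x ^+ 32 / y ^+ 80 = p ^+ 32 * y ^+ 16 by rewrite /p; field; rewrite gt_eqF.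
  rewrite mulrAC ler_pdivrMr // -[leRHS]mulrA ler_wpM2l ?(ltW c20) // mulrC ler_wpM2l ?exprn_ge0 //.
  apply: le_trans (_ : d ^+ 2 <= _); last first.
    by apply: ler_exp2rW (ltW small); rewrite dE exprn_ge0 //; lra.
  by rewrite dE -exprM ler_weXn2l.
pose s := Num.min (x ^+ 16 / y ^+ 40) (x ^+ 3).
have sD : D <= s.
  have yy k : (0 < k)%N -> D <= y ^+ k.
    by move=> k0; apply: le_trans yD _; rewrite -[X in X <= _]expr1 ler_weXn2l.
  have yx3 : y <= x by apply: le_trans yx; rewrite -[X in X <= _]expr1 ler_weXn2l.
  rewrite le_min; apply/andP; split.
    apply: le_trans (yy 8%N isT) _; rewrite ler_pdivlMr ?exprn_gt0 // -exprD.
    by rewrite -[(8 + 40)%N]/(3 * 16)%N exprM ler_exp2rW // ltW.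
  by apply: le_trans (yy 3%N isT) _; rewrite ler_exp2rW.
(* [s ^+ 2] is the target. With r about rho/D and a about s/rho, the product r a is about s/D.
   [rho <= d] amounts to the condition on r n^3, and [rho <= s] keeps a at least 1. *)
pose rho := Num.min d s.
have rD : D <= rho by rewrite le_min big.
have rho0 : 0 < rho by lra.
have s0 : 0 < s by lra.
have q1 : 1 <= rho / D by rewrite ler_pdivlMr // mul1r.
have al1 : 1 <= s / rho by rewrite ler_pdivlMr // mul1r ge_min lexx orbT.
have [r' [r1 r2 _]] := nat_below q1.
have [a' [a1 a2 _]] := nat_below al1.
have sx3 : s <= x ^+ 3 by rewrite ge_min lexx orbT.
have sxy : s <= x ^+ 16 / y ^+ 40 by rewrite ge_min lexx.
have x24 : 0 <= x ^+ 24 by rewrite exprn_ge0.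
have yx2 : y ^+ 6 <= x ^+ 2 by rewrite -[6%N]/(3 * 2)%N exprM ler_exp2rW // ltW.
have x1 : 1 <= x by apply: le_trans yx; rewrite exprn_ege1.
have yk k l m' : (m' <= 3 * k)%N -> (k <= l)%N -> y ^+ m' <= x ^+ l.
  move=> mk kl; apply: le_trans (_ : y ^+ (3 * k) <= _); first by rewrite ler_weXn2l.
  apply: le_trans (_ : x ^+ k <= _); last by rewrite ler_weXn2l.
  by rewrite exprM ler_exp2rW // ltW.
have ra : r'.+1%:R * a'.+1%:R <= s / D.
  apply: le_trans (_ : rho / D * (s / rho) <= _); first by rewrite ler_pM ?ler0n.
  by rewrite (_ : rho / D * (s / rho) = s / D) //; field; rewrite !gt_eqF.
have DX X : 0 <= X -> X <= x ^+ 24 -> forall k, (0 < k)%N -> D * (X / D ^+ k) <= x ^+ 24.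
  move=> X0 Xx [//|k] _; apply: le_trans Xx; rewrite exprS invfM mulrCA mulVKf ?gt_eqF //.
  by rewrite ler_pdivrMr ?exprn_gt0 // ler_peMr // exprn_ege1.
have at1 : attains_un 4 n e ((r'.+1 * a'.+1) ^ 2).
  have s4 : s ^+ 3 * y ^+ 48 <= x ^+ 24 * rho.
    rewrite /rho; have [_|_] := leP d s.
      apply: le_trans (_ : (x ^+ 16 / y ^+ 40) ^+ 3 * y ^+ 48 <= _).
        by rewrite ler_wpM2r ?exprn_ge0 // ler_exp2rW // ltW.
      rewrite (_ : _ ^+ 3 * _ = x ^+ 24 * d) //; rewrite /d; field.
      by rewrite gt_eqF.
    rewrite exprSr mulrAC ler_wpM2r ?(ltW s0) //.
    apply: le_trans (_ : (x ^+ 3) ^+ 2 * x ^+ 18 <= _).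
      by rewrite ler_pM ?exprn_ge0 ?(ltW s0) ?(yk 16%N) // ler_exp2rW // ltW.
    by rewrite -exprM -exprD.
  have s6 : y ^+ 24 * s ^+ 6 <= x ^+ 24 * rho ^+ 3.
    rewrite /rho; have [_|_] := leP d s.
      apply: le_trans (_ : y ^+ 24 * (x ^+ 16 / y ^+ 40) ^+ 6 <= _).
        by rewrite ler_wpM2l ?exprn_ge0 // ler_exp2rW // ltW.
      rewrite (_ : _ * _ ^+ 6 = x ^+ 24 * d ^+ 3) //; rewrite /d; field.
      by rewrite gt_eqF.
    rewrite (exprD s 3 3) mulrA ler_wpM2r ?exprn_ge0 ?(ltW s0) //.
    apply: le_trans (_ : x ^+ 15 * (x ^+ 3) ^+ 3 <= _).
      by rewrite ler_pM ?exprn_ge0 ?(ltW s0) ?(yk 8%N) // ler_exp2rW // ltW.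
    by rewrite -exprM -exprD.
  have rD0 : 0 <= rho / D by rewrite divr_ge0 // ltW.
  have al0 : 0 <= s / rho by lra.
  have ra0 : 0 <= r'.+1%:R * a'.+1%:R :> R by rewrite mulr_ge0 ?ler0n.
  apply: hC => //; rewrite -(ler_nat R) -?xe.
  - rewrite natr_budget4 -/D -yn; apply: le_trans (_ : D * ((y ^+ 24) ^+ 2 * ((rho / D) ^+ 2 * (s / rho) ^+ 3)) <= _).
      by rewrite ler_pM2l // ler_wpM2l ?exprn_ge0 // ler_pM ?exprn_ge0 ?ler0n // ler_exp2rW ?ler0n.
    apply: le_trans (_ : D * ((s ^+ 3 * y ^+ 48 / rho) / D ^+ 2) <= _).
      by rewrite le_eqVlt; apply/orP; left; apply/eqP; field; rewrite !gt_eqF.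
    apply: DX => //; first by rewrite divr_ge0 ?(ltW rho0) // mulr_ge0 ?exprn_ge0 ?(ltW s0).
    by rewrite ler_pdivrMr.
  - rewrite natr_budget5 -/D -yn; apply: le_trans (_ : D * (y ^+ 24 * (rho / D * (s / rho) ^+ 2) ^+ 3) <= _).
      rewrite ler_pM2l // ler_wpM2l ?exprn_ge0 // ler_exp2rW ?mulr_ge0 ?exprn_ge0 ?ler0n //.
      by rewrite ler_pM ?exprn_ge0 ?ler0n // ler_exp2rW ?ler0n.
    apply: le_trans (_ : D * ((y ^+ 24 * s ^+ 6 / rho ^+ 3) / D ^+ 3) <= _).
      by rewrite le_eqVlt; apply/orP; left; apply/eqP; field; rewrite !gt_eqF.
    apply: DX => //; first by rewrite divr_ge0 ?mulr_ge0 ?exprn_ge0 ?(ltW rho0) ?(ltW s0).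
    by rewrite ler_pdivrMr ?exprn_gt0.
  - rewrite natr_budget6 -/D; apply: le_trans (_ : D * (s ^+ 8 / D ^+ 8) <= _).
      by rewrite ler_pM2l // -expr_div_n ler_exp2rW.
    apply: DX => //; first by rewrite exprn_ge0 // ltW.
    by rewrite -[24%N]/(3 * 8)%N exprM ler_exp2rW // ltW.
  - rewrite natr_budget7 -/D -yn; apply: le_trans (_ : D * ((s ^+ 5 * y ^+ 24) / D ^+ 5) <= _).
      by rewrite ler_pM2l // [leRHS]mulrAC -expr_div_n ler_wpM2r ?exprn_ge0 // ler_exp2rW.
    apply: DX => //; first by rewrite mulr_ge0 ?exprn_ge0 // ltW.
    apply: le_trans (_ : (x ^+ 3) ^+ 5 * x ^+ 9 <= _); last by rewrite -exprM -exprD.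
    by rewrite ler_pM ?exprn_ge0 ?(ltW s0) ?(yk 8%N) // ler_exp2rW // ltW.
  - rewrite natr_budget8 -/D -yn; apply: le_trans (_ : D * (rho / D * (y ^+ 24) ^+ 3) <= _).
      by rewrite ler_pM2l // ler_wpM2r ?exprn_ge0.
    rewrite mulrA [D * _]mulrC divfK ?gt_eqF // -exprM.
    apply: le_trans (_ : d * y ^+ 72 <= _); first by rewrite ler_wpM2r ?exprn_ge0 // ge_min lexx.
    by rewrite /d divfK // gt_eqF // exprn_gt0.
have := un_ge eN at1; rewrite -(ler_nat R) natrX natrM => /(le_trans _); apply.
have low : s / D / 4 <= r'.+1%:R * a'.+1%:R.
  apply: le_trans (_ : (rho / D / 2) * (s / rho / 2) <= _).
    by rewrite le_eqVlt; apply/orP; left; apply/eqP; field; rewrite !gt_eqF.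
  move: q1 al1 r2 a2; clear; move: (rho / D) (s / rho) (r'.+1%:R) (a'.+1%:R) => t u v w ? ? ? ?.
  by apply: ler_pM; lra.
apply: le_trans (_ : (s / D / 4) ^+ 2 <= _); last first.
  by apply: ler_exp2rW => //; rewrite !divr_ge0 ?ler0n // ltW.
apply: le_trans (_ : D ^- 2 / 16 * s ^+ 2 <= _); last first.
  by rewrite le_eqVlt; apply/orP; left; apply/eqP; field; rewrite !gt_eqF.
rewrite ler_pM //.
- by rewrite le_min !divr_ge0 ?ler0n ?invr_ge0 // ltW.
- by rewrite le_min divr_ge0 ?exprn_ge0.
- by rewrite ge_min lexx orbT.
- rewrite /s; have [_|_] := leP (x ^+ 16 / y ^+ 40) (x ^+ 3).
    by rewrite expr_div_n -!exprM ge_min lexx.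
  by rewrite -exprM ge_min lexx orbT.
Qed.

(** Take m about n^(1/2), r m about e^(1/4)/K, q about L/8, and [D] about K n^4/e, an inverse
    density. By the choice of q, Lam^q <= n^(1/8); since 4 D <= Lam^2, the loss (4 D)^q in
    [biclique] is at most n^(1/4). [8 < L] makes q at least 1. *)
Lemma lower_dense (R : realType) : exists c C : R, [/\ 0 < c, 2 <= C & forall (n e : nat) (x y : R),
  0 < x -> 0 < y -> x ^+ 24 = e%:R -> y ^+ 24 = n%:R -> 100 <= y -> C <= y ->
  (e <= 'C(n, 4))%N -> C <= 'C(n, 4)%:R / e%:R ->
  8 < ln (n%:R : R) / ln ('C(n, 4)%:R / e%:R) ->
  c * (x ^+ 6 * (ln n%:R / ln ('C(n, 4)%:R / e%:R))) <= (un 4 n e)%:R].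
Proof.
have [C0 C00 hC] := attains_bicliques; have K1 : 1 <= C0%:R :> R by rewrite ler1n.
set K : R := C0%:R in K1; have K0 : 0 < K by lra.
have K41 : 1 <= K ^+ 4 by rewrite exprn_ege1.
have KK4 : K <= K ^+ 4 by rewrite -[X in X <= _]expr1 ler_weXn2l.
exists (K^-1 / 32), (384 * K ^+ 4); split; [by rewrite divr_gt0 ?ltr0n // invr_gt0 | lra |].
move=> n e x y x0 y0 xe yn y100 yC eN LC L8.
set Lam : R := 'C(n, 4)%:R / e%:R in LC L8 *; set L : R := ln n%:R / ln Lam in L8 *.
have xw : 0 <= x by lra.
have yw : 0 <= y by lra.
have y1 : 1 <= y by lra.
have n0 : (0 < n)%N by rewrite -(ltr_nat R) -yn exprn_gt0.
have e0 : (0 < e)%N by rewrite -(ltr_nat R) -xe exprn_gt0.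
have e0R : 0 < e%:R :> R by rewrite ltr0n.
have n12 : (12 <= n)%N by apply: leq_trans (n_large y0 yn y100).
have Lam1 : 1 < Lam by lra.
have Lam0 : 0 < Lam by lra.
have lnL : 0 < ln Lam by rewrite ln_gt0.
have Nn : y ^+ 96 <= 48 * (Lam * x ^+ 24).
  rewrite /Lam xe divfK ?gt_eqF // -natrM -[96%N]/(24 * 4)%N exprM yn -natrX ler_nat.
  exact: bin4_ge.
have Nn' : Lam * x ^+ 24 <= y ^+ 96.
  rewrite /Lam xe divfK ?gt_eqF // -[96%N]/(24 * 4)%N exprM yn -natrX ler_nat.
  by apply: leq_trans (bin4_le n); rewrite leq_pmull.
have [m' [m1 m2 _]] : exists M : nat, [/\ M.+1%:R <= y ^+ 12, y ^+ 12 <= 2 * M.+1%:R & y ^+ 12 < M.+1%:R + 1].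
  by apply: nat_below; rewrite exprn_ege1.
have [|q' [q1 q2 _]] := @nat_below _ (L / 8); first by rewrite ler_pdivlMr ?ltr0n // mul1r ltW.
have qL : Lam ^+ q'.+1 <= y ^+ 3.
  rewrite -ler_ln ?posrE ?exprn_gt0 // !lnXn //.
  have h : q'.+1%:R * ln Lam <= ln n%:R / 8.
    apply: le_trans (_ : L / 8 * ln Lam <= _); first by rewrite ler_wpM2r // ltW.
    by rewrite mulrAC /L divfK // gt_eqF.
  move: h; rewrite -yn lnXn // -[ln Lam *+ _]mulr_natl -mulr_natl -[ln y *+ 3]mulr_natl; lra.
have Ly : Lam <= y ^+ 3.
  apply: le_trans qL; rewrite -[X in X <= _]expr1 ler_weXn2l //; lra.
have qy : q'.+1%:R <= y ^+ 3.
  apply: le_trans qL; apply: le_trans (_ : 2 ^+ q'.+1 <= _); last by apply: ler_exp2rW; lra.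
  by rewrite -natrX ler_nat; apply: ltnW; apply: ltn_expl.
have x93 : y ^+ 93 <= 48 * x ^+ 24.
  rewrite -(@ler_pM2l _ (y ^+ 3)) ?exprn_gt0 // -exprD; apply: le_trans Nn _.
  by rewrite mulrCA ler_wpM2r // mulr_ge0 ?exprn_ge0.
have M0 : 0 < m'.+1%:R :> R by rewrite ltr0n.
have KM0 : 0 < K * m'.+1%:R by rewrite mulr_gt0.
have r1' : 1 <= x ^+ 6 / (K * m'.+1%:R).
  rewrite ler_pdivlMr // mul1r; apply: le_trans (_ : K * y ^+ 12 <= _); first by rewrite ler_pM2l.
  suff : (K * y ^+ 12) ^+ 4 <= (x ^+ 6) ^+ 4.
    by rewrite ler_pXn2r // nnegrE ?exprn_ge0 // mulr_ge0 ?exprn_ge0 // ltW.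
  rewrite exprMn -!exprM -(@ler_pM2l _ 48) ?ltr0n //; apply: le_trans x93.
  rewrite -[93%N]/(1 + 48 + 44)%N !exprD expr1 mulrA.
  apply: le_trans (_ : y * y ^+ 48 <= _).
    by rewrite ler_wpM2r ?exprn_ge0 //; lra.
  by rewrite ler_peMr ?exprn_ege1 //; apply: mulr_ge0 => //; exact: exprn_ge0.
have [r' [r1 r2 _]] := nat_below r1'.
have rm : r'.+1%:R * m'.+1%:R <= x ^+ 6 / K.
  apply: le_trans (_ : x ^+ 6 / (K * m'.+1%:R) * m'.+1%:R <= _); first by rewrite ler_wpM2r // ltW.
  by rewrite invfM mulrA divfK // gt_eqF.
pose z := K * y ^+ 96 / x ^+ 24.
have z0 : 0 <= z.
  by apply: divr_ge0; [apply: mulr_ge0; [exact: ltW | exact: exprn_ge0] | exact: exprn_ge0].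
pose D := (Num.truncn z).+1.
have D1 : z <= D%:R by rewrite ltW // /D truncnS_gt.
(* The threshold [384 * K ^+ 4] on [Lam] serves here: [D] is O(K Lam), and the second factor [Lam]
   absorbs the constants. *)
have D2 : 4 * D%:R <= Lam ^+ 2.
  have h : D%:R <= z + 1 by rewrite /D -natr1 lerD2r; case/andP: (truncn_itv z0).
  have h2 : z <= 48 * K * Lam.
    rewrite /z ler_pdivrMr ?exprn_gt0 // (_ : 48 * K * Lam * _ = K * (48 * (Lam * x ^+ 24))); last by ring.
    by rewrite ler_pM2l.
  apply: le_trans (_ : 384 * K ^+ 4 * Lam <= _); last by rewrite expr2 ler_wpM2r // ltW.
  have h3 : 1 <= K * Lam by rewrite mulr_ege1 // ltW.
  have h4 : K * Lam <= K ^+ 4 * Lam by rewrite ler_wpM2r // ltW.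
  move: h h2 h3 h4; rewrite -!mulrA; move: (K * Lam) (K ^+ 4 * Lam) (D%:R) => ? ? ? ? ? ? ?; lra.
have at1 : attains_un 4 n e (r'.+1 * (q'.+1 * m'.+1)).
  apply: (hC n e r'.+1 q'.+1 m'.+1 D) => //; rewrite -(ler_nat R).
  - rewrite natr_budget6 -/K -xe; apply: le_trans (_ : K * (x ^+ 6 / K) ^+ 4 <= _).
      by rewrite ler_pM2l // ler_exp2rW // mulr_ge0 // ltW.
    rewrite (_ : K * _ = x ^+ 24 / K ^+ 3); last by field; rewrite gt_eqF.
    by rewrite ler_pdivrMr ?exprn_gt0 // ler_peMr ?exprn_ge0 // exprn_ege1.
  - rewrite natr_budget8 natrM -/K -xe -yn -exprM.
    have h1 : K * r'.+1%:R <= 2 * y ^+ 12.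
      apply: le_trans (_ : K * (x ^+ 6 / (K * m'.+1%:R)) <= _); first by rewrite ler_pM2l.
      rewrite invfM mulrCA mulVKf ?gt_eqF // ler_pdivrMr //.
      apply: le_trans (_ : y ^+ 24 <= _).
        suff : (x ^+ 6) ^+ 4 <= (y ^+ 24) ^+ 4 by rewrite ler_pXn2r // nnegrE exprn_ge0.
        rewrite -!exprM; apply: le_trans Nn'; rewrite ler_peMl ?exprn_ge0 // ltW //.
      rewrite (exprD y 12 12) (_ : 2 * _ * _ = y ^+ 12 * (2 * m'.+1%:R)); last by ring.
      by rewrite ler_wpM2l ?exprn_ge0.
    apply: le_trans (_ : 2 * y ^+ 12 * y ^+ 3 * y ^+ 72 <= _).
      rewrite [K * _]mulrA [K * (_ * q'.+1%:R)]mulrA ler_wpM2r ?exprn_ge0 //.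
      by rewrite ler_pM ?ler0n // mulr_ge0 ?ler0n // ltW.
    have y6 : 100 <= y ^+ 6.
      by apply: le_trans y100 _; rewrite -[X in X <= _]expr1 ler_weXn2l.
    have -> : 2 * y ^+ 12 * y ^+ 3 * y ^+ 72 = 2 * y ^+ 87 by ring.
    have y87 : 0 <= y ^+ 87 by rewrite exprn_ge0.
    have : 100 * y ^+ 87 <= y ^+ 6 * y ^+ 87 by rewrite ler_wpM2r.
    by rewrite -exprD; move: x93 y87; move: (y ^+ 87) (y ^+ 93) (x ^+ 24) => u v w; lra.
  - rewrite natrM natrX natrM -/K -xe -yn -exprM.
    by move: D1; rewrite /z ler_pdivrMr ?exprn_gt0.
  - rewrite natrM natrM -yn.
    apply: le_trans (_ : (y ^+ 3) ^+ 2 * y ^+ 3 <= _).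
      rewrite ler_pM ?mulr_ge0 ?ler0n //; apply: le_trans D2 _.
      by apply: ler_exp2rW Ly; exact: ltW.
    by rewrite -exprM -exprD ler_weXn2l.
  - rewrite natrM natrX natrM natrM natrM -yn.
    apply: le_trans (_ : (y ^+ 3) ^+ 2 * ((y ^+ 3) ^+ 2 * y ^+ 12) <= _); last first.
      by rewrite -!exprM -!exprD ler_weXn2l.
    have D0 : 0 <= D%:R :> R by rewrite ler0n.
    have L2 : Lam ^+ 2 <= (y ^+ 3) ^+ 2 by apply: ler_exp2rW Ly; exact: ltW.
    have D40 : 0 <= 4 * D%:R :> R by rewrite mulr_ge0 ?ler0n.
    have D20 : 0 <= 2 * D%:R :> R by rewrite mulr_ge0 ?ler0n.
    have D24 : 2 * D%:R <= 4 * D%:R :> R by rewrite ler_wpM2r // ler_nat.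
    have M1 := ltW M0.
    apply: ler_pM; first (by rewrite exprn_ge0); first (by rewrite mulr_ge0).
      apply: le_trans (_ : (Lam ^+ 2) ^+ q'.+1 <= _); first exact: ler_exp2rW.
      by rewrite -exprM mulnC exprM ler_exp2rW // exprn_ge0 // ltW.
    by apply: ler_pM => //; exact: le_trans D24 (le_trans D2 L2).
have := un_ge eN at1; rewrite -(ler_nat R) natrM natrM => /(le_trans _); apply.
apply: le_trans (_ : x ^+ 6 / K / 2 * (L / 8 / 2) <= _).
  by rewrite le_eqVlt; apply/orP; left; apply/eqP; field; rewrite !gt_eqF.
have rmlow : x ^+ 6 / K / 2 <= r'.+1%:R * m'.+1%:R.
  apply: le_trans (_ : x ^+ 6 / (K * m'.+1%:R) / 2 * m'.+1%:R <= _).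
    suff -> : x ^+ 6 / (K * m'.+1%:R) / 2 * m'.+1%:R = x ^+ 6 / K / 2 by [].
    by move: (m'.+1%:R) M0 => mm mm0; field; rewrite !gt_eqF.
  by rewrite ler_wpM2r // ler_pdivrMr ?ltr0n // [leRHS]mulrC.
rewrite (_ : r'.+1%:R * _ = r'.+1%:R * m'.+1%:R * q'.+1%:R); last by ring.
have K6 : 0 <= x ^+ 6 / K by rewrite divr_ge0 ?exprn_ge0 // ltW.
have L0 : 0 <= L / 8 by rewrite divr_ge0 ?ler0n // (le_trans _ (ltW L8)) ?ler0n.
apply: ler_pM rmlow _; first (by apply: divr_ge0 K6 _); first (by apply: divr_ge0 L0 _).
by rewrite ler_pdivrMr ?ltr0n // [leRHS]mulrC.
Qed.

(** * Assembling the estimates *)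

Lemma ler_mul_min (R : realType) (C m a b : R) : m <= C * a -> m <= C * b -> m <= C * Num.min a b.
Proof. by move=> ma mb; have [_|_] := leP a b. Qed.

Section Upper.
Variable R : realType.
Variables (n e : nat) (x y : R).
Hypotheses (x0 : 0 < x) (y0 : 0 < y) (xe : x ^+ 24 = e%:R) (yn : y ^+ 24 = n%:R) (y100 : 100 <= y).

Lemma upper_ii : y ^+ 2 <= x -> x <= y ^+ 3 ->
  (un 4 n e)%:R <= 144 * (500 * 500) * Num.min ((x / y ^+ 2) ^+ 18) ((x / y) ^+ 8).
Proof.
move=> yx xy; have [T [H [uH unH <-]]] := un_witness (le_e_bin x0 y0 xe yn y100 xy).
have ht := card_t x0 y0 xe yn y100 uH unH xy yx.
have p0 : 0 <= (x / y) ^+ 8 by rewrite exprn_ge0 // divr_ge0 // ltW.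
have {}ht : #|H|%:R <= 144 * (500 * 500) * (x / y) ^+ 8.
  by apply: le_trans ht _; rewrite -expr_div_n; move: p0; move: ((x / y) ^+ 8) => z; lra.
apply: ler_mul_min => //.
(* The two terms of the minimum cross here; beyond the crossing the bound by (e/n)^(1/3) is the
   smaller one and already suffices. *)
have [k|k] := leP (x ^+ 10) (y ^+ 28).
  have := card_k x0 y0 xe yn y100 uH unH xy yx k.
  by rewrite [144 * (_ * _)]mulrA (_ : (x ^+ 6 / y ^+ 12) ^+ 3 = (x / y ^+ 2) ^+ 18) //; field; rewrite gt_eqF.
apply: le_trans ht _; rewrite ler_wpM2l ?mulr_ge0 ?ler0n //.
rewrite (_ : (x / y ^+ 2) ^+ 18 = (x / y) ^+ 8 * (x ^+ 10 / y ^+ 28)); last by field; rewrite gt_eqF.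
by rewrite ler_peMr // ler_pdivlMr ?exprn_gt0 // mul1r ltW.
Qed.

Lemma upper_iii : y ^+ 3 <= x -> (e <= 'C(n, 4))%N -> 12 <= 'C(n, 4)%:R / e%:R :> R ->
  (un 4 n e)%:R <= 8 * (144 * 192) *
    Num.min (x ^+ 32 / y ^+ 80) (x ^+ 6 * (ln n%:R / ln ('C(n, 4)%:R / e%:R))).
Proof.
move=> yx eN; set Lam : R := _ / _ => L12.
have xw : 0 <= x := ltW x0.
have yw : 0 <= y := ltW y0.
have y1 : 1 <= y by apply: le_trans y100; rewrite ler1n.
have x1 : 1 <= x by apply: le_trans yx; rewrite exprn_ege1.
have n0 : (0 < n)%N by rewrite -(ltr_nat R) -yn exprn_gt0.
have e0 : (0 < e)%N by rewrite -(ltr_nat R) -xe exprn_gt0.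
have e0R : 0 < e%:R :> R by rewrite ltr0n.
have n12 : (12 <= n)%N by apply: leq_trans (n_large y0 yn y100).
have Lam0 : 0 < Lam by apply: lt_le_trans L12; rewrite ltr0n.
have Lam1 : 1 < Lam by apply: lt_le_trans L12; rewrite ltr1n.
have lnL : 0 < ln Lam by rewrite ln_gt0.
have lnn : 0 <= ln (n%:R : R) by rewrite ln_ge0 // ler1n.
have NE : Lam * x ^+ 24 = 'C(n, 4)%:R by rewrite /Lam xe divfK ?gt_eqF.
have h100 : 100 * x ^+ 24 <= y ^+ 96.
  have : 24 * 'C(n, 4)%:R <= y ^+ 96 by rewrite -[96%N]/(24 * 4)%N exprM yn -natrX -natrM ler_nat bin4_le.
  have : 12 * x ^+ 24 <= Lam * x ^+ 24 by rewrite ler_wpM2r ?exprn_ge0.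
  rewrite NE; move: (exprn_ge0 24 xw); move: (x ^+ 24) ('C(n, 4)%:R) (y ^+ 96) => u v w; lra.
have [T [H [uH unH <-]]] := un_witness eN.
have h1 := cover_big x0 y0 xe yn y100 uH unH yx h100.
have h2 := clique_big x0 y0 xe yn y100 uH unH yx h100.
have := random_ln R n0 e0 eN uH unH; rewrite -/Lam => rnd.
pose L := ln (n%:R : R) / ln Lam.
have L0 : 0 <= L by rewrite divr_ge0 // ltW.
have {}rnd : #|H|%:R <= #|cover H|%:R * L by rewrite /L mulrA ler_pdivlMr.
have A0 : 0 <= x ^+ 32 / y ^+ 80 by rewrite divr_ge0 ?exprn_ge0.
have mB : #|H|%:R <= 36 * (x ^+ 6 * L) by apply: le_trans rnd _; rewrite mulrA ler_wpM2r.
have B0 : 0 <= x ^+ 6 * L by rewrite mulr_ge0 ?exprn_ge0.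
apply: ler_mul_min; last first.
  by apply: le_trans mB _; rewrite -/L; move: B0; move: (x ^+ 6 * L) => z; lra.
(* For L <= 8 the vertex bound [h1] loses a factor 8. Otherwise [Lam] is at most n^(1/8), so e is
   close enough to n^4 for the first term to dominate the second up to a constant. *)
have [L8|L8] := leP L 8.
  apply: le_trans rnd _; rewrite -[8 * _ * _]mulrA [8 * _]mulrC.
  by apply: ler_pM.
apply: le_trans mB _.
have Ly : Lam <= y ^+ 3.
  rewrite -ler_ln ?posrE ?exprn_gt0 // lnXn //.
  move: (ltW L8); rewrite /L ler_pdivlMr // -yn lnXn // -mulr_natl -[ln y *+ 3]mulr_natl.
  by move: (ln y) (ln Lam) => u v; lra.
have Nn : y ^+ 96 <= 48 * (Lam * x ^+ 24).
  by rewrite NE -natrM -[96%N]/(24 * 4)%N exprM yn -natrX ler_nat bin4_ge.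
have x93 : y ^+ 93 <= 48 * x ^+ 24.
  rewrite -(@ler_pM2l _ (y ^+ 3)) ?exprn_gt0 // -exprD; apply: le_trans Nn _.
  by rewrite mulrCA ler_wpM2r // mulr_ge0 ?exprn_ge0.
have Lyy : L <= 48 * y.
  (* Both logarithm estimates come from ln (1 + t) <= t, at t = 1/Lam - 1 and at t = y - 1. *)
  have l2 : 2^-1 <= ln Lam.
    have Li : Lam^-1 <= 2^-1 by rewrite lef_pV2 ?posrE ?ltr0n //; lra.
    have Li0 : 0 < Lam^-1 by rewrite invr_gt0.
    have h : -1 < Lam^-1 - 1 by lra.
    by have := le_ln1Dx h; rewrite addrC subrK lnV ?posrE //; lra.
  rewrite /L ler_pdivrMr // -yn lnXn // -[ln y *+ 24]mulr_natl.
  have ly : ln y <= y.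
    have h : -1 < y - 1 by lra.
    by have := le_ln1Dx h; rewrite addrC subrK; lra.
  apply: le_trans (_ : 48 * y * 2^-1 <= _); last by rewrite ler_wpM2l ?mulr_ge0.
  by move: (ln y) ly => u; lra.
apply: le_trans (_ : 36 * (x ^+ 6 * (48 * y)) <= _).
  by rewrite ler_wpM2l ?ler0n // ler_wpM2l ?exprn_ge0.
have key : x ^+ 6 * y <= x ^+ 32 / y ^+ 80.
  rewrite ler_pdivlMr ?exprn_gt0 // -mulrA -exprS (exprD x 6 26) ler_wpM2l ?exprn_ge0 //.
  apply: le_trans (_ : x ^+ 24 <= _); last by rewrite ler_weXn2l.
  have y81 : 0 <= y ^+ 81 by rewrite exprn_ge0.
  have : 100 * y ^+ 81 <= y ^+ 12 * y ^+ 81.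
    rewrite ler_wpM2r //; apply: le_trans y100 _.
    by rewrite -[X in X <= _]expr1 ler_weXn2l.
  rewrite -exprD; move: x93 y81; move: (y ^+ 93) (y ^+ 81) (x ^+ 24) => u v w; lra.
rewrite (_ : 36 * _ = 36 * 48 * (x ^+ 6 * y)); last by ring.
by move: key A0; move: (x ^+ 6 * y) (x ^+ 32 / y ^+ 80) => u v; lra.
Qed.
End Upper.

Lemma root24_cmp (R : realType) (n e k : nat) (x y : R) :
  0 < x -> 0 < y -> x ^+ 24 = e%:R -> y ^+ 24 = n%:R ->
  ((y ^+ k <= x) = (n ^ k <= e)%N) * ((x <= y ^+ k) = (e <= n ^ k)%N).
Proof.
move=> x0 y0 xe yn; have ynk : (y ^+ k) ^+ 24 = (n ^ k)%:R.
  by rewrite -exprM mulnC exprM yn natrX.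
have yk : 0 <= y ^+ k by rewrite exprn_ge0 // ltW.
split.
  by rewrite -(@ler_pXn2r _ 24) ?nnegrE ?(ltW x0) // ynk xe ler_nat.
by rewrite -(@ler_pXn2r _ 24) ?nnegrE ?(ltW x0) // ynk xe ler_nat.
Qed.

Theorem theorem1p1 (R : realType) :
  [/\ approx_on (fun n e => (1 <= e <= n ^ 2)%N)
        (fun n e => (un 4 n e)%:R : R)
        (fun n e => 1),
      approx_on (fun n e => (n ^ 2 <= e <= n ^ 3)%N)
        (fun n e => (un 4 n e)%:R : R)
        (fun n e => Num.min ((e%:R / n%:R ^+ 2) `^ (3 / 4))
                            ((e%:R / n%:R) `^ (1 / 3)))
    & exists2 c0 : R, 0 < c0 &
      approx_on (fun n e => (n ^ 3 < e)%N /\ e%:R <= c0 * 'C(n, 4)%:R)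
        (fun n e => (un 4 n e)%:R : R)
        (fun n e => Num.min (e%:R `^ (4 / 3) / n%:R `^ (10 / 3))
                            (e%:R `^ (1 / 4) * ln n%:R
                               / ln ('C(n, 4)%:R / e%:R)))].
Proof.
have roots (C : R) : exists n0 : nat, forall n : nat, (n0 <= n)%N ->
    (0 < n)%N /\ exists y : R, [/\ 0 < y, y ^+ 24 = n%:R, 100 <= y & C <= y].
  have [n1 l1] := root24_large (100 : R); have [n2 l2] := root24_large C.
  exists (maxn 1 (maxn n1 n2)) => n; rewrite !geq_max => /and3P[n0 h1 h2]; split=> //.
  have [y y0 yn] := root24 R n0.
  by exists y; split=> //; [exact: l1 yn | exact: l2 yn].
split.
- exists 1, (144 * (500 * 500)); rewrite ltr01; split=> //; first by rewrite !mulr_gt0 ?ltr0n.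
  have [n0 hn0] := roots 0; exists n0 => n e /hn0[n1 [y [y0 yn y100 _]]] /andP[e1 en].
  (* By monotonicity (i) follows from the upper bound of (ii) at e = n^2, where the first term of
     the minimum is 1. *)
  have y20 : 0 < y ^+ 2 by rewrite exprn_gt0.
  have y2 : (y ^+ 2) ^+ 24 = (n ^ 2)%:R by rewrite -exprM mulnC exprM yn natrX.
  have yy : y ^+ 2 <= y ^+ 3 by rewrite ler_weXn2l //; apply: le_trans y100; rewrite ler1n.
  have n2N := le_e_bin y20 y0 y2 yn y100 yy.
  have := upper_ii y20 y0 y2 yn y100 (lexx _) yy => h.
  apply/andP; split; first by rewrite mulr1 ler1n un_gt0 // (leq_trans en).
  apply: le_trans (le_trans _ h) _; first by rewrite ler_nat un_mono.
  by rewrite ler_wpM2l ?mulr_ge0 ?ler0n // ge_min divff ?gt_eqF // expr1n lexx.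
- have [c c0 low] := lower_ii R.
  exists c, (144 * (500 * 500)); split=> //; first by rewrite !mulr_gt0 ?ltr0n.
  have [n0 hn0] := roots 0; exists n0 => n e /hn0[n1 [y [y0 yn y100 _]]] /andP[ne en].
  have e0 : (0 < e)%N by apply: leq_trans ne; rewrite expn_gt0 n1.
  have [x x0 xe] := root24 R e0.
  have yx : y ^+ 2 <= x by rewrite (root24_cmp _ x0 y0 xe yn).
  have xy : x <= y ^+ 3 by rewrite (root24_cmp _ x0 y0 xe yn).
  have -> : e%:R / n%:R ^+ 2 = (x / y ^+ 2) ^+ 24.
    by rewrite expr_div_n xe -exprM mulnC exprM yn.
  have -> : e%:R / n%:R = (x / y) ^+ 24 by rewrite expr_div_n xe yn.
  rewrite (@powR_root _ _ 3 4 18) ?divr_gt0 ?exprn_gt0 //.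
  rewrite (@powR_root _ _ 1 3 8) ?divr_gt0 ?exprn_gt0 //.
  by rewrite low // upper_ii.
have [c3 [C3 [c30 C31 low3]]] := lower_iii R; have [c4 [C4 [c40 C42 low4]]] := lower_dense R.
(* This forces the ratio of binomial to e above both 12, for [upper_iii], and [C4], for
   [lower_dense]. *)
exists (C4 + 12)^-1; first by rewrite invr_gt0; lra.
exists (Num.min (c3 / 8) c4), (8 * (144 * 192)).
split; first by rewrite lt_min c40 divr_gt0.
  by rewrite !mulr_gt0 ?ltr0n.
have [n0 hn0] := roots (C3 + C4); exists n0 => n e /hn0[n1 [y [y0 yn y100 yC]]] [ne eN].
have e0 : (0 < e)%N by apply: leq_trans ne.
have e0R : 0 < e%:R :> R by rewrite ltr0n.
have LC : C4 + 12 <= 'C(n, 4)%:R / e%:R.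
  by rewrite ler_pdivlMr // -ler_pdivlMl //; lra.
have {}eN : (e <= 'C(n, 4))%N.
  rewrite -(ler_nat R) -[leLHS]mul1r -ler_pdivlMr //; lra.
have [x x0 xe] := root24 R e0.
have yx : y ^+ 3 <= x by rewrite (root24_cmp _ x0 y0 xe yn) ltnW.
have L12 : 12 <= 'C(n, 4)%:R / e%:R :> R by lra.
have L4 : C4 <= 'C(n, 4)%:R / e%:R by lra.
have yC3 : C3 <= y by lra.
have yC4 : C4 <= y by lra.
have -> : e%:R `^ (4 / 3) = x ^+ 32 by rewrite -xe (@powR_root _ _ 4 3 32).
have -> : n%:R `^ (10 / 3) = y ^+ 80 by rewrite -yn (@powR_root _ _ 10 3 80).
have -> : e%:R `^ (1 / 4) = x ^+ 6 by rewrite -xe (@powR_root _ _ 1 4 6).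
rewrite -mulrA (upper_iii x0 y0 xe yn) // andbT.
have := low4 _ _ _ _ x0 y0 xe yn y100 yC4 eN L4.
have := low3 _ _ _ _ x0 y0 xe yn y100 yC3 yx eN.
have : 0 <= ln (n%:R : R) / ln ('C(n, 4)%:R / e%:R).
  by rewrite divr_ge0 // ln_ge0 ?ler1n //; lra.
have : 0 <= x ^+ 6 by rewrite exprn_ge0 // ltW.
have : 0 <= x ^+ 32 / y ^+ 80 by rewrite divr_ge0 // exprn_ge0 // ltW.
move: (ln (n%:R : R) / ln ('C(n, 4)%:R / e%:R)) (x ^+ 6) (x ^+ 32 / y ^+ 80) ((un 4 n e)%:R : R) => L X A u A0 X0 L0 h3 h4.
have m0 : 0 <= Num.min A (X * L) by rewrite le_min A0 mulr_ge0.
(* For L <= 8 the second term is at most 8 e^(1/4), so star forests reach the minimum up to a factor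
   8; for larger L biclique forests are used. *)
have [L8|L8] := leP L 8.
  apply: le_trans h3; apply: le_trans (_ : c3 / 8 * Num.min A (X * L) <= _).
    by rewrite ler_wpM2r // ge_min lexx.
  rewrite -mulrA ler_wpM2l ?(ltW c30) // le_min; apply/andP; split.
    have : Num.min A (X * L) <= A by rewrite ge_min lexx.
    by lra.
  have : Num.min A (X * L) <= X * L by rewrite ge_min lexx orbT.
  have : X * L <= X * 8 by rewrite ler_wpM2l.
  by lra.
apply: le_trans (h4 L8); apply: ler_pM => //.
- by rewrite le_min !ltW // divr_gt0.
- by rewrite ge_min lexx orbT.
- by rewrite ge_min lexx orbT.
Qed.
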